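(* Let $\ell\in\mathbb{Z}_+$, let $g:\boldsymbol{\Omega}_\ell\to\mathbb{R}$ belong to the class $\mathcal{L}$, and assume $\mathbb{P}$ is ergodic. Then $\Lambda_\ell(g)$ is deterministic. The following properties hold for $\mathbb{P}$-a.e. $\omega$. (a) If $\Lambda_\ell(g)=\infty$ then $\Lambda_\ell(g,\zeta)$ is identically $+\infty$ for $\zeta\in\mathrm{ri}\,\mathcal{U}$. (b) Suppose $\Lambda_\ell(g)<\infty$. Then $\Lambda_\ell(g,\cdot\,;\omega)$ is lower semicontinuous and bounded on $\mathcal{U}$ and concave and continuous on $\mathrm{ri}\,\mathcal{U}$. The upper semicontinuous regularization of $\Lambda_\ell(g,\cdot\,;\omega)$ and its unique continuous extension from $\mathrm{ri}\,\mathcal{U}$ to $\mathcal{U}$ are equal and deterministic.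
   Context: Fix $d\in\mathbb{N}$ and a finite nonempty set $\mathcal{R}\subset\mathbb{Z}^d$. Let $\mathcal{G}=\{\sum_{z\in\mathcal{R}}a_z z: a_z\in\mathbb{Z}\}$ be the additive group generated by $\mathcal{R}$ and let $\mathcal{U}$ be the convex hull of $\mathcal{R}$ in $\mathbb{R}^d$; $\mathrm{ri}$ denotes relative interior. $P$ (expectation $E$) is the law of the random walk $(X_k)_{k\ge 0}$ on $\mathbb{Z}^d$ with $X_0=0$ and i.i.d. steps $Z_k=X_k-X_{k-1}$ uniformly distributed on $\mathcal{R}$; $Z_{i,j}=(Z_i,\dots,Z_j)$. $E$ averages over the walk only, with $\omega$ fixed. $(\Omega,\mathfrak{S},\mathbb{P},\{T_z:z\in\mathcal{G}\})$ is a measurable dynamical system: $(\Omega,\mathfrak S,\mathbb P)$ is a probability space, the $T_z$ are measurable commuting transformations of $\Omega$ with $T_{x+y}=T_xT_y$ and $T_0$ the identity, and $\mathbb{P}$ is invariant under all $T_z$. $\mathbb{P}$ is ergodic if every event $A$ with $T_z^{-1}A=A$ for all $z\in\mathcal{R}$ has $\mathbb{P}(A)\in\{0,1\}$. $\boldsymbol{\Omega}_\ell=\Omega\times\mathcal{R}^\ell$, with $\boldsymbol{\Omega}_0=\Omega$. A measurable function $g:\boldsymbol{\Omega}_\ell\to\mathbb{R}$ is in class $\mathcal{L}$ if for each $\tilde z_{1,\ell}\in\mathcal{R}^\ell$: $g(\cdot,\tilde z_{1,\ell})\in L^1(\mathbb{P})$, and for every nonzero $z\in\mathcal{R}$, $$\varlimsup_{\varepsilon\searrow0}\varlimsup_{n\to\infty}\max_{x\in\mathcal{G}:|x|\le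 n}\frac1n\sum_{0\le k\le\varepsilon n}|g(T_{x+kz}\omega,\tilde z_{1,\ell})|=0\quad\text{for }\mathbb{P}\text{-a.e. }\omega.$$ Lattice points $\hat x_n(\zeta)$: for each $\zeta\in\mathcal{U}$ fix weights $\beta_z(\zeta)\in[0,1]$, $z\in\mathcal{R}$, with $\sum_z\beta_z(\zeta)=1$ and $\zeta=\sum_{z}\beta_z(\zeta)z$; when $\zeta\in\mathcal{U}\cap\mathbb{Q}^d$ the weights are required to be rational. Then $\hat x_n(\zeta)=\sum_{z\in\mathcal{R}}(\lfloor n\beta_z(\zeta)\rfloor+b_z^{(n)}(\zeta))z$ for $n\in\mathbb{Z}_+$, where $b_z^{(n)}(\zeta)\in\{0,1\}$ are arbitrary subject to: $b_z^{(n)}(\zeta)=0$ if $\beta_z(\zeta)=0$, and $\sum_z b_z^{(n)}(\zeta)=n-\sum_z\lfloor n\beta_z(\zeta)\rfloor$. Free energies (for $g\in\mathcal{L}$ these limits exist in $(-\infty,\infty]$ for $\mathbb{P}$-a.e. $\omega$, the first simultaneously for all $\zeta\in\mathcal{U}$ and independently of the choices defining $\hat x_n(\zeta)$): $$\Lambda_\ell(g,\zeta)=\Lambda_\ell(g,\zeta;\omega)=\lim_{n\to\infty}n^{-1}\log E\Big[e^{\sum_{k=0}^{n-1}g(T_{X_k}\omega,Z_{k+1,k+\ell})}\mathbf{1}\{X_n=\hat x_n(\zeta)\}\Big],$$ $$\Lambda_\ell(g)=\Lambda_\ell(g;\omega)=\lim_{n\to\infty}n^{-1}\log E\Big[e^{\sum_{k=0}^{n-1}g(T_{X_k}\omega,Z_{k+1,k+\ell})}\Big].$$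 The upper semicontinuous regularization of $f$ on $\mathcal U$ is $f^{\mathrm{usc}}(x)=\inf_{B\ni x\text{ open}}\sup_{y\in B\cap\mathcal{U}}f(y)$. ''Deterministic'' means $\mathbb{P}$-a.s. equal to a nonrandom quantity (function). *)

(* Defs.v *)
From HB Require Import structures.
From mathcomp Require Import all_boot all_order all_algebra finmap.
From mathcomp Require Import all_classical all_reals all_analysis.

Set Implicit Arguments.
Unset Strict Implicit.
Unset Printing Implicit Defensive.

Import Order.TTheory GRing.Theory Num.Theory.
Import numFieldNormedType.Exports.

Local Open Scope classical_set_scope.
Local Open Scope ring_scope.

Section convex_geometry.
Context {R : realType} {d : nat}.
Implicit Types (A B : set 'rV[R]_d) (f h : 'rV[R]_d -> \bar R).

Definition conv_hull A : set 'rV[R]_d :=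
  [set x | exists m (p : 'I_m -> 'rV[R]_d) (a : 'I_m -> R),
    [/\ forall i, A (p i), forall i, 0 <= a i, \sum_i a i = 1
      & x = \sum_i a i *: p i]].

Definition affine_hull A : set 'rV[R]_d :=
  [set x | exists m (p : 'I_m -> 'rV[R]_d) (a : 'I_m -> R),
    [/\ forall i, A (p i), \sum_i a i = 1 & x = \sum_i a i *: p i]].

Definition relint A : set 'rV[R]_d :=
  [set x | A x /\ within (affine_hull A) (nbhs x) A].

Definition bounded_on A f :=
  exists M : R, forall x, A x -> (`|f x| <= M%:E)%E.

Definition concave_on A f := forall x y (t : R), A x -> A y -> 0 <= t <= 1 ->
  (t%:E * f x + (1 - t)%:E * f y <= f (t *: x + (1 - t) *: y)%R)%E.

Definition lsc_on A f := lower_semicontinuous (f : subspace A -> \bar R).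

(* [f] is only looked at on [A]. *)
Definition usc_reg A f (x : 'rV[R]_d) : \bar R :=
  ereal_inf [set ereal_sup [set f y | y in B `&` A]
            | B in [set B | open B /\ B x]].

Definition cont_ext A B f h :=
  {within B, continuous h} /\ (forall x, A x -> h x = f x).

Definition unique_cont_ext A B f h :=
  cont_ext A B f h /\
  forall h', cont_ext A B f h' -> forall x, B x -> h' x = h x.

End convex_geometry.

Section steps.
Context {R : realType} {d : nat}.
Variable Rs : {fset 'rV[int]_d}.

Definition real_pt (x : 'rV[int]_d) : 'rV[R]_d := map_mx intr x.

Definition euclid_norm (x : 'rV[int]_d) : R :=
  Num.sqrt (\sum_i ((x 0 i)%:~R) ^+ 2).

Definition step_group : set 'rV[int]_d :=
  [set x | exists a : Rs -> int, x = \sum_z a z *: val z].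

Definition step_hull : set 'rV[R]_d :=
  conv_hull [set real_pt (val z) | z in [set: Rs]].

Definition step_weights (beta : 'rV[R]_d -> Rs -> R) :=
  forall zeta, step_hull zeta ->
  [/\ forall z, 0 <= beta zeta z <= 1,
      \sum_z beta zeta z = 1,
      zeta = \sum_z beta zeta z *: real_pt (val z)
    & (forall i, range (@ratr R) (zeta 0 i)) ->
      forall z, range (@ratr R) (beta zeta z)].

Definition rounding (beta : 'rV[R]_d -> Rs -> R)
    (b : nat -> 'rV[R]_d -> Rs -> bool) :=
  forall n zeta, step_hull zeta ->
    (forall z, beta zeta z = 0 -> b n zeta z = false) /\
    \sum_z (b n zeta z : nat)%:Z
      = n%:Z - \sum_z Num.floor (n%:R * beta zeta z).

Definition lattice_pt (beta : 'rV[R]_d -> Rs -> R)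
    (b : nat -> 'rV[R]_d -> Rs -> bool) (n : nat) (zeta : 'rV[R]_d) :
    'rV[int]_d :=
  \sum_z (Num.floor (n%:R * beta zeta z) + (b n zeta z : nat)%:Z) *: val z.

End steps.

Section environment.
Context {R : realType} {d : nat} (Rs : {fset 'rV[int]_d}).
Context {dO : measure_display} {Om : measurableType dO}.
Variables (PP : probability Om R) (T : 'rV[int]_d -> Om -> Om).

(* Only the maps [T x] with [x] in the group generated by the steps matter. *)
Definition dynamical_system :=
  [/\ T 0 = id,
      forall x y, step_group Rs x -> step_group Rs y ->
        T (x + y) = T x \o T y,
      forall x, step_group Rs x -> measurable_fun setT (T x)
    & forall x A, step_group Rs x -> measurable A -> PP (T x @^-1` A) = PP A].

Definition ergodic := forall A, measurable A ->
  (forall z : Rs, T (val z) @^-1` A = A) -> PP A = 0%E \/ PP A = 1%E.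

(* The choice of the Euclidean norm is immaterial: any two norms on R^d yield
   the same class.
   The sigma-algebra on the first line is the product of that of [Om] with the
   discrete one; [l.-tuple Rs] is not a [measurableType] because it is not
   pointed. *)
Definition class_L (l : nat) (g : Om * l.-tuple Rs -> R) :=
  [/\ forall B, measurable B ->
        <<s [set A `*` C | A in measurable & C in setT] >> (g @^-1` B),
      forall zs, PP.-integrable setT (fun om => (g (om, zs))%:E)
    & forall zs (z : Rs), val z != 0 ->
        {ae PP, forall om,
          limf_esup (fun eps : R => limn_esup (fun n : nat =>
            ereal_sup
              [set (n%:R^-1 * \sum_(0 <= k < (Num.truncn (eps * n%:R)).+1)
                      `|g (T (x + val z *+ k) om, zs)|)%:E
              | x in [set x | step_group Rs x /\ euclid_norm x <= n%:R :> R]]))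
            0^'+ = 0%E}].

End environment.

Section walk.
Context {R : realType} {d : nat} {Rs : {fset 'rV[int]_d}}.
Context {dW : measure_display} {W : measurableType dW}.
Variables (P : probability W R) (Z : nat -> W -> Rs).

(* Indices start at 0: [Z k] is the step from time k to time k + 1. *)
Definition iid_uniform_steps :=
  [/\ forall k (B : set Rs), measurable (Z k @^-1` B),
      forall k z, P (Z k @^-1` [set z]) = (#|` Rs|%:R^-1)%:E
    & forall (J : {fset nat}) (B : nat -> set Rs),
        P (\bigcap_(k in [set` J]) Z k @^-1` B k) =
        (\prod_(k <- J) P (Z k @^-1` B k))%E].

Definition walk_pos (n : nat) (w : W) : 'rV[int]_d :=
  \sum_(k < n) val (Z k w).

Context {dO : measure_display} {Om : measurableType dO}.
Variables (T : 'rV[int]_d -> Om -> Om).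
Variables (l : nat) (g : Om * l.-tuple Rs -> R).

Definition potential_sum (om : Om) (n : nat) (w : W) : R :=
  \sum_(k < n) g (T (walk_pos k w) om, [tuple Z (k + i)%N w | i < l]).

(* [limn] is a total operator, meaningful only where the sequence converges;
   for [g] in class L it does so for almost every [om]. *)
Definition free_energy (om : Om) : \bar R :=
  limn (fun n : nat =>
    (n%:R^-1)%:E * lne ('E_P[fun w => expR (potential_sum om n w)]))%E.

(* [xhat n zeta] is the lattice point at which the walk is pinned at time n. *)
Definition free_energy_pt (xhat : nat -> 'rV[R]_d -> 'rV[int]_d)
    (om : Om) (zeta : 'rV[R]_d) : \bar R :=
  limn (fun n : nat =>
    (n%:R^-1)%:E *
    lne ('E_P[fun w => (expR (potential_sum om n w) *
                        \1_[set w' | walk_pos n w' = xhat n zeta] w)%R]))%E.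

End walk.

(* Main.v *)
Require Import Defs.
From HB Require Import structures.
From mathcomp Require Import all_boot all_order all_algebra finmap.
From mathcomp Require Import all_classical all_reals all_analysis.
From mathcomp Require Import measurable_realfun.
From mathcomp Require Import zify ring lra.

(* Paths are recorded by count vectors u in N^Rs. Let H u be the logarithm of the
   partition function over the paths with |u| steps that end where u ends. After
   replacing g near the end of a path by minus an envelope, H is superadditive
   under concatenation (up to a shift of the environment), so Kingman's theorem
   gives a.s. limits of H (k u) / (k |u|) along all of the countably many rays.
   The class L condition says that few additional steps can be made at small
   cost; hence the limits in all directions are squeezed between rays, and do
   not depend on the weights chosen: by the pigeonhole principle two weights of
   the same point have nearby count vectors with the same displacement.

   The ray limits of positive vectors are monotone under every shift, hence
   constant by ergodicity. They are superadditive, because a.s. convergence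
   gives convergence in probability and the environment is stationary. This
   yields concavity in the relative interior, and, the total free energy being
   the supremum of the ray limits, also the dichotomy (a). Finally, moving a
   little from x towards any point of U changes the free energy little from
   below. Near x0 all points of the polytope U are of the form
   (1 - eps) x0 + eps y with y in U, so this gives lower semicontinuity on U,
   and continuity of the upper semicontinuous regularization. *)

Set Implicit Arguments.
Unset Strict Implicit.
Unset Printing Implicit Defensive.

Import Order.TTheory GRing.Theory Num.Theory.
Import numFieldNormedType.Exports.

Local Open Scope classical_set_scope.
Local Open Scope ring_scope.

(** * Kingman's subadditive ergodic theorem *)

(** The obstacle is uncountability: an ergodic theorem gives almost sure limits for countably many
    rays only, while the statement concerns all [zeta] at almost every environment. After the ray
    limits everything is therefore argued at one fixed environment, for a function [H] on count
    vectors with the properties [extension_stable] and [ray_limits].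

    The growth of the expectations of [H (k u) / k] is not assumed to be bounded. Kingman's theorem
    is thus needed with limits up to [+oo], and inequalities between limits are phrased through real
    numbers below or above them, which avoids arithmetic with infinities.

    Only vectors that use every step get constant ray limits: a step [z] followed by [k u] can be
    completed to [(k + 1) u] only if [u] contains [z]. The argument gives no determinism for vectors
    that omit a step. Determinism on the boundary is recovered only for the continuous extension,
    through its uniqueness. *)

Section limsup_thresholds.
Context {R : realType}.
Implicit Types (u : nat -> \bar R) (L : \bar R).
Local Open Scope ereal_scope.

Lemma limn_esup_le_near u L : (\forall n \near \oo, u n <= L) -> limn_esup u <= L.
Proof.
move=> [N _ hN]; rewrite /limn_esup /limf_esup.
apply: (@le_trans _ _ (ereal_sup (u @` [set n | (N <= n)%N]))).
  apply: ereal_inf_lbound; exists [set n | (N <= n)%N] => //.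
  by exists N.
by apply: ge_ereal_sup => _ [n Nn <-]; exact: hN.
Qed.

Lemma limn_einf_ge_near u L : (\forall n \near \oo, L <= u n) -> L <= limn_einf u.
Proof.
move=> h; rewrite /limn_einf leeNr; apply: limn_esup_le_near.
by apply: filterS h => n; rewrite leeN2.
Qed.

Lemma limn_esup_gt_freq u L : L < limn_esup u ->
  forall N, exists2 n, (N <= n)%N & L < u n.
Proof.
move=> Lu N; apply: contrapT => h; move: Lu; apply/negP; rewrite -leNgt.
apply: limn_esup_le_near; exists N => // n /= Nn.
by rewrite leNgt; apply/negP => Ln; apply: h; exists n.
Qed.

Lemma limn_esup_lt_near u L : limn_esup u < L -> \forall n \near \oo, u n < L.
Proof.
move=> /ereal_inf_lt[_ [V [N _ NV] <-]] supL; exists N => // n Nn.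
by apply: le_lt_trans supL; apply: ereal_sup_ubound; exists n => //; exact: NV.
Qed.

Lemma limn_einf_gt_near u L : L < limn_einf u -> \forall n \near \oo, L < u n.
Proof.
rewrite /limn_einf lteNr => /limn_esup_lt_near; apply: filterS => n.
by rewrite lteN2.
Qed.

Lemma cvgn_limn_esup_einf u : limn_esup u <= limn_einf u -> u @ \oo --> limn_einf u.
Proof.
move=> h; have e : limn_esup u = limn_einf u.
  by apply/eqP; rewrite eq_le h limn_einf_sup.
apply: (@squeeze_cvge _ _ _ _ (einfs u) _ (esups u)).
- apply: nearW => n; apply/andP; split.
    by apply: ereal_inf_lbound; exists n => /=.
  by apply: ereal_sup_ubound; exists n => /=.
- by rewrite limn_einf_lim; exact: is_cvg_einfs.
- by rewrite -e limn_esup_lim; exact: is_cvg_esups.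
Qed.

Lemma lte_rat_between (x y : \bar R) : x < y ->
  exists2 q : rat, x < (ratr q)%:E & (ratr q)%:E < y.
Proof.
move: x y => [x| |] [y| |] //=.
- rewrite lte_fin => /rat_in_itvoo[q]; rewrite in_itv/= => /andP[h1 h2].
  by exists q; rewrite lte_fin.
- move=> _; have : (x < x + 1)%R by rewrite ltrDl.
  move=> /rat_in_itvoo[q]; rewrite in_itv/= => /andP[h1 h2].
  by exists q; rewrite ?lte_fin ?ltry.
- move=> _; have : (y - 1 < y)%R by rewrite ltrBlDr ltrDl.
  move=> /rat_in_itvoo[q]; rewrite in_itv/= => /andP[h1 h2].
  by exists q; rewrite ?ltNyr ?lte_fin.
- by move=> _; exists 0%R; rewrite ?ltNyr ?ltry.
Qed.

End limsup_thresholds.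

(** * Measure-preserving maps and almost sure invariance *)

Section measure_preserving.
Context {R : realType} {dO : measure_display} {Om : measurableType dO}.
Variable PP : probability Om R.

Lemma ae_and (P Q : Om -> Prop) : {ae PP, forall x, P x} -> {ae PP, forall x, Q x} ->
  {ae PP, forall x, P x /\ Q x}.
Proof. by move=> hP hQ; near=> x; split; near: x. Unshelve. all: by end_near. Qed.

Lemma ae_forall_countable (I : countType) (P : I -> Om -> Prop) :
  (forall i, {ae PP, forall x, P i x}) -> {ae PP, forall x, forall i, P i x}.
Proof.
move=> h; have : {ae PP, forall x, forall n,
    if choice.unpickle n is Some i then P i x else True}.
  apply: ae_foralln => n; case: (choice.unpickle n) => [i|]; first exact: h.
  exact: aeW.
by apply: filterS => x hx i; have := hx (choice.pickle i); rewrite choice.pickleK.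
Qed.

Lemma ae_exists (P : Om -> Prop) : {ae PP, forall x, P x} -> exists x, P x.
Proof.
move=> h; have P0 : (0%R < PP [set: Om])%E.
  by have := @probability_setT _ _ _ PP => ->; rewrite lte01.
by have [x Px] := @filter_ex _ _ (ae_properfilter_algebraOfSetsType P0) _ h; exists x.
Qed.

Lemma ae_meas0 (A : set Om) : measurable A -> PP A = 0%E ->
  {ae PP, forall x, ~ A x}.
Proof. by move=> mA A0; exists A; split => // x /= /contrapT. Qed.

Definition mpreserving (tau : Om -> Om) := measurable_fun setT tau /\
  forall A, measurable A -> PP (tau @^-1` A) = PP A.

Variable tau : Om -> Om.
Hypothesis tau_mp : mpreserving tau.

Lemma mpreserving_meas A : measurable A -> measurable (tau @^-1` A).
Proof. by move=> mA; rewrite -[X in measurable X]setTI; exact: tau_mp.1. Qed.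

Lemma mpreserving_ae (P : Om -> Prop) : {ae PP, forall x, P x} ->
  {ae PP, forall x, P (tau x)}.
Proof.
move=> [N [mN N0 sN]]; exists (tau @^-1` N); split.
- exact: mpreserving_meas.
- by rewrite tau_mp.2.
- by move=> x /= hx; exact: sN.
Qed.

Lemma mpreserving_iter k : mpreserving (iter k tau).
Proof.
elim: k => [|k [mk pk]]; first by split => //; exact: measurable_id.
split; first by apply: measurableT_comp => //; exact: tau_mp.1.
move=> A mA; rewrite (_ : _ @^-1` A = iter k tau @^-1` (tau @^-1` A)); last by [].
by rewrite pk ?tau_mp.2//; exact: mpreserving_meas.
Qed.

Lemma mpreserving_integral (f : Om -> R) : measurable_fun setT f ->
  (forall x, 0 <= f x) ->
  (\int[PP]_x (f (tau x))%:E = \int[PP]_x (f x)%:E)%E.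
Proof.
move=> mf f0.
have h := @ge0_integral_pushforward _ _ _ _ _ tau tau_mp.1 PP setT
  (fun x => (f x)%:E) measurableT.
rewrite -[LHS]h; last 2 first.
- exact/measurable_EFinP.
- by move=> x _; rewrite lee_fin.
apply: eq_measure_integral => [|mt A mA _]; first exact: tau_mp.1.
exact: (tau_mp.2 A mA).
Qed.

(* The sets {f > q} are mapped into themselves by the preimage under tau, which
   has the same measure, so they are invariant up to null sets. *)
Lemma mpreserving_ae_invariant (f : Om -> \bar R) : measurable_fun setT f ->
  {ae PP, forall x, (f (tau x) <= f x)%E} -> {ae PP, forall x, f (tau x) = f x}.
Proof.
move=> mf hle.
pose A (q : rat) := [set x | ((ratr q)%:E < f x)%E].
have mA q : measurable (A q).
  rewrite -[A q]setTI; exact: emeasurable_fun_o_infty.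
have mtA q : measurable (tau @^-1` A q) by exact: mpreserving_meas.
have hAq q : {ae PP, forall x, ~ (A q `\` tau @^-1` (A q)) x}.
  apply: ae_meas0; first exact: measurableD.
  have e0 : PP (tau @^-1` A q `\` A q) = 0%E.
    case: hle => N [mN N0 sN]; apply/eqP; rewrite -measure_le0 -N0.
    apply: le_measure; rewrite ?inE//; first exact: measurableD.
    move=> x [h1 h2]; apply: sN => /= h; apply: h2.
    by apply: lt_le_trans h; exact: h1.
  have e1 : PP (A q) = PP (A q `&` tau @^-1` A q).
    rewrite -[LHS]tau_mp.2//; apply: (etrans (measureDI PP (mtA q) (mA q))).
    by rewrite [X in (X + _)%E](_ : _ = 0%E) ?add0e 1?setIC// e0.
  apply: (etrans (measureD (mA q) (mtA q) _)).
    by rewrite ltey_eq fin_num_measure.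
  by rewrite [X in (_ - X)%E](_ : _ = PP (A q)) ?subee// fin_num_measure.
have := ae_and hle (ae_forall_countable hAq); apply: filterS => x [h1 h2].
apply/eqP; rewrite eq_le h1/= leNgt; apply/negP => /lte_rat_between[q q1 q2].
by apply: (h2 q); split => //=; apply/negP; rewrite -leNgt ltW.
Qed.

End measure_preserving.

(** * Block decompositions of superadditive sequences *)

Section superadditive.
Context {R : realType} {dO : measure_display} {Om : measurableType dO}.
Variable PP : probability Om R.
Variables (tau : Om -> Om) (a : nat -> Om -> R).
Hypothesis tau_mp : mpreserving PP tau.
Hypothesis a_meas : forall n, measurable_fun setT (a n).
Hypothesis a_ge0 : forall n x, 0 <= a n x.
Hypothesis a_super : forall m n x, a m x + a n (iter m tau x) <= a (m + n)%N x.

(* Cutting the orbit of x into blocks on which a is large, and single steps at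
   the times spent in B. *)
Lemma superadditive_block_bound (B : set Om) (L : R) (N K : nat) x : 0 <= L ->
  (forall k, ~ B (iter k tau x) ->
    exists n, (0 < n <= N)%N /\ n%:R * L <= a n (iter k tau x)) ->
  L * (K%:R - N%:R - \sum_(0 <= k < K) \1_B (iter k tau x)) <= a K x.
Proof.
move=> L0; elim/ltn_ind: K x => K IH x hB.
have sum_ge0 m (F : nat -> R) : (forall k, 0 <= F k) -> 0 <= \sum_(0 <= k < m) F k.
  by move=> F0; apply: sumr_ge0.
have i0 k y : 0 <= \1_B (iter k tau y) :> R by rewrite indicE.
have [KN|NK] := leqP K N.
  apply: le_trans (a_ge0 K x); apply: mulr_ge0_le0 => //.
  have : K%:R <= N%:R :> R by rewrite ler_nat.
  have := sum_ge0 K (fun k => \1_B (iter k tau x)) (fun k => i0 k x); lra.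
have [Bx|nBx] := pselect (B x).
  case: K NK IH => // K NK IH.
  have := IH K (ltnSn K) (tau x).
  have e k : iter k tau (tau x) = iter k.+1 tau x by rewrite -iterSr.
  have hB' k : ~ B (iter k tau (tau x)) ->
      exists n, (0 < n <= N)%N /\ n%:R * L <= a n (iter k tau (tau x)).
    by rewrite e; exact: hB.
  move=> /(_ hB') h1.
  rewrite big_nat_recl//= indicE mem_set//=.
  have := a_super 1 K x; rewrite /= add1n => h2.
  have E : \sum_(0 <= k < K) \1_B (iter k tau (tau x)) =
      \sum_(0 <= k < K) \1_B (iter k.+1 tau x) :> R.
    by apply: eq_bigr => k _; rewrite e.
  have := a_ge0 1 x; move: h1; rewrite E.
  rewrite -natr1 /=; set S := \sum_(0 <= _ < _) _; lra.
have [n [/andP[n0 nN] an]] := hB 0%N nBx.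
have nK : (n <= K)%N by apply: leq_trans nN (ltnW NK).
have KnK : (K - n < K)%N by rewrite ltn_subrL n0 (leq_ltn_trans _ NK).
have e k : iter k tau (iter n tau x) = iter (k + n) tau x by rewrite -iterD.
have := IH _ KnK (iter n tau x).
have hB' k : ~ B (iter k tau (iter n tau x)) ->
    exists n', (0 < n' <= N)%N /\ n'%:R * L <= a n' (iter k tau (iter n tau x)).
  by rewrite e; exact: hB.
move=> /(_ hB') h1.
have := a_super n (K - n) x; rewrite subnKC// => h2.
rewrite (big_cat_nat (n := n))//=.
have -> : \sum_(n <= k < K) \1_B (iter k tau x) =
    \sum_(0 <= k < K - n) \1_B (iter (k + n) tau x) :> R.
  by rewrite -{1}[n]add0n big_addn.
have E : \sum_(0 <= k < K - n) \1_B (iter k tau (iter n tau x)) =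
    \sum_(0 <= k < K - n) \1_B (iter (k + n) tau x) :> R.
  by apply: eq_bigr => k _; rewrite e.
move: h1 an; rewrite natrB//= E.
have := sum_ge0 n (fun k => \1_B (iter k tau x)) (fun k => i0 k x).
set S1 := \sum_(0 <= _ < n) _; set S2 := \sum_(0 <= _ < _) _ => S10 h1 an.
have : 0 <= L * S1 by rewrite mulr_ge0.
by move: h2 h1 an; lra.
Qed.

Let f x := limn_esup (fun n => (a n x / n%:R)%:E).

(** [a n (tau x) <= a n.+1 x] because [a 1 x] is nonnegative, and dividing by [n] or by [n + 1]
    makes no difference in the limit. *)
Lemma superadditive_limsup_shift x : (f (tau x) <= f x)%E.
Proof.
rewrite leNgt; apply/negP => /lte_rat_between[q fq /lte_rat_between[q' qq' q'f]].
have {fq}[N _ hN] := limn_esup_lt_near fq.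
rewrite lte_fin in qq'.
set r : R := ratr q in qq' hN *; set r' : R := ratr q' in qq' q'f *.
have [n nN] := limn_esup_gt_freq q'f (maxn N (Num.truncn (`|r| / (r' - r))).+1).
move: nN; rewrite geq_max => /andP[nN n1].
have n0 : (0 < n)%N by apply: leq_trans n1.
have n0' : 0 < n%:R :> R by rewrite ltr0n.
rewrite lte_fin ltr_pdivlMr// => h1.
have := hN n.+1 (leqW nN); rewrite lte_fin ltr_pdivrMr ?ltr0Sn// => h2.
have := a_super 1 n x; rewrite add1n /= => h3.
have := a_ge0 1 x => h4.
have : `|r| < n%:R * (r' - r).
  rewrite -ltr_pdivrMr ?subr_gt0//; apply: lt_le_trans (truncnS_gt _) _.
  by rewrite ler_nat.
have := ler_norm r; rewrite -natr1 in h2.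
by move: h1 h2 h3 h4; lra.
Qed.

Lemma measurable_superadditive_limsup : measurable_fun setT f.
Proof.
apply: (measurable_fun_limn_esup (f := fun n x => (a n x / n%:R)%:E)) => n.
by apply/measurable_EFinP; apply: measurable_funM => //; exact: measurable_cst.
Qed.

Lemma superadditive_limsup_orbit :
  {ae PP, forall x, forall k, f (iter k tau x) = f x}.
Proof.
have h : {ae PP, forall x, f (tau x) = f x}.
  apply: mpreserving_ae_invariant => //.
    exact: measurable_superadditive_limsup.
  by apply: aeW => x; exact: superadditive_limsup_shift.
have : {ae PP, forall x, forall k, f (tau (iter k tau x)) = f (iter k tau x)}.
  apply: ae_foralln => k.
  exact: (mpreserving_ae (mpreserving_iter tau_mp k) h).
by apply: filterS => x hx; elim=> [//|k IH]; rewrite iterS hx IH.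
Qed.

(** The points from which no block of length at most [N] reaches the rate [L], although the upper
    limit exceeds it. This is the exceptional set to which [superadditive_block_bound] is applied;
    its measure tends to 0 with [N]. *)
Definition late_set (L : R) (N : nat) : set Om :=
  [set x | (L%:E < f x)%E /\ forall n, (0 < n <= N)%N -> a n x < n%:R * L].

Lemma measurable_limsup_gt (L : R) : measurable [set x | (L%:E < f x)%E].
Proof.
rewrite -[X in measurable X]setTI.
apply: emeasurable_fun_o_infty => //.
exact: measurable_superadditive_limsup.
Qed.

Lemma measurable_late_set L N : measurable (late_set L N).
Proof.
rewrite (_ : late_set L N = [set x | (L%:E < f x)%E] `&`
  \bigcap_(n in [set n | (0 < n <= N)%N]) [set x | a n x < n%:R * L]); last by [].
apply: measurableI; first exact: measurable_limsup_gt.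
apply: bigcap_measurableType => n _.
rewrite (_ : [set x | _] = setT `&` a n @^-1` `]-oo, n%:R * L[); first exact: a_meas.
by apply/seteqP; split => x /=; rewrite in_itv//= => -[].
Qed.

Lemma late_set_nonincreasing L : nonincreasing_seq (late_set L).
Proof.
move=> m n mn; apply/subsetPset => x [h1 h2]; split => // k /andP[k0 km].
by apply: h2; rewrite k0 (leq_trans km).
Qed.

Lemma bigcap_late_set L : \bigcap_N late_set L N = set0.
Proof.
apply/seteqP; split => // x h.
have [Lf _] := h 0%N I.
have [n n1] := limn_esup_gt_freq Lf 1%N.
rewrite lte_fin ltr_pdivlMr ?ltr0n// => h1.
have [_ /(_ n)] := h n I; rewrite n1 leqnn => /(_ isT).
by rewrite mulrC ltNge (ltW h1).
Qed.

Lemma late_set_cvg0 L : PP (late_set L N) @[N --> \oo] --> 0%E.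
Proof.
have := @nonincreasing_cvg_mu _ _ _ PP (late_set L).
rewrite bigcap_late_set measure0; apply => //.
- rewrite ltey_eq; apply/orP; left.
  exact: fin_num_measure (measurable_late_set _ _).
- by move=> ?; exact: measurable_late_set.
- exact: late_set_nonincreasing.
Qed.

(** The upper limit is constant along almost every orbit, so at each time outside the late set a
    block of rate at least [L] begins. *)
Lemma late_set_bound L : 0 <= L -> {ae PP, forall x, (L%:E < f x)%E -> forall N K,
  L * (K%:R - N%:R - \sum_(0 <= k < K) \1_(late_set L N) (iter k tau x)) <= a K x}.
Proof.
move=> L0; apply: filterS superadditive_limsup_orbit => x hx Lf N K.
apply: superadditive_block_bound => // k nB; apply: contrapT => h; apply: nB.
split; first by rewrite hx.
move=> n nN; rewrite ltNge; apply/negP => h'; apply: h; exists n; split => //.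
Qed.

End superadditive.

(** * Birkhoff sums *)

Section maximal_inequality.
Context {R : realType} {dO : measure_display} {Om : measurableType dO}.
Variable PP : probability Om R.
Variables (tau : Om -> Om) (phi : Om -> R).
Hypothesis tau_mp : mpreserving PP tau.
Hypothesis phi_meas : measurable_fun setT phi.
Hypothesis phi_ge0 : forall x, 0 <= phi x.

Definition birkhoff_sum (n : nat) (x : Om) : R :=
  \sum_(0 <= k < n) phi (iter k tau x).

Lemma measurable_birkhoff_sum n : measurable_fun setT (birkhoff_sum n).
Proof.
apply: measurable_sum => k.
by apply: measurableT_comp => //; exact: (mpreserving_iter tau_mp k).1.
Qed.

Lemma birkhoff_sum_ge0 n x : 0 <= birkhoff_sum n x.
Proof. by apply: sumr_ge0. Qed.

Lemma birkhoff_sumD m n x :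
  birkhoff_sum m x + birkhoff_sum n (iter m tau x) = birkhoff_sum (m + n) x.
Proof.
rewrite /birkhoff_sum (@big_cat_nat _ _ _ m 0 (m + n))//= ?leq_addr//; congr (_ + _).
rewrite -{2}[m]add0n big_addn addKn; apply: eq_bigr => k _.
by rewrite -iterD.
Qed.

Lemma integral_birkhoff_sum n :
  (\int[PP]_x (birkhoff_sum n x)%:E = n%:R%:E * \int[PP]_x (phi x)%:E)%E.
Proof.
under eq_integral do rewrite /birkhoff_sum -sumEFin.
rewrite ge0_integral_sum//=; last 2 first.
- move=> k; apply/measurable_EFinP; apply: measurableT_comp => //.
  exact: (mpreserving_iter tau_mp k).1.
- by move=> k x _; rewrite lee_fin.
rewrite (eq_bigr (fun=> \int[PP]_x (phi x)%:E)%E); last first.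
  by move=> k _; rewrite (mpreserving_integral (mpreserving_iter tau_mp k)).
rewrite big_mkord sumr_const card_ord.
by elim: n => [|n IH]; rewrite ?mulr0n ?mul0e// mulrS IH -natr1 EFinD addeC
  ge0_muleDl ?mul1e ?lee_fin// addeC.
Qed.

End maximal_inequality.

(** * The maximal inequality and Kingman's theorem *)

Section kingman.
Context {R : realType} {dO : measure_display} {Om : measurableType dO}.
Variable PP : probability Om R.
Variable tau : Om -> Om.
Hypothesis tau_mp : mpreserving PP tau.

(** The pointwise bound [late_set_bound] is applied to the Birkhoff sums themselves and integrated;
    by invariance the time spent in the late set becomes its measure. *)
Lemma maximal_inequality (phi : Om -> R) (L : R) : measurable_fun setT phi ->
  (forall x, 0 <= phi x) -> 0 < L ->
  (L%:E * PP [set x | L%:E < limn_esup (fun n => (birkhoff_sum tau phi n x / n%:R)%:E)]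
   <= \int[PP]_x (phi x)%:E)%E.
Proof.
move=> mphi phi0 L0.
set b := birkhoff_sum tau phi.
have mb n : measurable_fun setT (b n) by exact: (measurable_birkhoff_sum tau_mp).
have b0 n x : 0 <= b n x by exact: birkhoff_sum_ge0.
have sb m n x : b m x + b n (iter m tau x) <= b (m + n)%N x.
  by rewrite /b birkhoff_sumD.
set A := [set x | _].
have mA : measurable A by exact: measurable_limsup_gt mb L.
pose B N := late_set b L N.
have mB N : measurable (B N) by exact: measurable_late_set.
have B0 : PP (B N) @[N --> \oo] --> 0%E by exact: late_set_cvg0.
have bnd := late_set_bound tau_mp mb b0 sb (ltW L0).
have Ige0 : (0 <= \int[PP]_x (phi x)%:E)%E.
  by apply: integral_ge0 => x _; rewrite lee_fin.
have pA : PP A \is a fin_num by exact: fin_num_measure.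
have pB N : PP (B N) \is a fin_num by exact: fin_num_measure.
have key N K : (N <= K)%N ->
    ((L * (K%:R - N%:R))%:E * PP A <=
     K%:R%:E * (\int[PP]_x (phi x)%:E + L%:E * PP (B N)))%E.
  move=> NK.
  have NK' : 0 <= K%:R - N%:R :> R by rewrite subr_ge0 ler_nat.
  (* [psi] puts the loss on the late set on the side of the Birkhoff sum, so that
     [integral_birkhoff_sum] evaluates both at once. *)
  pose psi x := phi x + L * \1_(B N) x.
  have mi : measurable_fun setT (\1_(B N) : Om -> R) by exact: measurable_indic.
  have mpsi : measurable_fun setT psi.
    by apply: measurable_funD => //; apply: measurable_funM.
  have i0 x : 0 <= L * \1_(B N) x by rewrite mulr_ge0 ?(ltW L0)// indicE.
  have psi0 x : 0 <= psi x by rewrite addr_ge0.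
  have e1 : (\int[PP]_x (L * \1_(B N) x)%:E = L%:E * PP (B N))%E.
    under eq_integral do rewrite EFinM.
    rewrite ge0_integralZl_EFin//.
    - by rewrite integral_indic// setIT.
    - by apply/measurable_EFinP; exact: mi.
    - exact: ltW.
  have -> : (\int[PP]_x (phi x)%:E + L%:E * PP (B N) = \int[PP]_x (psi x)%:E)%E.
    rewrite /psi; under [RHS]eq_integral do rewrite EFinD.
    rewrite ge0_integralD//.
    - by rewrite e1.
    - by move=> x _; rewrite lee_fin.
    - by apply/measurable_EFinP.
    - by move=> x _; rewrite lee_fin.
    - by apply/measurable_EFinP; apply: measurable_funM.
  rewrite -(integral_birkhoff_sum tau_mp)//.
  have -> : ((L * (K%:R - N%:R))%:E * PP A =
      \int[PP]_x (L * (K%:R - N%:R) * \1_A x)%:E)%E.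
    under [RHS]eq_integral do rewrite EFinM.
    rewrite ge0_integralZl_EFin//.
    - by rewrite integral_indic// setIT.
    - by apply/measurable_EFinP; exact: measurable_indic.
    - by rewrite mulr_ge0// ltW.
  apply: ae_ge0_le_integral => //.
  - by move=> x _; rewrite lee_fin !mulr_ge0// ?indicE// ltW.
  - by apply/measurable_EFinP; apply: measurable_funM.
  - by move=> x _; rewrite lee_fin; exact: birkhoff_sum_ge0.
  - by apply/measurable_EFinP; exact: (measurable_birkhoff_sum tau_mp).
  apply: filterS bnd => x hx _; rewrite lee_fin indicE.
  have [xA|xA] := boolP (x \in A); last by rewrite mulr0 birkhoff_sum_ge0.
  have := hx (set_mem xA) N K; rewrite mulr1 -/(B N) => h.
  have -> : birkhoff_sum tau psi K x =
      b K x + L * \sum_(0 <= k < K) \1_(B N) (iter k tau x).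
    by rewrite /b /birkhoff_sum big_split/= -mulr_sumr.
  by move: h; rewrite mulrBr; lra.
have [Ifin|] := boolP (\int[PP]_x (phi x)%:E \is a fin_num)%E; last first.
  by rewrite ge0_fin_numE// -leNgt leye_eq => /eqP ->; exact: leey.
move: key Ige0; rewrite -(fineK Ifin) -(fineK pA); set I := fine (\int[PP]_x (phi x)%:E)%E; set p := fine (PP A).
move=> key Ige0; rewrite -EFinM lee_fin leNgt; apply/negP => Ip.
have d0 : 0 < L * p - I by rewrite subr_gt0.
(* [N] makes the late set cost less than half of the gap [L * p - I]; then [K] is so large that the
   [N] lost times cost less than the other half. *)
have [N _ hN] : \forall N \near \oo, (PP (B N) < ((L * p - I) / (2 * L))%:E)%E.
  apply: limn_esup_lt_near; rewrite (cvg_limn_einf_sup B0).2 lte_fin.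
  by rewrite divr_gt0// mulr_gt0.
have {hN} := hN N (leqnn N).
have {}key := key N.
rewrite -(fineK (pB N)) lte_fin ltr_pdivlMr ?mulr_gt0//.
set q := fine (PP (B N)) => hq.
pose K := maxn N (Num.truncn (2 * L * N%:R * p / (L * p - I))).+1.
have NK : (N <= K)%N by rewrite leq_maxl.
have := key K NK; rewrite -(fineK (pB N)) -/q -!EFinM lee_fin.
move=> hh; have {hh} : L * (K%:R - N%:R) * p <= K%:R * (I + L * q) := hh.
have hK : 2 * L * N%:R * p < K%:R * (L * p - I).
  rewrite -ltr_pdivrMr//; apply: lt_le_trans (truncnS_gt _) _.
  by rewrite ler_nat leq_maxr.
have K0 : 0 <= K%:R :> R by [].
have : K%:R * (q * (2 * L)) <= K%:R * (L * p - I) by rewrite ler_wpM2l// ltW.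
by move: hK; nra.
Qed.

(** For rational [L] below the upper limit, the block bound gives the lower limit [L] up to the
    frequency of visits to the late set, which the maximal inequality makes as small as desired.
    Convergence is in [\bar R], with the limit [+oo] allowed; nonnegativity takes the place of
    integrability. *)
Theorem kingman_superadditive (a : nat -> Om -> R) :
  (forall n, measurable_fun setT (a n)) -> (forall n x, 0 <= a n x) ->
  (forall m n x, a m x + a n (iter m tau x) <= a (m + n)%N x) ->
  {ae PP, forall x, cvgn (fun n => (a n x / n%:R)%:E)}.
Proof.
move=> ma a0 sa.
pose f x := limn_esup (fun n => (a n x / n%:R)%:E).
pose B L N := late_set a L N.
have mB L N : measurable (B L N) by exact: measurable_late_set.
pose g L N x := limn_esup (fun n => (birkhoff_sum tau (\1_(B L N) : Om -> R) n x / n%:R)%:E).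
have mi L N : measurable_fun setT (\1_(B L N) : Om -> R) by exact: measurable_indic.
have i0 L N x : 0 <= \1_(B L N) x :> R by rewrite indicE.
(* The event that the upper frequency of visits to [B L N] exceeds [1 / (j + 1)] for every [N] has
   measure at most [(j + 1) * PP (B L N)], for every [N]. *)
have gsmall (L : R) : 0 <= L ->
    {ae PP, forall x, forall j : nat, exists N, (g L N x <= j.+1%:R^-1%:E)%E}.
  move=> L0; apply: ae_foralln => j.
  pose C N := [set x | (j.+1%:R^-1%:E < g L N x)%E].
  have mC N : measurable (C N).
    apply: (measurable_limsup_gt) => n.
    exact: (measurable_birkhoff_sum tau_mp).
  have mIC : measurable (\bigcap_N C N) by apply: bigcap_measurableType => N _.
  have : PP (\bigcap_N C N) = 0%E.
    apply/eqP; rewrite -measure_le0 leNgt; apply/negP => h.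
    have B0 : PP (B L N) @[N --> \oo] --> 0%E by exact: late_set_cvg0.
    have : (0 < j.+1%:R^-1%:E * PP (\bigcap_N C N))%E by rewrite mule_gt0.
    rewrite -(cvg_limn_einf_sup B0).2 => /limn_esup_lt_near[N _ /(_ N (leqnn N))].
    rewrite ltNge => /negP; apply.
    have /(_ (B L N)) := @integral_indic _ _ _ PP setT measurableT.
    move=> /(_ (mB L N)); rewrite setIT => <-.
    have jgt0 : 0 < j.+1%:R^-1 :> R by rewrite invr_gt0.
    apply: le_trans (maximal_inequality (mi L N) (i0 L N) jgt0).
    rewrite lee_pmul2l//; apply: le_measure; rewrite ?inE//; last exact: bigcap_inf.
    exact: mC.
  move=> /(ae_meas0 mIC); apply: filterS => x hx; apply: contrapT => h; apply: hx.
  by move=> N _; rewrite /C /= ltNge; apply/negP => h'; apply: h; exists N.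
have step (L : rat) : {ae PP, forall x, 0 <= ratr L :> R -> ((ratr L)%:E < f x)%E ->
    ((ratr L)%:E <= limn_einf (fun n => (a n x / n%:R)%:E))%E}.
  have [L0|] := boolP (0 <= ratr L :> R); last by move=> _; apply: aeW.
  have := ae_and (late_set_bound tau_mp ma a0 sa L0) (gsmall _ L0).
  apply: filterS => x [h1 h2] _ Lf; have {}h1 := h1 Lf.
  rewrite leNgt; apply/negP => /lte_rat_between[q q1]; rewrite lte_fin => q2.
  move: q1; apply/negP; rewrite -leNgt; apply: limn_einf_ge_near.
  set l : R := ratr L in L0 Lf h1 h2 q2 *; set r : R := ratr q in q2 *.
  (* [N] and the visits to the late set each take at most [e * K] of the first [K] times, which
     costs the rate at most [2 * e * l <= l - r]. *)
  pose e := (l - r) / (3 * (l + 1)).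
  have e0 : 0 < e by rewrite divr_gt0 ?subr_gt0// mulr_gt0// ltr_wpDl.
  have [N gN] := h2 (Num.truncn e^-1).
  have je : (Num.truncn e^-1).+1%:R^-1 < e.
    by rewrite invf_plt ?posrE//; exact: truncnS_gt.
  have /limn_esup_lt_near[M _ hM] : (g l N x < e%:E)%E.
    by apply: le_lt_trans gN _; rewrite lte_fin.
  exists (maxn M (Num.truncn (N%:R / e)).+1) => // K /=; rewrite geq_max => /andP[MK K1].
  have K0 : 0 < K%:R :> R by rewrite ltr0n (leq_trans _ K1).
  have := hM K MK; rewrite lte_fin lee_fin ltr_pdivrMr// ler_pdivlMr// => hb.
  have := h1 N K; rewrite -/(B l N) -/(birkhoff_sum tau \1_(B l N) K x).
  move: hb; set s := birkhoff_sum _ _ _ _ => hb.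
  have NK : N%:R < e * K%:R.
    rewrite mulrC -ltr_pdivrMr//; apply: lt_le_trans (truncnS_gt _) _.
    by rewrite ler_nat.
  have el : e * (3 * (l + 1)) = l - r.
    by rewrite divfK// mulf_neq0// gt_eqF// ltr_wpDl.
  move=> h; apply: le_trans h.
  have : l * (K%:R - 2 * (e * K%:R)) <= l * (K%:R - N%:R - s).
    by apply: ler_wpM2l => //; lra.
  apply: le_trans.
  have -> : r = l - e * (3 * (l + 1)) by rewrite el; ring.
  have p1 : 0 <= e * K%:R by rewrite mulr_ge0 ?ltW.
  have p2 : 0 <= e * K%:R * l by rewrite mulr_ge0.
  by move: p1 p2; move: (e) (K%:R) => e' K'; nra.
apply: filterS (ae_forall_countable step) => x hx.
apply/cvg_ex; exists (limn_einf (fun n => (a n x / n%:R)%:E)).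
apply: cvgn_limn_esup_einf; rewrite leNgt; apply/negP => /lte_rat_between[q q1 q2].
have q0 : (0 <= ratr q :> R).
  rewrite -lee_fin; apply: le_trans (ltW q1); apply: limn_einf_ge_near.
  by apply: nearW => n; rewrite lee_fin divr_ge0.
by have := hx q q0 q2; rewrite leNgt q1.
Qed.

(** By the maximal inequality the upper limit exceeds [N + 1] with probability at most the integral
    divided by [N + 1]. A finite limit of the averages is needed to subtract them from a sequence
    whose limit may be [+oo]. *)
Lemma birkhoff_limsup_finite (phi : Om -> R) : measurable_fun setT phi ->
  (forall x, 0 <= phi x) -> (\int[PP]_x (phi x)%:E < +oo)%E ->
  {ae PP, forall x,
    (limn_esup (fun n => (birkhoff_sum tau phi n x / n%:R)%:E) < +oo)%E}.
Proof.
move=> mphi phi0 Ifin.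
pose f x := limn_esup (fun n => (birkhoff_sum tau phi n x / n%:R)%:E).
pose A := [set x | (f x = +oo)%E].
have mA N : measurable [set x | (N%:R%:E < f x)%E].
  by apply: (measurable_limsup_gt) => n; exact: (measurable_birkhoff_sum tau_mp).
have AE : A = \bigcap_N [set x | (N%:R%:E < f x)%E].
  apply/seteqP; split => [x Ax N _|x h].
    by have fx : f x = +oo%E := Ax; rewrite /mkset fx ltry.
  rewrite /A /mkset.
  case fx: (f x) => [r| |] //.
    have := h (Num.truncn r).+1 I; rewrite /mkset fx lte_fin ltNge => /negP; case.
    exact: ltW (truncnS_gt _).
  by have := h 0%N I; rewrite /mkset fx.
have mA' : measurable A by rewrite AE; apply: bigcap_measurableType => N _.
have I0 : (0 <= \int[PP]_x (phi x)%:E)%E.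
  by apply: integral_ge0 => x _; rewrite lee_fin.
have pA : PP A \is a fin_num by exact: fin_num_measure.
have Ifn : (\int[PP]_x (phi x)%:E)%E \is a fin_num by rewrite ge0_fin_numE.
have key N : (N.+1%:R%:E * PP A <= \int[PP]_x (phi x)%:E)%E.
  have N0 : 0 < N.+1%:R :> R by [].
  apply: le_trans (maximal_inequality mphi phi0 N0).
  rewrite lee_pmul2l//; apply: le_measure; rewrite ?inE; [exact: mA'|exact: mA|].
  by rewrite AE; exact: bigcap_inf.
have : PP A = 0%E.
  apply: contrapT => /eqP pn0.
  have p0 : 0 < fine (PP A) by rewrite lt_def fine_eq0// pn0 fine_ge0.
  have := key (Num.truncn (fine (\int[PP]_x (phi x)%:E)%E / fine (PP A))).
  rewrite -(fineK pA) -(fineK Ifn) -EFinM lee_fin leNgt => /negP; apply.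
  by rewrite -ltr_pdivrMr//; exact: truncnS_gt.
move=> /(ae_meas0 mA'); apply: filterS => x hx.
by rewrite ltey; apply/eqP.
Qed.

End kingman.

(** * Ergodicity *)

Section ergodic_constancy.
Context {R : realType} {d : nat} {Rs : {fset 'rV[int]_d}}.
Context {dO : measure_display} {Om : measurableType dO}.
Variables (PP : probability Om R) (T : 'rV[int]_d -> Om -> Om).
Hypothesis T_sys : dynamical_system Rs PP T.

Lemma step_group0 : step_group Rs 0.
Proof. by exists (fun=> 0); rewrite big1// => z _; rewrite scale0r. Qed.

Lemma step_groupD x y : step_group Rs x -> step_group Rs y -> step_group Rs (x + y).
Proof.
move=> [a ->] [b ->]; exists (fun z => a z + b z).
by rewrite -big_split/=; apply: eq_bigr => z _; rewrite scalerDl.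
Qed.

Lemma step_groupN x : step_group Rs x -> step_group Rs (- x).
Proof.
move=> [a ->]; exists (fun z => - a z).
by rewrite -sumrN; apply: eq_bigr => z _; rewrite scaleNr.
Qed.

Lemma step_group_val (z : Rs) : step_group Rs (val z).
Proof.
exists (fun z' => (z' == z)%:R); rewrite (bigD1 z)//= eqxx scale1r big1 ?addr0//.
by move=> z' /negPf ->; rewrite scale0r.
Qed.

Lemma step_group_sum (I : Type) (s : seq I) (F : I -> 'rV[int]_d) :
  (forall i, step_group Rs (F i)) -> step_group Rs (\sum_(i <- s) F i).
Proof. by move=> h; elim/big_ind: _ => //; [exact: step_group0|exact: step_groupD]. Qed.

Lemma step_groupMn x n : step_group Rs x -> step_group Rs (x *+ n).
Proof.
move=> hx; elim: n => [|n IH]; rewrite ?mulr0n ?mulrS; first exact: step_group0.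
exact: step_groupD.
Qed.

Lemma shift0 om : T 0 om = om. Proof. by case: T_sys => ->. Qed.

Lemma shiftD x y om : step_group Rs x -> step_group Rs y ->
  T (x + y) om = T x (T y om).
Proof. by case: T_sys => _ h _ _ hx hy; rewrite h. Qed.

Lemma shift_mpreserving x : step_group Rs x -> mpreserving PP (T x).
Proof. by case: T_sys => _ _ h1 h2 hx; split; [exact: h1|move=> A; exact: h2]. Qed.

Lemma shift_iter x n om : step_group Rs x -> iter n (T x) om = T (x *+ n) om.
Proof.
move=> hx; elim: n => [|n IH]; first by rewrite mulr0n shift0.
by rewrite iterS IH mulrS shiftD//; exact: step_groupMn.
Qed.

(** The shifts that preserve [f] almost surely form a group, which contains the steps. *)
Lemma shift_ae_invariant (f : Om -> \bar R) x : step_group Rs x ->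
  (forall z : Rs, {ae PP, forall om, f (T (val z) om) = f om}) ->
  {ae PP, forall om, f (T x om) = f om}.
Proof.
move=> gx finv.
pose Q x := step_group Rs x /\ {ae PP, forall om, f (T x om) = f om}.
have Q0 : Q 0 by split; [exact: step_group0|apply: aeW => om; rewrite shift0].
have QD x1 x2 : Q x1 -> Q x2 -> Q (x1 + x2).
  move=> [g1 i1] [g2 i2]; split; first exact: step_groupD.
  apply: filterS (ae_and (mpreserving_ae (shift_mpreserving g2) i1) i2) => om [e1 e2].
  by rewrite shiftD// e1 e2.
have QN x1 : Q x1 -> Q (- x1).
  move=> [g1 i1]; have gN := step_groupN g1; split => //.
  apply: filterS (mpreserving_ae (shift_mpreserving gN) i1) => om.
  by rewrite -shiftD// subrr shift0.
suff [] : Q x by [].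
case: gx => a ->; elim/big_ind: _ => // z _.
have Qz : Q (val z) by split; [exact: step_group_val|exact: finv].
have Qn n : Q (val z *+ n).
  by elim: n => [|n IH]; rewrite ?mulr0n ?mulrS//; exact: QD.
case: (a z) => n.
  by rewrite -[Posz n]natz scaler_nat.
by rewrite NegzE scaleNr -[Posz _]natz scaler_nat; exact: QN.
Qed.

(* Intersecting {q < f} over the orbit makes it invariant without exception. *)
Lemma ergodic_ae_constant (f : Om -> \bar R) : ergodic Rs PP T ->
  measurable_fun setT f ->
  (forall z : Rs, {ae PP, forall om, (f (T (val z) om) <= f om)%E}) ->
  exists c, {ae PP, forall om, f om = c}.
Proof.
move=> erg mf fle.
have finv (z : Rs) : {ae PP, forall om, f (T (val z) om) = f om}.
  apply: mpreserving_ae_invariant (fle z) => //.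
  exact: (shift_mpreserving (step_group_val z)).
pose S (q : rat) x := [set om | step_group Rs x -> ((ratr q)%:E < f (T x om))%E].
pose A q := \bigcap_(x in [set: 'rV[int]_d]) S q x.
have mS q x : measurable (S q x).
  have [gx|ngx] := pselect (step_group Rs x); last first.
    by rewrite (_ : S q x = setT)//; apply/seteqP; split => om // _ gx.
  rewrite (_ : S q x = T x @^-1` [set om | ((ratr q)%:E < f om)%E]); last first.
    by apply/seteqP; split => [om /(_ gx)|om h _].
  apply: (mpreserving_meas (shift_mpreserving gx)).
  rewrite -[X in measurable X]setTI; exact: emeasurable_fun_o_infty.
have mA q : measurable (A q).
  rewrite (_ : A q = \bigcap_n (if choice.unpickle n is Some x then S q x else setT)).
    by apply: bigcap_measurableType => n _; case: (choice.unpickle n).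
  apply/seteqP; split => om h.
    by move=> n _; case: (choice.unpickle n) => // x; exact: h.
  by move=> x _; have := h (choice.pickle x) I; rewrite choice.pickleK.
have invA q (z : Rs) : T (val z) @^-1` A q = A q.
  apply/seteqP; split => om h x _ gx.
    have gx' := step_groupD gx (step_groupN (step_group_val z)).
    have := h (x - val z) I gx'.
    by rewrite -shiftD ?subrK//; exact: step_group_val.
  rewrite -shiftD//; last exact: step_group_val.
  by apply: h => //; apply: step_groupD => //; exact: step_group_val.
have good : {ae PP, forall om, forall x, step_group Rs x -> f (T x om) = f om}.
  apply: ae_forall_countable => x.
  have [gx|ngx] := pselect (step_group Rs x); last by apply: aeW.
  by apply: filterS (shift_ae_invariant gx finv) => om.
(* At almost every [om] each rational level is decided by a condition free of [om]; two environments
   with the same answers at all rational levels have the same [f]. *)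
have cut q : {ae PP, forall om, ((ratr q)%:E < f om)%E <-> PP (A q) = 1%E}.
  case: (erg (A q) (mA q) (invA q)) => pA.
    apply: filterS (ae_and (ae_meas0 (mA q) pA) good) => om [h1 h2].
    split; last by rewrite pA => /eqP; rewrite eq_sym onee_eq0.
    by move=> qf; exfalso; apply: h1 => x _ gx; rewrite h2.
  have pAc : PP (~` A q) = 0%E.
    by rewrite probability_setC// pA subee.
  apply: filterS (ae_meas0 (measurableC (mA q)) pAc) => om /contrapT h.
  by split => // _; have := h 0 I step_group0; rewrite shift0.
have := ae_forall_countable cut => hcut.
have [om0 h0] := ae_exists hcut.
exists (f om0); apply: filterS hcut => om h.
apply/eqP; rewrite eq_le; apply/andP; split; rewrite leNgt; apply/negP.
  by move=> /lte_rat_between[q q1] /(h q).1/(h0 q).2; rewrite ltNge (ltW q1).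
by move=> /lte_rat_between[q q1] /(h0 q).1/(h q).2; rewrite ltNge (ltW q1).
Qed.
End ergodic_constancy.

(** * Limits along count vectors *)

Lemma natr_large {R : realType} (c : R) : exists N : nat, forall n, (N <= n)%N -> c <= n%:R.
Proof.
exists (Num.truncn c).+1 => n Nn; apply: ltW; apply: lt_le_trans (truncnS_gt _) _.
by rewrite ler_nat.
Qed.

Section counts.
Context {d : nat} {Rs : {fset 'rV[int]_d}}.
Definition cnt := {ffun Rs -> nat}.
Implicit Types u v w : cnt.

Definition csize u : nat := (\sum_z u z)%N.
Definition cpos u : 'rV[int]_d := \sum_z val z *+ u z.
Definition cadd u v : cnt := [ffun z => (u z + v z)%N].
Definition cmul (k : nat) u : cnt := [ffun z => (k * u z)%N].
Definition csub u v : cnt := [ffun z => (u z - v z)%N].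
Definition c0 : cnt := [ffun=> 0%N].
Definition cle u v := forall z, (u z <= v z)%N.
Definition cpositive u := forall z, (0 < u z)%N.

Lemma csize_add u v : csize (cadd u v) = (csize u + csize v)%N.
Proof. by rewrite /csize -big_split; apply: eq_bigr => z _; rewrite ffunE. Qed.

Lemma csize_mul k u : csize (cmul k u) = (k * csize u)%N.
Proof. by rewrite /csize big_distrr; apply: eq_bigr => z _; rewrite ffunE. Qed.

Lemma cpos_add u v : cpos (cadd u v) = cpos u + cpos v.
Proof. by rewrite /cpos -big_split; apply: eq_bigr => z _; rewrite ffunE mulrnDr. Qed.

Lemma cpos_mul k u : cpos (cmul k u) = cpos u *+ k.
Proof. by rewrite /cpos -sumrMnl; apply: eq_bigr => z _; rewrite ffunE mulnC mulrnA. Qed.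

Lemma cadd_sub u v : cle u v -> cadd u (csub v u) = v.
Proof. by move=> uv; apply/ffunP => z; rewrite !ffunE subnKC. Qed.

Lemma csize_le u v : cle u v -> (csize u <= csize v)%N.
Proof. by move=> uv; apply: leq_sum => z _. Qed.

Lemma csize_sub u v : cle u v -> csize (csub v u) = (csize v - csize u)%N.
Proof. by move=> uv; rewrite -{2}(cadd_sub uv) csize_add addKn. Qed.

Lemma cpos_sub u v : cle u v -> cpos (csub v u) = cpos v - cpos u.
Proof. by move=> uv; rewrite -{2}(cadd_sub uv) cpos_add addrAC subrr add0r. Qed.

Lemma csize0 : csize c0 = 0%N.
Proof. by rewrite /csize big1// => z _; rewrite ffunE. Qed.

Lemma cmul_mul k m u : cmul k (cmul m u) = cmul (k * m) u.
Proof. by apply/ffunP => z; rewrite !ffunE mulnA. Qed.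

Lemma csize_positive u (z0 : Rs) : cpositive u -> (0 < csize u)%N.
Proof.
by move=> hu; apply: leq_trans (hu z0) _; rewrite /csize (bigD1 z0)//= leq_addr.
Qed.

End counts.
Arguments cnt {d} Rs.

(** * Weights of a direction and the count vectors that follow them *)

Section weights.
Context {R : realType} {d : nat} {Rs : {fset 'rV[int]_d}}.
Implicit Types (beta : Rs -> R) (u v w : cnt Rs).

Definition weights beta := (forall z, 0 <= beta z) /\ \sum_z beta z = 1.

(** A rounding deviates by at most [#|{: Rs}| + 1], a difference of two roundings by at most twice
    and a concatenation of two roundings by at most four times as much; the factor 6 leaves room. *)
Definition dev : R := 6 * (#|{: Rs}|%:R + 1).

(** Steps of weight zero are forbidden altogether, so that a multiple of one vector following [beta]
    can lie under another one. *)
Definition follows beta v := forall z,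
  `|(v z)%:R - (csize v)%:R * beta z| <= dev /\ (beta z = 0 -> v z = 0%N).

Lemma weights_le1 beta z : weights beta -> beta z <= 1.
Proof.
by move=> [b0 b1]; rewrite -b1 (bigD1 z)//= lerDl; exact: sumr_ge0.
Qed.

Lemma weights_min beta : weights beta ->
  exists2 m, 0 < m & forall z, beta z != 0 -> m <= beta z.
Proof.
move=> [b0 b1]; exists (\big[Order.min/1]_(z | beta z != 0) beta z).
  elim/big_ind: _ => // [x y x0 y0|z bz]; first by rewrite lt_min x0.
  by rewrite lt_def bz b0.
by move=> z bz; apply: bigmin_le_cond.
Qed.

Lemma csizeE v : (csize v)%:R = \sum_z (v z)%:R :> R.
Proof. by rewrite natr_sum. Qed.

Definition round beta (N : nat) : cnt Rs := [ffun z => Num.truncn (N%:R * beta z)].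

Lemma round_near beta N z : weights beta ->
  N%:R * beta z - 1 < (round beta N z)%:R <= N%:R * beta z.
Proof.
move=> [b0 b1]; have h : 0 <= N%:R * beta z by rewrite mulr_ge0.
rewrite ffunE; have /andP[h1 h2] := truncn_itv h.
by rewrite h1 andbT ltrBlDr natr1.
Qed.

Lemma csize_round beta N : weights beta ->
  N%:R - #|{: Rs}|%:R <= ((csize (round beta N))%:R : R) <= N%:R.
Proof.
move=> wb; have Nb : \sum_z N%:R * beta z = N%:R.
  by rewrite -mulr_sumr wb.2 mulr1.
rewrite csizeE; apply/andP; split.
  have -> : N%:R - #|{: Rs}|%:R = \sum_z (N%:R * beta z - 1).
    by rewrite big_split/= Nb sumrN sumr_const.
  by apply: ler_sum => z _; have /andP[/ltW] := round_near N z wb.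
by rewrite -[leRHS]Nb; apply: ler_sum => z _; have /andP[] := round_near N z wb.
Qed.

Lemma round_eq0 beta N z : beta z = 0 -> round beta N z = 0%N.
Proof. by move=> b0; rewrite ffunE b0 mulr0 truncn0. Qed.

Lemma mul_weight_bound beta (x c : R) z : weights beta ->
  `|x| <= c -> `|x * beta z| <= c.
Proof.
move=> wb xc; rewrite normrM (ger0_norm (wb.1 z)); apply: le_trans xc.
by rewrite ler_piMr// weights_le1.
Qed.

Lemma follows_round beta N : weights beta -> follows beta (round beta N).
Proof.
move=> wb z; split; last exact: round_eq0.
have /andP[h1 h2] := round_near N z wb.
have /andP[h3 h4] := csize_round N wb.
have : `|((csize (round beta N))%:R - N%:R) * beta z| <= #|{: Rs}|%:R.
  by apply: mul_weight_bound => //; rewrite ler_norml; lra.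
rewrite ler_norml => /andP[h5 h6]; rewrite ler_norml /dev.
have : 0 <= #|{: Rs}|%:R :> R by [].
by move: h5 h6; rewrite mulrBl; lra.
Qed.

Lemma follows_large beta (L : nat) : weights beta ->
  exists2 w, follows beta w & (L <= csize w)%N.
Proof.
move=> wb; exists (round beta (L + #|{: Rs}|)); first exact: follows_round.
have /andP[+ _] := csize_round (L + #|{: Rs}|) wb.
by rewrite natrD addrK ler_nat.
Qed.

End weights.

(** * Comparison of long count vectors with rays *)

Section comparison.
Context {R : realType} {d : nat} {Rs : {fset 'rV[int]_d}}.
Variables (H : cnt Rs -> R) (lam : cnt Rs -> \bar R).
Implicit Types (beta : Rs -> R) (u v w : cnt Rs).

(* H is the log partition function: prolonging a path of at most n steps by at
   most eps n steps costs at most eta n. *)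
Definition extension_stable := forall eta : R, 0 < eta -> exists2 eps : R, 0 < eps &
  exists N : nat, forall (n : nat) u v, (N <= n)%N -> cle u v -> (csize v <= n)%N ->
    (csize v)%:R - (csize u)%:R <= eps * n%:R -> H u - eta * n%:R <= H v.

Definition ray_limits := forall u, (0 < csize u)%N ->
  (H (cmul k u) / (k * csize u)%:R)%:E @[k --> \oo] --> lam u.

Hypothesis H_ext : extension_stable.
Hypothesis H_ray : ray_limits.

Lemma ray_lower w (r r' : R) : (0 < csize w)%N -> r' < r -> (r%:E <= lam w)%E ->
  exists K : nat, forall k, (K <= k)%N -> r' * (k * csize w)%:R <= H (cmul k w).
Proof.
move=> w0 r'r rl; have := H_ray w0 => /cvg_limn_einf_sup[e _].
have /limn_einf_gt_near[K _ hK] : (r'%:E < limn_einf (fun k => (H (cmul k w) / (k * csize w)%:R)%:E))%E.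
  by rewrite e; apply: lt_le_trans rl; rewrite lte_fin.
exists K.+1 => k Kk; have := hK k (ltnW Kk); rewrite lte_fin => /ltW.
by rewrite ler_pdivlMr// ltr0n muln_gt0 w0 (leq_trans _ Kk).
Qed.

Lemma ray_upper w (r r' : R) : (0 < csize w)%N -> r < r' -> (lam w <= r%:E)%E ->
  exists K : nat, forall k, (K <= k)%N -> H (cmul k w) <= r' * (k * csize w)%:R.
Proof.
move=> w0 rr' rl; have := H_ray w0 => /cvg_limn_einf_sup[_ e].
have /limn_esup_lt_near[K _ hK] : (limn_esup (fun k => (H (cmul k w) / (k * csize w)%:R)%:E) < r'%:E)%E.
  by rewrite e; apply: le_lt_trans rl _; rewrite lte_fin.
exists K.+1 => k Kk; have := hK k (ltnW Kk); rewrite lte_fin => /ltW.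
by rewrite ler_pdivrMr// ltr0n muln_gt0 w0 (leq_trans _ Kk).
Qed.

(* A multiple k w of a long vector w following beta, with k |w| slightly below
   |v|, lies under every long v following beta. *)
Lemma follows_lower beta (p r : R) : weights beta -> p < r -> exists L : nat, forall w,
  follows beta w -> (L <= csize w)%N -> (r%:E <= lam w)%E ->
  exists N : nat, forall v, follows beta v -> (N <= csize v)%N ->
    p * (csize v)%:R <= H v.
Proof.
move=> wb pr; have [bm bm0 hbm] := weights_min wb.
pose del := r - p; have del0 : 0 < del by rewrite subr_gt0.
have [eps0 eps00 [N0 hN0]] := H_ext (divr_gt0 del0 (ltr0n _ 4)).
set D := @dev R d Rs; have D0 : 0 < D by rewrite mulr_gt0// ltr_wpDl.
pose rm := `|r| + del; have rm0 : 0 < rm by rewrite ltr_wpDl.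
(* The multiple of [w] will be shorter than [v] by at most [2 * eps * n] steps: [eps0 / 2] makes
   this an extension that [H_ext] admits, and [del / (8 * rm)] bounds the rate lost on these steps
   by [del / 4]. [H_ext] and the ray limit cost another [del / 4] each. *)
pose eps := Num.min (1/4) (Num.min (eps0 / 2) (del / (8 * rm))).
have eps_gt0 : 0 < eps by rewrite !lt_min !divr_gt0// mulr_gt0.
have eps1 : eps <= 1/4 by rewrite ge_min lexx.
have eps2 : 2 * eps <= eps0.
  have : eps <= eps0 / 2 by rewrite !ge_min lexx !orbT.
  lra.
have eps3 : eps * (8 * rm) <= del.
  by rewrite -ler_pdivlMr ?mulr_gt0// !ge_min lexx !orbT.
have ebm : 0 < eps * bm by rewrite mulr_gt0.
have [L hL] := natr_large (2 * D / (eps * bm)).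
exists L.+1 => w fw Lw rw.
have w0 : (0 < csize w)%N by apply: leq_trans Lw.
set m : R := (csize w)%:R; have m0 : 0 < m by rewrite ltr0n.
have mL : 2 * D <= m * (eps * bm) by rewrite -ler_pdivrMr// hL// ltnW.
have rr' : r - del / 4 < r by rewrite ltrBlDr ltrDl divr_gt0.
have [K hK] := ray_lower w0 rr' rw.
have [N hN] := natr_large (Num.max (2 * D / (eps * bm)) (Num.max (m / eps) (2 * m * (K%:R + 1)))).
exists (maxn N N0).+1 => v fv; rewrite -ltnS => Nv.
have {Nv} : (maxn N N0 <= csize v)%N by rewrite ltnW.
rewrite geq_max => /andP[Nv N0v].
set n : R := (csize v)%:R.
have := hN _ Nv; rewrite !ge_max -/n => /and3P[n1 n2 n3].
have n0 : 0 < n by apply: lt_le_trans n2; rewrite divr_gt0.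
have {}n1 : 2 * D <= n * (eps * bm) by rewrite -ler_pdivrMr.
have {}n2 : m <= n * eps by rewrite -ler_pdivrMr.
pose k := Num.truncn ((1 - eps) * n / m).
have q0 : 0 <= (1 - eps) * n / m by rewrite divr_ge0 ?ltW// mulr_gt0//; lra.
have /andP[k1 k2] := truncn_itv q0; rewrite -/k in k1 k2.
have km1 : k%:R * m <= (1 - eps) * n by rewrite -ler_pdivlMr.
have km2 : (1 - 2 * eps) * n <= k%:R * m.
  move: k2; rewrite ltr_pdivrMr// -natr1; nra.
have Kk : (K <= k)%N.
  rewrite -ltnS -(ltr_nat R); apply: le_lt_trans k2.
  rewrite ler_pdivlMr//; nra.
have kwv : cle (cmul k w) v.
  move=> z; rewrite ffunE; have [b0|b0] := eqVneq (beta z) 0.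
    by rewrite (fw z).2// muln0.
  rewrite -(ler_nat R) natrM.
  have bz := hbm z b0.
  have := (fw z).1; have := (fv z).1; rewrite !ler_norml -/m -/n -/D.
  move=> /andP[v1 v2] /andP[w1 w2].
  have h1 : k%:R * (w z)%:R <= k%:R * (m * beta z + D).
    by apply: ler_wpM2l => //; lra.
  have h2 : k%:R * m * beta z <= (1 - eps) * n * beta z.
    by apply: ler_wpM2r => //; exact: wb.1.
  (* The gap [eps * n * beta z] left between [k w] and [v] absorbs both deviations: [k * D] because
     [w] is long, and [D] because [n] is large. *)
  have h3 : 2 * (k%:R * D) <= n * eps * beta z.
    have e1 : k%:R * (2 * D) <= k%:R * (m * (eps * bm)) by apply: ler_wpM2l.
    have e2 : k%:R * m * (eps * bm) <= n * (eps * bm).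
      by apply: ler_wpM2r; [exact: ltW|nra].
    have e3 : n * eps * bm <= n * eps * beta z.
      by apply: ler_wpM2l => //; rewrite mulr_ge0 ?ltW.
    by lra.
  have h4 : 2 * D <= n * eps * beta z.
    have e3 : n * eps * bm <= n * eps * beta z.
      by apply: ler_wpM2l => //; rewrite mulr_ge0 ?ltW.
    by lra.
  by lra.
have sz : (csize (cmul k w))%:R = k%:R * m :> R by rewrite csize_mul natrM.
have := hN0 (csize v) (cmul k w) v N0v kwv (leqnn _).
rewrite sz -/n => h; have {h} : H (cmul k w) - del / 4 * n <= H v.
  apply: h.
  have : 2 * eps * n <= eps0 * n by apply: ler_wpM2r => //; exact: ltW.
  by lra.
apply: le_trans.
have := hK k Kk; rewrite natrM -/m; move: (H _) => h Hk.
suff : (r - del / 4) * n - del / 4 * n <= (r - del / 4) * (k%:R * m).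
  by move: Hk; rewrite /del; nra.
have a1 : `|r - del / 4| <= rm.
  rewrite (le_trans (ler_normB _ _))// /rm lerD2l ger0_norm; last by rewrite divr_ge0 ?ltW.
  by lra.
have a2 : (r - del / 4) * (n - k%:R * m) <= rm * (2 * eps * n).
  apply: le_trans (ler_norm _) _; rewrite normrM; apply: ler_pM => //.
  by rewrite ger0_norm; lra.
have a3 : n * (eps * (8 * rm)) <= n * del by apply: ler_wpM2l => //; exact: ltW.
by lra.
Qed.

(** Mirror image of [follows_lower]: every long [v] following [beta] lies under a multiple of [w] of
    slightly larger size, and extending [v] to this multiple bounds [H v] from above. *)
Lemma follows_upper beta (r q : R) : weights beta -> r < q -> exists L : nat, forall w,
  follows beta w -> (L <= csize w)%N -> (lam w <= r%:E)%E ->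
  exists N : nat, forall v, follows beta v -> (N <= csize v)%N ->
    H v <= q * (csize v)%:R.
Proof.
move=> wb rq; have [bm bm0 hbm] := weights_min wb.
pose del := q - r; have del0 : 0 < del by rewrite subr_gt0.
have [eps0 eps00 [N0 hN0]] := H_ext (divr_gt0 del0 (ltr0n _ 8)).
set D := @dev R d Rs; have D0 : 0 < D by rewrite mulr_gt0// ltr_wpDl.
pose rm := `|r| + del; have rm0 : 0 < rm by rewrite ltr_wpDl.
pose eps := Num.min (1/4) (Num.min (eps0 / 2) (del / (8 * rm))).
have eps_gt0 : 0 < eps by rewrite !lt_min !divr_gt0// mulr_gt0.
have eps1 : eps <= 1/4 by rewrite ge_min lexx.
have eps2 : 2 * eps <= eps0.
  have : eps <= eps0 / 2 by rewrite !ge_min lexx !orbT.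
  lra.
have eps3 : eps * (8 * rm) <= del.
  by rewrite -ler_pdivlMr ?mulr_gt0// !ge_min lexx !orbT.
have ebm : 0 < eps * bm by rewrite mulr_gt0.
have [L hL] := natr_large (4 * D / (eps * bm)).
exists L.+1 => w fw Lw rw.
have w0 : (0 < csize w)%N by apply: leq_trans Lw.
set m : R := (csize w)%:R; have m0 : 0 < m by rewrite ltr0n.
have mL : 4 * D <= m * (eps * bm) by rewrite -ler_pdivrMr// hL// ltnW.
have rr' : r < r + del / 4 by rewrite ltrDl divr_gt0.
have [K hK] := ray_upper w0 rr' rw.
have [N hN] := natr_large (Num.max (4 * D / (eps * bm)) (Num.max (m / eps) (m * K%:R))).
exists (maxn N N0) => v fv; rewrite geq_max => /andP[Nv N0v].
set n : R := (csize v)%:R.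
have := hN _ Nv; rewrite !ge_max -/n => /and3P[n1 n2 n3].
have n0 : 0 < n by apply: lt_le_trans n2; rewrite divr_gt0.
have {}n1 : 4 * D <= n * (eps * bm) by rewrite -ler_pdivrMr.
have {}n2 : m <= n * eps by rewrite -ler_pdivrMr.
pose k := (Num.truncn ((1 + eps) * n / m)).+1.
have q0 : 0 <= (1 + eps) * n / m by rewrite divr_ge0 ?ltW// mulr_gt0//; lra.
have /andP[k2 k1] := truncn_itv q0; rewrite -/k in k1.
have km1 : (1 + eps) * n <= k%:R * m by rewrite -ler_pdivrMr// ltW.
have km2 : k%:R * m <= (1 + 2 * eps) * n.
  by move: k2; rewrite ler_pdivlMr// /k -natr1; nra.
have Kk : (K <= k)%N.
  rewrite -(ler_nat R) -(ler_pM2l m0); nra.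
have vkw : cle v (cmul k w).
  move=> z; rewrite ffunE; have [b0|b0] := eqVneq (beta z) 0.
    by rewrite (fv z).2.
  rewrite -(ler_nat R) natrM.
  have bz := hbm z b0.
  have := (fw z).1; have := (fv z).1; rewrite !ler_norml -/m -/n -/D.
  move=> /andP[v1 v2] /andP[w1 w2].
  have h1 : k%:R * (m * beta z - D) <= k%:R * (w z)%:R.
    by apply: ler_wpM2l => //; lra.
  have h2 : (1 + eps) * n * beta z <= k%:R * m * beta z.
    by apply: ler_wpM2r => //; exact: wb.1.
  have e3 : n * eps * bm <= n * eps * beta z.
    by apply: ler_wpM2l => //; rewrite mulr_ge0 ?ltW.
  have h3 : 2 * (k%:R * D) <= n * eps * beta z.
    have e1 : k%:R * (4 * D) <= k%:R * (m * (eps * bm)) by apply: ler_wpM2l.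
    have e2 : k%:R * m * (eps * bm) <= 2 * n * (eps * bm).
      by apply: ler_wpM2r; [exact: ltW|nra].
    by lra.
  by lra.
have sz : (csize (cmul k w))%:R = k%:R * m :> R by rewrite csize_mul natrM.
have N0k : (N0 <= csize (cmul k w))%N.
  by apply: leq_trans N0v _; apply: csize_le.
have := hN0 _ v (cmul k w) N0k vkw (leqnn _).
rewrite sz -/n => h; have {h} : H v - del / 8 * (k%:R * m) <= H (cmul k w).
  apply: h.
  have : n * (2 * eps) <= n * eps0 by apply: ler_wpM2l => //; exact: ltW.
  have : n * eps0 <= (k%:R * m) * eps0 by apply: ler_wpM2r; [exact: ltW|nra].
  by lra.
have := hK k Kk; rewrite natrM -/m; move: (H (cmul _ _)) => h Hk Hv.
have a1 : `|r + del / 4| <= rm.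
  rewrite (le_trans (ler_normD _ _))// /rm lerD2l ger0_norm; last by rewrite divr_ge0 ?ltW.
  by lra.
have a2 : (r + del / 4) * (k%:R * m - n) <= rm * (2 * eps * n).
  apply: le_trans (ler_norm _) _; rewrite normrM; apply: ler_pM => //.
  by rewrite ger0_norm; nra.
have a3 : n * (eps * (8 * rm)) <= n * del by apply: ler_wpM2l => //; exact: ltW.
have a4 : del * (k%:R * m) <= del * (2 * n) by apply: ler_wpM2l; [exact: ltW|nra].
have a5 : n * (q - r) = n * del by [].
have a6 : 0 <= n * del by rewrite mulr_ge0 ?ltW.
by lra.
Qed.

End comparison.

(** * Existence of directional limits *)

Section directional_limit.
Context {R : realType} {d : nat} {Rs : {fset 'rV[int]_d}}.
Variables (H : cnt Rs -> R) (lam : cnt Rs -> \bar R).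
Implicit Types (beta : Rs -> R) (u v w : cnt Rs).
Hypothesis H_ext : extension_stable H.

(** [v] is built up from [c0] in [K] stages. Each adds at most [eps * n] steps and costs at most
    [n = csize v], and [K] does not depend on [v]. *)
Lemma extension_lower_bound : H c0 = 0 -> exists2 C : R, 0 < C &
  exists N : nat, forall v, (N <= csize v)%N -> - C * (csize v)%:R <= H v.
Proof.
move=> H0; have [eps eps0 [N0 hN0]] := H_ext ltr01.
pose K := (Num.truncn (2 / eps)).+1.
have K0 : 0 < K%:R :> R by rewrite ltr0n.
have Keps : 2 <= K%:R * eps.
  by rewrite -ler_pdivrMr//; exact: ltW (truncnS_gt _).
have [N hN] := natr_large (2 * #|{: Rs}|%:R / eps).
exists K%:R => //; exists (maxn N N0) => v; rewrite geq_max => /andP[Nv N0v].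
set n : R := (csize v)%:R.
have nR : 2 * #|{: Rs}|%:R <= n * eps by rewrite -ler_pdivrMr// hN.
pose u j : cnt Rs := [ffun z => (j * v z) %/ K]%N.
have uK : u K = v by apply/ffunP => z; rewrite ffunE mulKn.
have u0 : u 0%N = c0 by apply/ffunP => z; rewrite !ffunE mul0n div0n.
have ule i j : (i <= j)%N -> cle (u i) (u j).
  by move=> ij z; rewrite !ffunE leq_div2r// leq_mul2r ij orbT.
have incr j : (csize (u j.+1))%:R - (csize (u j))%:R <= eps * n.
  have h : (csize (u j.+1) <= csize (u j) + (\sum_z v z %/ K + #|{: Rs}|))%N.
    rewrite /csize -sum1_card -!big_split/=; apply: leq_sum => z _.
    by rewrite !ffunE mulSn addnC addnA leq_divDl.
  have h2 : (\sum_z v z %/ K)%N%:R * K%:R <= n.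
    rewrite -natrM ler_nat big_distrl/=; apply: leq_sum => z _.
    exact: leq_divM.
  have h3 : (\sum_z v z %/ K)%N%:R * 2 <= eps * n.
    have : (\sum_z v z %/ K)%N%:R * 2 <= (\sum_z v z %/ K)%N%:R * (K%:R * eps) :> R.
      by apply: ler_wpM2l.
    have : (\sum_z v z %/ K)%N%:R * K%:R * eps <= n * eps.
      by apply: ler_wpM2r => //; exact: ltW.
    by lra.
  by move: h; rewrite -(ler_nat R) !natrD; lra.
suff hj j : (j <= K)%N -> - j%:R * n <= H (u j) by have := hj K (leqnn K); rewrite uK.
elim: j => [_|j IH jK]; first by rewrite u0 H0 oppr0 mul0r.
have := hN0 (csize v) (u j) (u j.+1) N0v (ule _ _ (leqnSn j)).
have szle : (csize (u j.+1) <= csize v)%N by have := csize_le (ule _ _ jK); rewrite uK.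
by move=> /(_ szle (incr j)); have := IH (ltnW jK); rewrite -natr1 -/n; lra.
Qed.

Hypothesis H_ray : ray_limits H lam.

(** A lower limit of [H v / csize v], uniform over the long vectors following [beta]. [dir_limit_lt]
    shows that it is an upper limit as well. *)
Definition dir_limit beta : \bar R := ereal_sup [set p%:E | p in
  [set p : R | exists N : nat, forall v, follows beta v -> (N <= csize v)%N ->
     p * (csize v)%:R <= H v]].

Lemma dir_limit_ge beta (p : R) (N : nat) :
  (forall v, follows beta v -> (N <= csize v)%N -> p * (csize v)%:R <= H v) ->
  (p%:E <= dir_limit beta)%E.
Proof. by move=> h; apply: ereal_sup_ubound; exists p => //; exists N. Qed.

Lemma dir_limit_gt beta (p : R) : (p%:E < dir_limit beta)%E ->
  exists N : nat, forall v, follows beta v -> (N <= csize v)%N ->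
    p * (csize v)%:R <= H v.
Proof.
move=> /ereal_sup_gt[_ [q [N hN] <-]]; rewrite lte_fin => pq.
exists N => v fv Nv; apply: le_trans (hN v fv Nv).
by rewrite ler_wpM2r// ltW.
Qed.

Lemma lte_real_between (x : \bar R) (y : R) : (x < y%:E)%E ->
  exists2 r : R, (x < r%:E)%E & r < y.
Proof. by move=> /lte_rat_between[q h1 h2]; exists (ratr q); rewrite -?lte_fin. Qed.

Lemma gte_real_between (x : \bar R) (y : R) : (y%:E < x)%E ->
  exists2 r : R, y < r & (r%:E < x)%E.
Proof. by move=> /lte_rat_between[q h1 h2]; exists (ratr q); rewrite -?lte_fin. Qed.

(** A single long ray [w] decides. If [lam w] exceeds [q2], then all long vectors reach the rate
    [q1], against the choice of [q1]; otherwise [follows_upper] applies. *)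
Lemma dir_limit_lt beta (q : R) : weights beta -> (dir_limit beta < q%:E)%E ->
  exists N : nat, forall v, follows beta v -> (N <= csize v)%N ->
    H v <= q * (csize v)%:R.
Proof.
move=> wb /lte_real_between[q2 /lte_real_between[q1 bq1 q12] q2q].
have [L1 hL1] := follows_lower H_ext H_ray wb q12.
have [L2 hL2] := follows_upper H_ext H_ray wb q2q.
have [w fw Lw] := follows_large (maxn L1 L2) wb.
move: Lw; rewrite geq_max => /andP[L1w L2w].
have [lw|/ltW lw] := leP (lam w) q2%:E; first exact: hL2 lw.
have [N hN] := hL1 w fw L1w lw.
by have := dir_limit_ge hN; rewrite leNgt bq1.
Qed.

Lemma dir_limit_gt_ray beta (p : R) : weights beta -> (p%:E < dir_limit beta)%E ->
  exists L : nat, forall w, follows beta w -> (L <= csize w)%N -> (p%:E <= lam w)%E.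
Proof.
move=> wb /gte_real_between[p1 pp1 /gte_real_between[p2 p12 p2b]].
have [L hL] := follows_upper H_ext H_ray wb pp1.
have [N hN] := dir_limit_gt p2b.
exists L => w fw Lw; rewrite leNgt; apply/negP => /ltW lw.
have [N' hN'] := hL w fw Lw lw.
have [v fv] := follows_large (maxn N N').+1 wb; rewrite gtn_max => /andP[Nv N'v].
have := le_trans (hN v fv (ltnW Nv)) (hN' v fv (ltnW N'v)).
by rewrite leNgt ltr_pM2r ?p12// ltr0n (leq_ltn_trans _ Nv).
Qed.

Lemma dir_limit_lt_ray beta (q : R) : weights beta -> (dir_limit beta < q%:E)%E ->
  exists L : nat, forall w, follows beta w -> (L <= csize w)%N -> (lam w <= q%:E)%E.
Proof.
move=> wb /lte_real_between[q1 bq1 q1q].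
have [L hL] := follows_lower H_ext H_ray wb q1q.
exists L => w fw Lw; rewrite leNgt; apply/negP => /ltW lw.
have [N hN] := hL w fw Lw lw.
by have := dir_limit_ge hN; rewrite leNgt bq1.
Qed.

Lemma dir_limit_le_of_rays beta (p : R) : weights beta ->
  (forall L : nat, exists w, [/\ follows beta w, (L <= csize w)%N & (p%:E <= lam w)%E]) ->
  (p%:E <= dir_limit beta)%E.
Proof.
move=> wb h; rewrite leNgt; apply/negP => /lte_real_between[q bq qp].
have [L hL] := dir_limit_lt_ray wb bq.
have [w [fw Lw pw]] := h L.
by have := le_trans pw (hL w fw Lw); rewrite lee_fin leNgt qp.
Qed.

End directional_limit.

(** * Independence of the choice of weights *)

Section weight_independence.
Context {R : realType} {d : nat} {Rs : {fset 'rV[int]_d}}.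
Implicit Types (beta : Rs -> R) (u v w : cnt Rs).

Definition barycenter beta : 'rV[R]_d := \sum_z beta z *: real_pt (val z).

Lemma pigeonhole_nat (m : nat) (f : nat -> 'I_m) :
  exists i j, [/\ (i < j)%N, (j <= m)%N & f i = f j].
Proof.
apply: contrapT => h.
have inj : injective (fun i : 'I_m.+1 => f i).
  move=> i j fij; apply/eqP; rewrite eq_le; apply/andP; split.
    rewrite leEord leqNgt; apply/negP => ji; apply: h; exists j, i; split => //.
    by rewrite -ltnS.
  rewrite leEord leqNgt; apply/negP => ij; apply: h; exists i, j; split => //.
  by rewrite -ltnS.
by have := leq_card _ inj; rewrite !card_ord ltnn.
Qed.

Lemma bounded_int_pigeonhole (I : finType) (B : nat) (f : nat -> I -> int) :
  (forall n i, `|f n i| <= B%:Z) -> exists K : nat, forall M : nat -> nat,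
  exists i j, [/\ (i < j)%N, (j <= K)%N & f (M i) = f (M j)].
Proof.
move=> fB; pose g n : {ffun I -> 'I_(2 * B).+1} := [ffun i => inord (absz (f n i + B%:Z))].
exists #|{: {ffun I -> 'I_(2 * B).+1}}| => M.
have [i [j [ij jK /enum_rank_inj e]]] := pigeonhole_nat (fun n => enum_rank (g (M n))).
exists i, j; split => //; apply/funext => z.
have /(congr1 (fun h : {ffun I -> 'I_(2 * B).+1} => (h z : nat))) := e.
have b1 := fB (M i) z; have b2 := fB (M j) z.
rewrite !ffunE !inordK; last 2 first.
- by move: b2; lia.
- by move: b1; lia.
by move: b1 b2; lia.
Qed.

End weight_independence.

Section matched_weights.
Context {R : realType} {d : nat} {Rs : {fset 'rV[int]_d}}.
Implicit Types (beta : Rs -> R) (u v w : cnt Rs).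

Lemma round_deviation beta N z : weights beta ->
  `|(round beta N z)%:R - (csize (round beta N))%:R * beta z| <= #|{: Rs}|%:R + 1.
Proof.
move=> wb; have /andP[h1 h2] := round_near N z wb.
have /andP[h3 h4] := csize_round N wb.
have : `|((csize (round beta N))%:R - N%:R) * beta z| <= #|{: Rs}|%:R.
  by apply: mul_weight_bound => //; rewrite ler_norml; lra.
rewrite ler_norml => /andP[h5 h6]; rewrite ler_norml.
by move: h5 h6; rewrite mulrBl; lra.
Qed.

Lemma round_le beta (M N : nat) : weights beta -> (M <= N)%N ->
  cle (round beta M) (round beta N).
Proof.
move=> wb MN z; rewrite !ffunE; apply: le_truncn.
by rewrite ler_wpM2r ?(wb.1 z)// ler_nat.
Qed.

Lemma cposE u (j : 'I_d) : (cpos u 0 j)%:~R = \sum_z (u z)%:R * (val z 0 j)%:~R :> R.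
Proof.
rewrite /cpos summxE rmorph_sum/=; apply: eq_bigr => z _.
by rewrite mulmxnE rmorphMn/= mulr_natl.
Qed.

(* The displacements of the roundings of N beta and of N beta' differ by a
   bounded integer vector, so two values of N give the same difference; subtract. *)
Lemma matched_follows beta beta' : weights beta -> weights beta' ->
  barycenter beta = barycenter beta' -> forall L : nat, exists w w',
  [/\ follows beta w, follows beta' w', csize w = csize w', cpos w = cpos w' &
      (L <= csize w)%N].
Proof.
move=> wb wb' ebar L.
set c := #|{: Rs}|.
(* The entry [None] compares the sizes, so that a repeated value of [f] matches them along with the
   displacements. *)
pose f (n : nat) (o : option 'I_d) : int := if o is Some j
  then cpos (round beta n) 0 j - cpos (round beta' n) 0 j
  else (csize (round beta n))%:Z - (csize (round beta' n))%:Z.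
pose a (z : Rs) (j : 'I_d) : nat := absz (val z 0 j).
pose B : nat := ((\sum_z \sum_j a z j) * 2 + c)%N.
have bj (bt : Rs -> R) n (j : 'I_d) : weights bt ->
    `|(cpos (round bt n) 0 j)%:~R - n%:R * (barycenter bt) 0 j| <=
    (\sum_z \sum_j a z j)%N%:R.
  move=> wbt; rewrite cposE /barycenter summxE mulr_sumr -sumrB.
  apply: le_trans (ler_norm_sum _ _ _) _; rewrite natr_sum; apply: ler_sum => z _.
  rewrite !mxE mulrA -mulrBl normrM (bigD1 j)//= natrD.
  have : `|(round bt n z)%:R - n%:R * bt z| <= 1.
    by have /andP[h1 h2] := round_near n z wbt; rewrite ler_norml; lra.
  have -> : `|((val z) 0 j)%:~R| = (a z j)%:R :> R.
    by rewrite /a natr_absz intr_norm.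
  move=> h; apply: (@le_trans _ _ (1 * (a z j)%:R)); first exact: ler_wpM2r.
  by rewrite mul1r lerDl.
have fB n o : `|f n o| <= B%:Z.
  rewrite -(ler_int R) intr_norm -[leRHS]pmulrn /f /B; case: o => [j|]; last first.
    rewrite rmorphB/= -!pmulrn natrD ler_norml.
    have /andP[h1 h2] := csize_round n wb; have /andP[h3 h4] := csize_round n wb'.
    have : 0 <= (\sum_z \sum_j a z j)%N%:R :> R by [].
    by rewrite -/c in h1 h3; rewrite natrM; lra.
  rewrite rmorphB/= natrD natrM.
  have := bj beta n j wb; have := bj beta' n j wb'; rewrite -ebar !ler_norml.
  have : 0 <= c%:R :> R by [].
  by lra.
have [K hK] := bounded_int_pigeonhole fB.
(* The samples are [L + c] apart: the rounding at [N] has size between [N - c] and [N], hence the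
   difference of two of them has size at least [L]. *)
have [i [j [ij jK e]]] := hK (fun k => (k * (L + c))%N).
pose S := (L + c)%N; rewrite -/S in e.
have iSjS : (i * S <= j * S)%N by rewrite leq_mul2r (ltnW ij) orbT.
have le1 := round_le wb iSjS; have le2 := round_le wb' iSjS.
have fl (bt : Rs -> R) : weights bt ->
    follows bt (csub (round bt (j * S)) (round bt (i * S))).
  move=> wbt z; have lez := round_le wbt iSjS; split; last first.
    by move=> b0; rewrite [LHS]ffunE !round_eq0.
  rewrite csize_sub// [X in X%:R - _]ffunE !natrB ?csize_le//.
  have := round_deviation (j * S) z wbt; have := round_deviation (i * S) z wbt.
  rewrite !ler_norml /dev.
  have : 0 <= #|{: Rs}|%:R :> R by [].
  by lra.
exists (csub (round beta (j * S)) (round beta (i * S))).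
exists (csub (round beta' (j * S)) (round beta' (i * S))).
have es : csize (csub (round beta (j * S)) (round beta (i * S))) =
    csize (csub (round beta' (j * S)) (round beta' (i * S))).
  rewrite !csize_sub//; have := congr1 (fun h => h None) e; rewrite /f.
  have := csize_le le1; have := csize_le le2; lia.
split => //; [exact: fl|exact: fl| |].
  rewrite !cpos_sub//; apply/rowP => k; have := congr1 (fun h => h (Some k)) e.
  have aux (x1 x2 x3 x4 : int) : x1 - x2 = x3 - x4 -> x3 - x1 = x4 - x2 by lia.
  by rewrite /f !mxE; exact: aux.
rewrite csize_sub// -(ler_nat R) natrB ?csize_le//.
have /andP[h1 h2] := csize_round (j * S) wb; have /andP[h3 h4] := csize_round (i * S) wb.
have : ((i * S)%:R + S%:R <= (j * S)%:R :> R).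
  by rewrite -natrD ler_nat -mulSnr leq_mul2r ij orbT.
rewrite -/c in h1 h3; rewrite {2}/S natrD; lra.
Qed.

Variables (H : cnt Rs -> R) (lam : cnt Rs -> \bar R).
Hypothesis H_ext : extension_stable H.
Hypothesis H_ray : ray_limits H lam.
Hypothesis H_pos : forall u v, csize u = csize v -> cpos u = cpos v -> H u = H v.

Lemma ray_eq u v : (0 < csize u)%N -> csize u = csize v -> cpos u = cpos v ->
  lam u = lam v.
Proof.
move=> u0 es ep; have h1 := H_ray u0.
have h2 : (H (cmul k v) / (k * csize v)%:R)%:E @[k --> \oo] --> lam v.
  by apply: H_ray; rewrite -es.
apply: (cvg_unique _ h1); first exact: ereal_hausdorff.
have -> // : (fun k => (H (cmul k u) / (k * csize u)%:R)%:E) =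
   (fun k => (H (cmul k v) / (k * csize v)%:R)%:E).
by apply/funext => k; rewrite es (H_pos (v := cmul k v)) ?csize_mul ?cpos_mul ?es ?ep.
Qed.

Lemma ray_scale k u : (0 < k)%N -> (0 < csize u)%N -> lam (cmul k u) = lam u.
Proof.
move=> k0 u0; have h1 := H_ray u0.
have h2 : (H (cmul m (cmul k u)) / (m * csize (cmul k u))%:R)%:E @[m --> \oo] -->
    lam (cmul k u).
  by apply: H_ray; rewrite csize_mul muln_gt0 k0.
apply: (cvg_unique _ h2); first exact: ereal_hausdorff.
have -> : (fun m => (H (cmul m (cmul k u)) / (m * csize (cmul k u))%:R)%:E) =
   (fun m => (H (cmul m u) / (m * csize u)%:R)%:E) \o (fun m => (m * k)%N).
  by apply/funext => m /=; rewrite cmul_mul csize_mul mulnA.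
apply: (cvg_comp (fun m => (m * k)%N) _ _ h1).
by move=> A [N _ hN]; exists N => // m /= Nm; apply: hN => /=; rewrite (leq_trans Nm)// leq_pmulr.
Qed.

(** Vectors matched in size and displacement have the same ray limit, and on both sides the rays of
    long vectors determine [dir_limit]. *)
Lemma dir_limit_weights_le beta beta' : weights beta -> weights beta' ->
  barycenter beta = barycenter beta' -> (dir_limit H beta <= dir_limit H beta')%E.
Proof.
move=> wb wb' ebar; rewrite leNgt; apply/negP => /lte_rat_between[q q1 q2].
have [L hL] := dir_limit_gt_ray H_ext H_ray wb q2.
suff : ((ratr q)%:E <= dir_limit H beta')%E by rewrite leNgt q1.
apply: (dir_limit_le_of_rays H_ext H_ray wb') => M.
have [w [w' [fw fw' es ep Lw]]] := matched_follows wb wb' ebar (maxn L M).+1.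
move: Lw; rewrite gtn_max => /andP[Lw Mw].
exists w'; split => //; first by rewrite -es ltnW.
by rewrite -(ray_eq _ es ep) ?hL// ?(ltnW Lw)// (leq_ltn_trans _ Lw).
Qed.

Lemma dir_limit_weights_eq beta beta' : weights beta -> weights beta' ->
  barycenter beta = barycenter beta' -> dir_limit H beta = dir_limit H beta'.
Proof.
move=> wb wb' ebar; apply/eqP; rewrite eq_le; apply/andP.
by split; apply: dir_limit_weights_le.
Qed.

(* A path following beta for the first (1 - t) n steps extends to one following
   alpha, at a cost that is small with t. *)
Lemma dir_limit_mix (eta : R) : 0 < eta -> exists2 t0, 0 < t0 & forall alpha beta t (r : R),
  weights alpha -> weights beta -> 0 <= t <= t0 ->
  (forall z, (1 - t) * beta z <= alpha z) -> (r%:E < dir_limit H beta)%E ->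
  (((1 - t) * r - eta)%:E <= dir_limit H alpha)%E.
Proof.
move=> eta0; have [eps eps0 [N0 hN0]] := H_ext (divr_gt0 eta0 (ltr0n _ 2)).
exists (Num.min (eps / 4) (1 / 2)); first by rewrite lt_min !divr_gt0.
move=> alpha beta t r wa wb /andP[t0]; rewrite le_min => /andP[te t1] ab rb.
have [bm bm0 hbm] := weights_min wb.
have [N1 hN1] := dir_limit_gt rb.
set D := @dev R d Rs; have D0 : 0 < D by rewrite mulr_gt0// ltr_wpDl.
(* Rounding at [(1 - t) * n - K] removes [K * beta z >= D] at each [z] of nonzero weight, which
   absorbs the deviation of [v] from [alpha] and puts [w] under [v]. [K'] adds the losses by
   rounding. *)
pose K := D / bm; have K0 : 0 < K by rewrite divr_gt0.
pose K' := K + 1 + #|{: Rs}|%:R; have K'0 : 0 < K' by rewrite ltr_wpDr// ltr_wpDl// ltW.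
have [N hN] := natr_large (Num.max (2 * K' / eps) (Num.max (2 * (N1%:R + K')) (2 * `|r| * K' / eta))).
apply: (@dir_limit_ge _ _ _ _ _ _ (maxn N0 N)) => v fv.
rewrite geq_max => /andP[N0v Nv]; have := hN _ Nv.
set n : R := (csize v)%:R; rewrite !ge_max => /and3P[n1 n2 n3].
have {}n1 : 2 * K' <= n * eps by rewrite -ler_pdivrMr.
have {}n3 : 2 * `|r| * K' <= n * eta by rewrite -ler_pdivrMr.
have n0 : 0 <= n by [].
have N10 : 0 <= N1%:R :> R by [].
have tn : n * t <= n * (1/2) by exact: ler_wpM2l.
pose q := (1 - t) * n - K; have q0 : 0 <= q.
  by move: n2; rewrite /q /K'; have : 0 <= #|{: Rs}|%:R :> R by []; lra.
pose M := Num.truncn q; have /andP[M1 M2] := truncn_itv q0; rewrite -/M in M1 M2.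
pose w := round beta M.
have /andP[w1 w2] := csize_round M wb; rewrite -/w in w1 w2.
have wv : cle w v.
  move=> z; have [b0|b0] := eqVneq (beta z) 0; first by rewrite /w round_eq0.
  rewrite -(ler_nat R); have /andP[_ h1] := round_near M z wb.
  apply: le_trans h1 _.
  have := (fv z).1; rewrite ler_norml -/n -/D => /andP[h2 _].
  have h3 : M%:R * beta z <= q * beta z by apply: ler_wpM2r => //; exact: wb.1.
  have h4 : D <= K * beta z.
    by rewrite /K mulrAC ler_pdivlMr// ler_wpM2l ?hbm// ltW.
  have h5 : n * ((1 - t) * beta z) <= n * alpha z by exact: ler_wpM2l.
  by move: h3; rewrite /q; lra.
rewrite -natr1 in M2.
have wlow : (1 - t) * n - K' <= (csize w)%:R by move: M2 w1; rewrite /q /K'; lra.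
have whigh : (csize w)%:R <= (1 - t) * n by move: M1 w2; rewrite /q; lra.
have N1w : (N1 <= csize w)%N by rewrite -(ler_nat R); lra.
have h := hN1 w (follows_round _ wb) N1w.
have := hN0 _ w v N0v wv (leqnn _); rewrite -/n => h'.
have {h'} : H w - eta / 2 * n <= H v.
  by apply: h'; have : n * t <= n * (eps / 4) by [exact: ler_wpM2l]; lra.
apply: le_trans.
have : r * ((1 - t) * n - (csize w)%:R) <= `|r| * K'.
  apply: le_trans (ler_norm _) _; rewrite normrM; apply: ler_wpM2l => //.
  by rewrite ger0_norm; lra.
by lra.
Qed.

End matched_weights.

Lemma ln_sublinear {R : realType} (e : R) : 0 < e ->
  exists N : nat, forall n : nat, (N <= n)%N -> ln n.+1%:R <= e * n%:R.
Proof.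
move=> e0; pose c := 2 / e; have c0 : 0 < c by rewrite divr_gt0.
have [N hN] := natr_large (2 * (c^-1 + ln c) / e).
exists N => n Nn; have := hN n Nn; rewrite ler_pdivrMr// => h.
have n0 : 0 < n.+1%:R / c by rewrite divr_gt0.
have -> : n.+1%:R = n.+1%:R / c * c by rewrite divfK// gt_eqF.
rewrite lnM ?posrE//.
have : ln (n.+1%:R / c) <= n.+1%:R / c.
  have := @le_ln1Dx R (n.+1%:R / c - 1); rewrite [1 + _]addrC subrK => h1.
  by apply: le_trans (h1 _) _; rewrite ?ltrBrDr ?addNr//; lra.
have e2 : c^-1 = e / 2 by rewrite /c invf_div.
rewrite -natr1 mulrDl mul1r e2; move: h; rewrite e2; lra.
Qed.

(** * The total free energy as a supremum over positive rays *)

Section total_limit.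
Context {R : realType} {d : nat} {Rs : {fset 'rV[int]_d}}.
Implicit Types (beta alpha : Rs -> R) (u v w : cnt Rs).
Variable z0 : Rs.
Variables (H : cnt Rs -> R) (lam : cnt Rs -> \bar R).
Hypothesis H_ext : extension_stable H.
Hypothesis H_ray : ray_limits H lam.

Lemma follows_positive alpha : weights alpha -> (forall z, 0 < alpha z) ->
  exists L : nat, forall w, follows alpha w -> (L <= csize w)%N -> cpositive w.
Proof.
move=> wa a0; have [m m0 hm] := weights_min wa.
have [L hL] := natr_large ((@dev R d Rs + 1) / m).
exists L => w fw Lw z; rewrite -(ltr_nat R).
have := hL _ Lw; rewrite ler_pdivrMr// => h.
have := (fw z).1; rewrite ler_norml => /andP[h1 _].
have : (csize w)%:R * m <= (csize w)%:R * alpha z by rewrite ler_wpM2l// hm// gt_eqF.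
by lra.
Qed.

Lemma ray_ge (C : R) (N : nat) :
  (forall v, (N <= csize v)%N -> - C * (csize v)%:R <= H v) ->
  forall u, (0 < csize u)%N -> ((- C)%:E <= lam u)%E.
Proof.
move=> hN u u0; rewrite -(cvg_lim _ (H_ray u0))//.
apply: lime_ge; first by apply/cvg_ex; exists (lam u); exact: H_ray.
exists N.+1 => // k /= Nk; rewrite lee_fin.
have ku : (0 < k * csize u)%N by rewrite muln_gt0 u0 (leq_trans _ Nk).
rewrite ler_pdivlMr ?ltr0n// -csize_mul; apply: hN.
by rewrite csize_mul (leq_trans (ltnW Nk))// leq_pmulr.
Qed.

Lemma dir_limit_ge_lower (C : R) (N : nat) :
  (forall v, (N <= csize v)%N -> - C * (csize v)%:R <= H v) ->
  forall beta, ((- C)%:E <= dir_limit H beta)%E.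
Proof. by move=> hN beta; apply: (@dir_limit_ge _ _ _ _ _ _ N) => v _; exact: hN. Qed.

Variable J : nat -> R.
Hypothesis H_le_J : forall u, H u <= J (csize u).
Hypothesis J_le_H : forall n, exists2 u, csize u = n &
  J n <= H u + #|{: Rs}|%:R * ln n.+1%:R.

(** Restricted to the positive vectors, whose ray limits turn out to be constant; [total_upper]
    shows that nothing is lost. *)
Definition ray_sup : \bar R := ereal_sup [set lam u | u in [set u | cpositive u]].

(** A path of length [n] repeats [u] as often as it fits and spends the fewer than [csize u]
    remaining steps on [z0]. *)
Lemma total_lower u (p : R) : cpositive u -> (p%:E < lam u)%E ->
  exists N : nat, forall n, (N <= n)%N -> p * n%:R <= J n.
Proof.
move=> u0 /gte_real_between[q pq /gte_real_between[r qr /ltW rl]].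
have su : (0 < csize u)%N := csize_positive z0 u0.
have [K hK] := ray_lower H_ray su qr rl.
have qp0 : 0 < q - p by rewrite subr_gt0.
have [eps eps0 [N0 hN0]] := H_ext (divr_gt0 qp0 (ltr0n _ 2)).
set m := csize u in su hK *.
have [N hN] := natr_large (Num.max (m%:R / eps) (2 * `|q| * m%:R / (q - p))).
exists (maxn (K * m) (maxn N0 N)) => n; rewrite !geq_max => /and3P[Kn N0n Nn].
have := hN n Nn; rewrite ge_max !ler_pdivrMr// => /andP[n1 n2].
pose k := (n %/ m)%N.
pose v : cnt Rs := cadd (cmul k u) [ffun z => if z == z0 then (n %% m)%N else 0%N].
have sv : csize v = n.
  rewrite csize_add csize_mul -/m [X in (_ + X)%N](_ : _ = n %% m)%N -?divn_eq//.
  rewrite /csize (bigD1 z0)//= ffunE eqxx.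
  by rewrite big1 ?addn0// => z /negPf zz; rewrite ffunE zz.
have kuv : cle (cmul k u) v by move=> z; rewrite [X in (_ <= X)%N]ffunE leq_addr.
have Kk : (K <= k)%N by rewrite /k leq_divRL.
have := H_le_J v; rewrite sv; apply: le_trans.
have e := divn_eq n m; rewrite -/k in e.
have lt : (n %% m < m)%N by rewrite ltn_mod.
have eR : n%:R = k%:R * m%:R + (n %% m)%:R :> R by rewrite {1}e natrD natrM.
have ltR : (n %% m)%:R <= m%:R :> R by rewrite ler_nat ltnW.
have ge0R : 0 <= (n %% m)%:R :> R by [].
have := hN0 n (cmul k u) v N0n kuv; rewrite sv => /(_ (leqnn _)).
rewrite csize_mul -/m => h; have {h} : H (cmul k u) - (q - p) / 2 * n%:R <= H v.
  by apply: h; rewrite natrM; lra.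
apply: le_trans; have := hK k Kk; rewrite natrM.
have : q * (n %% m)%:R <= `|q| * m%:R.
  apply: le_trans (ler_norm _) _; rewrite normrM; apply: ler_wpM2l => //.
  by rewrite ger0_norm.
have : q * n%:R = q * (k%:R * m%:R) + q * (n %% m)%:R by rewrite {1}eR mulrDr.
by lra.
Qed.

(* Every count vector u of size n lies under g w for a positive w from a finite
   set independent of n, with g |w| slightly larger than n. *)
Lemma total_upper (r q : R) : (forall u, cpositive u -> (lam u <= r%:E)%E) -> r < q ->
  exists N : nat, forall n, (N <= n)%N -> J n <= q * n%:R.
Proof.
move=> hr rq.
pose del := q - r; have del0 : 0 < del by rewrite subr_gt0.
have [eps0 eps00 [N0 hN0]] := H_ext (divr_gt0 del0 (ltr0n _ 8)).
pose rm := `|r| + del; have rm0 : 0 < rm by rewrite ltr_wpDl.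
pose eps := Num.min (1/4) (Num.min (eps0 / 2) (del / (8 * rm))).
have eps_gt0 : 0 < eps by rewrite !lt_min !divr_gt0// mulr_gt0.
have eps1 : eps <= 1/4 by rewrite ge_min lexx.
have eps2 : 2 * eps <= eps0.
  have : eps <= eps0 / 2 by rewrite !ge_min lexx !orbT.
  lra.
have eps3 : eps * (8 * rm) <= del.
  by rewrite -ler_pdivlMr ?mulr_gt0// !ge_min lexx !orbT.
set c := #|{: Rs}|.
have c0 : (0 < c)%N by apply/card_gt0P; exists z0.
have c0R : 0 < c%:R :> R by rewrite ltr0n.
pose B := (Num.truncn (2 * c%:R / eps)).+1.
have rr' : r < r + del / 8 by rewrite ltrDl divr_gt0.
have hKw w : exists K : nat, cpositive w -> forall k, (K <= k)%N ->
    H (cmul k w) <= (r + del / 8) * (k * csize w)%:R.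
  have [pw|npw] := pselect (cpositive w); last by exists 0%N.
  by have [K hK] := ray_upper H_ray (csize_positive z0 pw) rr' (hr w pw); exists K.
have [Kf hKf] := choice hKw.
pose K := (\max_(x : {ffun Rs -> 'I_B.+2}) Kf [ffun z => nat_of_ord (x z)])%N.
have c1 : 0 < del / (8 * c%:R) by rewrite divr_gt0// mulr_gt0.
have [N1 hN1] := ln_sublinear c1.
have [N hN] := natr_large (Num.max (2 * c%:R / eps) (c%:R * (K%:R + 1) / eps)).
exists (maxn N (maxn N1 N0)) => n; rewrite !geq_max => /and3P[Nn N1n N0n].
have := hN n Nn; rewrite ge_max !ler_pdivrMr// => /andP[n1 n2].
have {}hN1 := hN1 n N1n.
have [u su hu] := J_le_H n; apply: le_trans hu _.
(* Raising each coordinate of [u] to the next multiple of [g] adds at most [g * c <= eps * n] steps,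
   and the quotients are at most [2 * c / eps + 1], whatever [n] is. *)
pose g := Num.truncn (eps * n%:R / c%:R).
have g0 : 0 <= eps * n%:R / c%:R by rewrite divr_ge0// mulr_ge0// ltW.
have /andP[g1 g2] := truncn_itv g0; rewrite -/g in g1 g2.
have {}g1 : g%:R * c%:R <= eps * n%:R by rewrite -ler_pdivlMr.
have {}g2 : eps * n%:R < (g%:R + 1) * c%:R by rewrite natr1 -ltr_pdivrMr.
have gK : (K <= g)%N.
  rewrite -ltnS -(ltr_nat R) -natr1 -(ltr_pM2r c0R); lra.
have g3 : eps * n%:R <= 2 * (g%:R * c%:R) by lra.
have n0R : 0 < n%:R :> R.
  by rewrite -(pmulr_lgt0 _ eps_gt0); apply: lt_le_trans n1; rewrite mulr_gt0.
have gpos : (0 < g)%N.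
  rewrite -(ltr_nat R) -(pmulr_lgt0 _ c0R).
  have : 0 < eps * n%:R by rewrite mulr_gt0.
  by lra.
pose w : cnt Rs := [ffun z => (u z %/ g).+1].
have pw : cpositive w by move=> z; rewrite ffunE.
have wB z : (w z < B.+2)%N.
  rewrite ffunE !ltnS; apply: ltnW; rewrite -(ltr_nat R).
  apply: le_lt_trans (truncnS_gt _); rewrite ler_pdivlMr//.
  have : (u z %/ g * g <= n)%N.
    by apply: leq_trans (leq_divM _ _) _; rewrite -su /csize (bigD1 z)//= leq_addr.
  have gR : 0 < g%:R :> R by rewrite ltr0n.
  rewrite -(ler_nat R) natrM => h; rewrite -(ler_pM2l gR).
  have : (u z %/ g)%:R * g%:R * eps <= n%:R * eps by apply: ler_wpM2r => //; exact: ltW.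
  by lra.
have uw : cle u (cmul g w).
  by move=> z; rewrite !ffunE mulnC ltnW// ltn_ceil.
have sw : (csize (cmul g w) <= n + g * c)%N.
  rewrite csize_mul -su /csize /c -sum1_card !big_distrr -big_split/=.
  by apply: leq_sum => z _; rewrite ffunE mulnS muln1 addnC leq_add2r mulnC leq_divM.
have nsw : (n <= csize (cmul g w))%N by rewrite -su; exact: csize_le.
have swR : (csize (cmul g w))%:R <= n%:R + eps * n%:R :> R.
  by move: sw; rewrite -(ler_nat R) natrD natrM; lra.
have := hN0 _ u (cmul g w) (leq_trans N0n nsw) uw (leqnn _).
set m : R := (csize (cmul g w))%:R in swR *; rewrite su => h.
have nm : n%:R <= m by rewrite ler_nat.
have {h} : H u - del / 8 * m <= H (cmul g w).
  apply: h; have : n%:R * (2 * eps) <= n%:R * eps0 by exact: ler_wpM2l.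
  have : n%:R * eps0 <= m * eps0 by apply: ler_wpM2r => //; exact: ltW.
  have : 0 <= n%:R * eps by rewrite mulr_ge0 ?ltW.
  by lra.
have Kg : (Kf w <= g)%N.
  apply: leq_trans gK.
  have -> : w = [ffun z => nat_of_ord ([ffun z => Ordinal (wB z)] z)].
    by apply/ffunP => z; rewrite [RHS]ffunE ffunE.
  exact: (leq_bigmax (F := fun x : {ffun Rs -> 'I_B.+2} => Kf [ffun z => nat_of_ord (x z)])).
have := hKf w pw g Kg; rewrite -csize_mul -/m.
have : c%:R * ln n.+1%:R <= del / 8 * n%:R.
  have : c%:R * ln n.+1%:R <= c%:R * (del / (8 * c%:R) * n%:R) by rewrite ler_pM2l.
  have -> // : c%:R * (del / (8 * c%:R) * n%:R) = del / 8 * n%:R.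
  by field; rewrite gt_eqF.
have a1 : `|r + del / 8| <= rm.
  rewrite (le_trans (ler_normD _ _))// /rm lerD2l ger0_norm; last by rewrite divr_ge0 ?ltW.
  by lra.
have a2 : (r + del / 8) * (m - n%:R) <= rm * (eps * n%:R).
  apply: le_trans (ler_norm _) _; rewrite normrM; apply: ler_pM => //.
  by rewrite ger0_norm; lra.
have a3 : n%:R * (eps * (8 * rm)) <= n%:R * del by exact: ler_wpM2l.
have a4 : del * m <= del * (2 * n%:R).
  apply: ler_wpM2l; first exact: ltW.
  have : eps * n%:R <= 1/4 * n%:R by exact: ler_wpM2r.
  by lra.
have a5 : n%:R * (q - r) = n%:R * del by [].
have a6 : 0 <= n%:R * del by rewrite mulr_ge0 ?ltW.
by lra.
Qed.

Lemma total_cvg (C : R) (N : nat) :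
  (forall v, (N <= csize v)%N -> - C * (csize v)%:R <= H v) ->
  (J n / n%:R)%:E @[n --> \oo] --> ray_sup.
Proof.
move=> hC.
have e1 : (limn_esup (fun n => (J n / n%:R)%:E) <= ray_sup)%E.
  rewrite leNgt; apply/negP => /lte_rat_between[q1 q1l /lte_rat_between[q2 q12 q2l]].
  have hr u : cpositive u -> (lam u <= (ratr q1)%:E)%E.
    by move=> pu; apply: le_trans (ltW q1l); apply: ereal_sup_ubound; exists u.
  rewrite lte_fin in q12; have [M hM] := total_upper hr q12.
  move: q2l; apply/negP; rewrite -leNgt; apply: limn_esup_le_near.
  exists M.+1 => // n /= Mn; rewrite lee_fin ler_pdivrMr ?ltr0n ?(leq_trans _ Mn)//.
  exact: hM (ltnW Mn).
have e2 : (ray_sup <= limn_einf (fun n => (J n / n%:R)%:E))%E.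
  apply: ge_ereal_sup => _ [u pu <-].
  rewrite leNgt; apply/negP => /lte_rat_between[q1 q1l q1u].
  have [M hM] := total_lower pu q1u.
  move: q1l; apply/negP; rewrite -leNgt; apply: limn_einf_ge_near.
  exists M.+1 => // n /= Mn; rewrite lee_fin ler_pdivlMr ?ltr0n ?(leq_trans _ Mn)//.
  exact: hM (ltnW Mn).
have e3 : ray_sup = limn_einf (fun n => (J n / n%:R)%:E).
  by apply/eqP; rewrite eq_le e2 (le_trans (limn_einf_sup _) e1).
by rewrite e3; apply: cvgn_limn_esup_einf; rewrite -e3.
Qed.

Lemma dir_limit_le_ray_sup beta : weights beta -> (dir_limit H beta <= ray_sup)%E.
Proof.
move=> wb; rewrite leNgt; apply/negP => /lte_rat_between[q1 q1l /gte_real_between[q2 q12 q2l]].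
have hr u : cpositive u -> (lam u <= (ratr q1)%:E)%E.
  by move=> pu; apply: le_trans (ltW q1l); apply: ereal_sup_ubound; exists u.
have q23 : ratr q1 < (ratr q1 + q2) / 2 by rewrite midf_lt.
have [M hM] := total_upper hr q23.
have [N hN] := dir_limit_gt q2l.
have [v fv] := follows_large (maxn M N).+1 wb; rewrite gtn_max => /andP[Mv Nv].
have := le_trans (hN v fv (ltnW Nv)) (le_trans (H_le_J v) (hM _ (ltnW Mv))).
by rewrite leNgt ltr_pM2r ?midf_lt// ltr0n (leq_ltn_trans _ Nv).
Qed.

End total_limit.

(** * Consequences of superadditive ray limits: the infinite case and concavity *)

Section ray_superadditive.
Context {R : realType} {d : nat} {Rs : {fset 'rV[int]_d}}.
Implicit Types (beta alpha : Rs -> R) (u v w : cnt Rs).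
Variable z0 : Rs.
Variables (H : cnt Rs -> R) (lam : cnt Rs -> \bar R).
Hypothesis H_ext : extension_stable H.
Hypothesis H_ray : ray_limits H lam.

(** Stated through reals [r] and [s] below the ray limits, which may be infinite. *)
Definition ray_superadditive := forall u v (r s : R), cpositive u -> cpositive v ->
  (r%:E < lam u)%E -> (s%:E < lam v)%E ->
  (((r * (csize u)%:R + s * (csize v)%:R) / (csize u + csize v)%:R)%:E <=
   lam (cadd u v))%E.

Hypothesis H_super : ray_superadditive.
Hypothesis H_pos : forall u v, csize u = csize v -> cpos u = cpos v -> H u = H v.
Variables (C : R) (N : nat).
Hypothesis H_lower : forall v, (N <= csize v)%N -> - C * (csize v)%:R <= H v.

(* Any positive v dominates a fixed proportion of a multiple of any u. *)
Lemma ray_infinite v : ray_sup lam = +oo%E -> cpositive v -> lam v = +oo%E.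
Proof.
move=> supoo pv; apply/eqP; rewrite -leye_eq leNgt; apply/negP => lt.
have v0 : (0 < csize v)%N := csize_positive z0 pv.
have lvC := ray_ge H_ray H_lower v0.
have [r lr] : exists r : R, (lam v < r%:E)%E.
  move: lvC lt; case: (lam v) => [l _ _| |]//.
  by exists (l + 1); rewrite lte_fin ltrDl.
set V : R := (csize v)%:R; have V0 : 0 < V by rewrite ltr0n.
(* [u] will be the fraction [1 / (2 * V)] of [k v] with [k = 2 * csize u]; the rest of [k v] has
   rate at least [- |C| - 1]. *)
pose M := 2 * V * (`|r| + `|C| + 1).
have M0 : 0 <= M by rewrite !mulr_ge0// ?ltW// !addr_ge0.
have : (M%:E < ray_sup lam)%E by rewrite supoo ltry.
move=> /ereal_sup_gt[_ [u pu <-] Mu].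
have u0 : (0 < csize u)%N := csize_positive z0 pu.
pose k := (2 * csize u)%N.
have uz z : (u z <= csize u)%N by rewrite /csize (bigD1 z)//= leq_addr.
have ukv : cle u (cmul k v).
  move=> z; rewrite ffunE (leq_trans (uz z))// /k -mulnA.
  by have := pv z; nia.
pose w := csub (cmul k v) u.
have pw : cpositive w.
  by move=> z; rewrite !ffunE /k subn_gt0; have := pv z; have := uz z; nia.
have w0 : (0 < csize w)%N := csize_positive z0 pw.
have sw : ((- `|C| - 1)%:E < lam w)%E.
  apply: lt_le_trans (ray_ge H_ray H_lower w0); rewrite lte_fin.
  by have := ler_norm C; lra.
have := H_super pu pw Mu sw.
rewrite cadd_sub// (ray_scale H_ray (k := k))//; last by rewrite /k muln_gt0 u0.
rewrite -csize_add cadd_sub// csize_mul natrM.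
have ew : (csize w)%:R = k%:R * V - (csize u)%:R :> R.
  by rewrite csize_sub// natrB ?csize_le// csize_mul natrM.
have k0 : 0 < k%:R :> R by rewrite ltr0n muln_gt0 u0.
rewrite leNgt => /negP; apply; apply: lt_le_trans lr _; rewrite lee_fin.
rewrite ler_pdivlMr ?mulr_gt0// -/V.
have -> : M * (csize u)%:R = k%:R * V * (`|r| + `|C| + 1) by rewrite /M /k natrM; ring.
rewrite ew; have C1 : 0 <= (`|C| + 1) * (csize u)%:R by rewrite mulr_ge0// addr_ge0.
have : r * (k%:R * V) <= `|r| * (k%:R * V).
  by apply: ler_wpM2r; rewrite ?ler_norm// mulr_ge0// ltW.
by lra.
Qed.

Lemma dir_limit_infinite alpha : weights alpha -> (forall z, 0 < alpha z) ->
  ray_sup lam = +oo%E -> dir_limit H alpha = +oo%E.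
Proof.
move=> wa a0 supoo; apply/eqP; rewrite -leye_eq leNgt; apply/negP.
move=> /lte_rat_between[q q1 _].
suff : ((ratr q)%:E <= dir_limit H alpha)%E by rewrite leNgt q1.
apply: (dir_limit_le_of_rays H_ext H_ray wa) => L.
have [L' hL'] := follows_positive wa a0.
have [w fw] := follows_large (maxn L L') wa; rewrite geq_max => /andP[Lw L'w].
exists w; split => //.
by rewrite (ray_infinite supoo) ?leey//; exact: hL'.
Qed.

(** A rounding of [alpha] of length about [t * M] and one of [alpha'] of length about [(1 - t) * M]
    add up to a vector that follows the mixture. *)
Lemma dir_limit_concave alpha alpha' (t r r' : R) : weights alpha -> weights alpha' ->
  (forall z, 0 < alpha z) -> (forall z, 0 < alpha' z) -> 0 <= t <= 1 ->
  (r%:E < dir_limit H alpha)%E -> (r'%:E < dir_limit H alpha')%E ->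
  ((t * r + (1 - t) * r')%:E <=
   dir_limit H (fun z => t * alpha z + (1 - t) * alpha' z)%R)%E.
Proof.
move=> wa wa' a0 a0' /andP[t0 t1] rl rl'.
(* Both pieces must be long, so [t = 0] and [t = 1] are treated apart. *)
have [->|tn0] := eqVneq t 0.
  have -> : (fun z => 0 * alpha z + (1 - 0) * alpha' z) = alpha'.
    by apply/funext => z; rewrite mul0r add0r subr0 mul1r.
  by rewrite mul0r add0r subr0 mul1r ltW.
have [->|tn1] := eqVneq t 1.
  have -> : (fun z => 1 * alpha z + (1 - 1) * alpha' z) = alpha.
    by apply/funext => z; rewrite mul1r subrr mul0r addr0.
  by rewrite mul1r subrr mul0r addr0 ltW.
have tgt0 : 0 < t by rewrite lt_def tn0.
have tlt1 : t < 1 by rewrite lt_neqAle tn1.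
set tau := fun z => _; set p := t * r + (1 - t) * r'.
have wt : weights tau.
  split=> [z|]; last first.
    by rewrite big_split/= -!mulr_sumr wa.2 wa'.2; ring.
  by rewrite addr_ge0// mulr_ge0// ?subr_ge0// ltW.
rewrite leNgt; apply/negP => /lte_real_between[p' p'l p'p].
suff : (p'%:E <= dir_limit H tau)%E by rewrite leNgt p'l.
have e0 : 0 < p - p' by rewrite subr_gt0.
apply: (dir_limit_le_of_rays H_ext H_ray wt) => L.
have [r1 rr1 rl1] := gte_real_between rl; have [r1' rr1' rl1'] := gte_real_between rl'.
have [L1 hL1] := dir_limit_gt_ray H_ext H_ray wa rl1.
have [L1' hL1'] := dir_limit_gt_ray H_ext H_ray wa' rl1'.
have [L2 hL2] := follows_positive wa a0.
have [L2' hL2'] := follows_positive wa' a0'.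
set c := #|{: Rs}|%:R : R; have c0 : 0 <= c by [].
pose K := maxn L (maxn (maxn L1 L1') (maxn L2 L2')).
have [M hM] := natr_large (Num.max ((K%:R + c + 1) / t)
  (Num.max ((K%:R + c) / (1 - t)) (((`|r| + `|r'|) * (c + 1)) / (p - p') + 2 * c + 1))).
have := hM M (leqnn _); rewrite !ge_max !ler_pdivrMr ?subr_gt0// => /and3P[m1 m2 m3].
have tM0 : 0 <= t * M%:R by rewrite mulr_ge0.
pose n := Num.truncn (t * M%:R); have /andP[n1 n2] := truncn_itv tM0.
rewrite -/n in n1 n2; rewrite -natr1 in n2.
have nM : (n <= M)%N by rewrite -(ler_nat R); apply: le_trans n1 _; rewrite ler_piMl.
pose u := round alpha n; pose u' := round alpha' (M - n).
have /andP[u1 u2] := csize_round n wa; have /andP[u1' u2'] := csize_round (M - n) wa'.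
rewrite -/u -/c in u1 u2; rewrite -/u' -/c natrB// in u1' u2'.
have Ku : (K <= csize u)%N by rewrite -(ler_nat R); lra.
have Ku' : (K <= csize u')%N by rewrite -(ler_nat R); lra.
move: (Ku) (Ku'); rewrite !geq_max.
move=> /and3P[Lu /andP[L1u _] /andP[L2u _]] /and3P[_ /andP[_ L1u'] /andP[_ L2u']].
set x : R := (csize u)%:R in u1 u2 *; set x' : R := (csize u')%:R in u1' u2' *.
(* The two sizes are in the ratio [t : 1 - t] up to a bounded error, which enters both the deviation
   from [tau] and the mean rate. *)
have dx : `|(1 - t) * x - t * x'| <= c + 1.
  have : (1 - t) * x <= (1 - t) * n%:R by apply: ler_wpM2l => //; lra.
  have : (1 - t) * (n%:R - c) <= (1 - t) * x by apply: ler_wpM2l => //; lra.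
  have : t * x' <= t * (M%:R - n%:R) by apply: ler_wpM2l.
  have : t * (M%:R - n%:R - c) <= t * x' by apply: ler_wpM2l.
  have : 0 <= t * c by rewrite mulr_ge0.
  have : t * c <= c by rewrite ler_piMl.
  by rewrite ler_norml; lra.
have es : (csize (cadd u u'))%:R = x + x' :> R by rewrite csize_add natrD.
have fs : follows tau (cadd u u').
  move=> z; split; last first.
    have : 0 < tau z by rewrite addr_gt0// mulr_gt0// subr_gt0.
    by move=> + tz; rewrite tz ltxx.
  rewrite es ffunE natrD /tau /dev -/c.
  have := round_deviation n z wa; have := round_deviation (M - n) z wa'.
  rewrite -/u -/u' -/c -/x -/x'.
  have := mul_weight_bound z wa dx; have := mul_weight_bound z wa' dx.
  by rewrite !ler_norml; lra.
exists (cadd u u'); split => //.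
  by rewrite csize_add (leq_trans Lu)// leq_addr.
have pu : cpositive u by apply: hL2 => //; exact: follows_round.
have pu' : cpositive u' by apply: hL2' => //; exact: follows_round.
have lu : (r%:E < lam u)%E.
  by apply: lt_le_trans (hL1 u (follows_round _ wa) L1u); rewrite lte_fin.
have lu' : (r'%:E < lam u')%E.
  by apply: lt_le_trans (hL1' u' (follows_round _ wa') L1u'); rewrite lte_fin.
apply: le_trans (H_super pu pu' lu lu'); rewrite lee_fin natrD -/x -/x'.
have su := csize_positive z0 pu.
rewrite ler_pdivlMr; last by rewrite ltr_wpDr// /x ltr0n.
have : ((`|r| + `|r'|) * (c + 1)) / (p - p') <= x + x' by lra.
rewrite ler_pdivrMr// => h.
have : (r' - r) * ((1 - t) * x - t * x') <= (`|r| + `|r'|) * (c + 1).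
  apply: le_trans (ler_norm _) _; rewrite normrM; apply: ler_pM => //.
  by rewrite (addrC `|r|) ler_normB.
by rewrite /p in h *; lra.
Qed.

End ray_superadditive.

(** Long vectors following positive weights are positive, and their ray limits alone determine
    [dir_limit]. [H] and [H'] will come from two environments. *)
Lemma dir_limit_deterministic {R : realType} {d : nat} {Rs : {fset 'rV[int]_d}}
    (H H' : cnt Rs -> R) (lam lam' : cnt Rs -> \bar R) (alpha : Rs -> R) :
  extension_stable H -> ray_limits H lam -> extension_stable H' -> ray_limits H' lam' ->
  (forall u, cpositive u -> lam u = lam' u) ->
  weights alpha -> (forall z, 0 < alpha z) ->
  (dir_limit H alpha <= dir_limit H' alpha)%E.
Proof.
move=> he hr he' hr' ll wa a0.
rewrite leNgt; apply/negP => /lte_rat_between[q q1 q2].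
suff : ((ratr q)%:E <= dir_limit H' alpha)%E by rewrite leNgt q1.
apply: (dir_limit_le_of_rays he' hr' wa) => M.
have [L hL] := dir_limit_gt_ray he hr wa q2.
have [L' hL'] := follows_positive wa a0.
have [w fw] := follows_large (maxn M (maxn L L')) wa.
rewrite !geq_max => /and3P[Mw Lw L'w].
by exists w; split => //; rewrite -ll; [exact: hL|exact: hL'].
Qed.

(** * Geometry of the polytope *)

Section row_vectors.
Context {R : realType}.

Lemma nbhs_rVP (d : nat) (x : 'rV[R]_d) (A : set 'rV[R]_d) : nbhs x A <->
  exists2 e : R, 0 < e & forall y : 'rV[R]_d, (forall j, `|x 0 j - y 0 j| < e) -> A y.
Proof.
split=> [/nbhs_ballP[e /= e0 h]|[e e0 h]].
  by exists e => // y hy; apply: h; split => // i j; rewrite ord1; exact: hy.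
apply/nbhs_ballP; exists e => //= y [_ hy]; apply: h => j.
exact: hy.
Qed.

Lemma mulmx_near (m d : nat) (M : 'M[R]_(m, d)) (x : 'rV[R]_m) (e : R) : 0 < e ->
  \forall y \near x, forall j, `|(x *m M) 0 j - (y *m M) 0 j| < e.
Proof.
move=> e0; pose S := \sum_i \sum_j `|M i j|.
have S0 : 0 <= S by apply: sumr_ge0 => i _; apply: sumr_ge0.
have S1 : 0 < S + 1 by rewrite ltr_wpDl.
apply/nbhs_rVP; exists (e / (S + 1)); first by rewrite divr_gt0.
move=> y hy j; rewrite !mxE -sumrB.
apply: le_lt_trans (ler_norm_sum _ _ _) _.
have : \sum_i `|x 0 i * M i j - y 0 i * M i j| <= \sum_i e / (S + 1) * \sum_j `|M i j|.
  apply: ler_sum => i _; rewrite -mulrBl normrM; apply: ler_pM => //; first exact: ltW.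
  by rewrite (bigD1 j)//= lerDl; exact: sumr_ge0.
move=> /le_lt_trans; apply; rewrite -mulr_sumr -/S mulrAC ltr_pdivrMr//.
by rewrite ltr_pM2l// ltrDl.
Qed.

End row_vectors.

Section polytope.
Context {R : realType} {d : nat} {Rs : {fset 'rV[int]_d}}.
Implicit Types (x y : 'rV[R]_d) (beta alpha : Rs -> R).

Let U : set 'rV[R]_d := @step_hull R d Rs.

Lemma sum_enum_val (V : nmodType) (F : Rs -> V) :
  \sum_z F z = \sum_(i < #|{: Rs}|) F (enum_val i).
Proof. by rewrite -(big_enum_val F); apply: eq_bigl => z; rewrite inE. Qed.

Lemma barycenter_lin (s t : R) beta alpha :
  barycenter (fun z => s * beta z + t * alpha z) =
  s *: barycenter beta + t *: barycenter alpha.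
Proof.
rewrite /barycenter !scaler_sumr -big_split/=; apply: eq_bigr => z _.
by rewrite scalerDl !scalerA.
Qed.

Lemma step_hull_barycenter beta : weights beta -> U (barycenter beta).
Proof.
move=> [b0 b1]; exists #|{: Rs}|, (fun i => real_pt (val (enum_val i))), (fun i => beta (enum_val i)).
split=> //.
- by rewrite -b1 sum_enum_val.
- by rewrite /barycenter sum_enum_val.
Qed.

Lemma step_hullP x : U x -> exists2 beta : Rs -> R, weights beta & x = barycenter beta.
Proof.
move=> [m [p [a [pA a0 a1 ->]]]].
have hz i : exists z : Rs, real_pt (val z) = p i by have [z _ <-] := pA i; exists z.
have [zf hzf] := choice hz.
exists (fun z => \sum_(i | zf i == z) a i).
  split=> [z|]; first exact: sumr_ge0.
  by rewrite -a1 [RHS](partition_big zf xpredT).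
rewrite [LHS](partition_big zf xpredT)//; apply: eq_bigr => z _.
rewrite scaler_suml; apply: eq_bigr => i /eqP <-.
by rewrite hzf.
Qed.

Lemma weights_mix beta alpha (t : R) : 0 <= t <= 1 -> weights beta -> weights alpha ->
  weights (fun z => (1 - t) * beta z + t * alpha z).
Proof.
move=> /andP[t0 t1] wb wa; split=> [z|].
  by rewrite addr_ge0// mulr_ge0 ?subr_ge0 ?(wb.1 z) ?(wa.1 z).
by rewrite big_split/= -!mulr_sumr wb.2 wa.2; ring.
Qed.

Lemma step_hull_convex x y (t : R) : 0 <= t <= 1 -> U x -> U y ->
  U ((1 - t) *: x + t *: y).
Proof.
move=> t01 /step_hullP[bx wx ->] /step_hullP[b wy ->].
by rewrite -barycenter_lin; apply: step_hull_barycenter; exact: weights_mix.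
Qed.

Let n := #|{: Rs}|.
Let P : 'M[R]_(n, d) := \matrix_(i, j) (real_pt (val (enum_val i)) : 'rV[R]_d) 0 j.
Let fw (a : 'rV[R]_n) (z : Rs) : R := a 0 (enum_rank z).

Let fwE (a : 'rV[R]_n) : barycenter (fw a) = a *m P.
Proof.
apply/rowP => j; rewrite /barycenter summxE mxE sum_enum_val.
apply: eq_bigr => i _; rewrite !mxE /fw; congr (a 0 _ * _).
by rewrite enum_valK.
Qed.

Let sum_fw (a : 'rV[R]_n) : \sum_z fw a z = \sum_i a 0 i.
Proof.
rewrite sum_enum_val; apply: eq_bigr => i _.
by rewrite /fw enum_valK.
Qed.

(** The simplex of weights, coded by row vectors in order to use compactness there. *)
Let K : set 'rV[R]_n := [set a | weights (fw a)].

Let K_bounded a i : K a -> 0 <= a 0 i <= 1.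
Proof.
move=> Ka; have := weights_le1 (enum_val i) Ka; have := Ka.1 (enum_val i).
by rewrite /fw enum_valK => -> ->.
Qed.

Let K_closed : closed K.
Proof.
rewrite -[K]setCK closedC openE => a /= nKa; rewrite /interior.
have [a0|/existsNP[z /negP]] := pselect (forall z, 0 <= fw a z).
  have s1 : \sum_i a 0 i != 1.
    by apply/eqP => s1; apply: nKa; split => //; rewrite sum_fw.
  pose One : 'M[R]_(n, 1) := const_mx 1.
  have s1E (b : 'rV[R]_n) : (b *m One) 0 0 = \sum_i b 0 i.
    by rewrite mxE; apply: eq_bigr => i _; rewrite mxE mulr1.
  have e0 : 0 < `|\sum_i a 0 i - 1| by rewrite normr_gt0 subr_eq0.
  apply: filterS (mulmx_near One a e0) => b /(_ 0); rewrite !s1E => h Kb.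
  by move: h; rewrite -(sum_fw b) Kb.2 ltxx.
rewrite -ltNge => az; apply/nbhs_rVP; exists (- fw a z); first by rewrite oppr_gt0.
move=> b /(_ (enum_rank z)) h Kb; have := Kb.1 z; move: h.
by rewrite -/(fw a z) -/(fw b z) ltr_norml; lra.
Qed.

Let K_compact : compact K.
Proof.
apply: bounded_closed_compact => //.
exists 1; split => // M M1 a Ka /=.
rewrite [X in X <= _]mx_normrE; apply/bigmax_leP; split => [|[i j] _]; first exact: le_trans (ltW M1).
have := K_bounded j Ka; rewrite ord1 /= => /andP[h1 h2].
by rewrite ger0_norm// (le_trans h2)// ltW.
Qed.

Let img_continuous : continuous (fun a : 'rV[R]_n => a *m P).
Proof.
move=> a A /nbhs_rVP[e e0 hA]; apply: filterS (mulmx_near P a e0) => b hb.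
exact: hA.
Qed.

(* The weights of x that do not dominate (1 - eps) times some weights of x0 form
   a compact set whose barycenters avoid x0. *)
Lemma step_hull_conical x0 (eps : R) : 0 < eps <= 1 ->
  \forall x \near x0, U x -> exists2 y, U y & x = (1 - eps) *: x0 + eps *: y.
Proof.
move=> /andP[eps0 eps1].
pose O := [set a : 'rV[R]_n | exists2 b : 'rV[R]_n, K b /\ b *m P = x0 &
  forall i, 0 < b 0 i -> (1 - eps) * b 0 i < a 0 i].
have O_open : open O.
  rewrite openE => a [b [Kb bx] hb]; rewrite /interior.
  have : \forall a' \near (a : 'rV[R]_n), forall i, 0 < b 0 i ->
      (1 - eps) * b 0 i < (a' : 'rV[R]_n) 0 i.
    apply: (@filter_forall _ _ (fun i => [set a' : 'rV[R]_n |
      0 < b 0 i -> (1 - eps) * b 0 i < a' 0 i]) _ (nbhs_filter (a : 'rV[R]_n))) => i.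
    have [bi|bi] := ltP 0 (b 0 i); last first.
      by apply: nearW.
    apply/nbhs_rVP; exists (a 0 i - (1 - eps) * b 0 i); first by rewrite subr_gt0 hb.
    by move=> a' /(_ i) + _; rewrite ltr_norml; lra.
  by apply: filterS => a' h; exists b.
have CK : compact (K `&` ~` O).
  apply: subclosed_compact K_compact _ => //.
  by apply: closedI => //; rewrite closedC.
have CP : closed [set a *m P | a in K `&` ~` O].
  apply: compact_closed; first exact: norm_hausdorff.
  apply: continuous_compact => //; apply: continuous_subspaceT; exact: img_continuous.
have x0n : (~` [set a *m P | a in K `&` ~` O]) x0.
  move=> [a [Ka nOa] ax]; apply: nOa; exists a => // i ai.
  by rewrite gtr_pMl// ltrBlDr ltrDl.
have : nbhs x0 (~` [set a *m P | a in K `&` ~` O]).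
  by apply: open_nbhs_nbhs; split => //; rewrite openC.
apply: filterS => x hx /step_hullP[beta wb xb].
pose a : 'rV[R]_n := \row_i beta (enum_val i).
have fa : fw a = beta by apply/funext => z; rewrite /fw mxE enum_rankK.
have Ka : K a by rewrite /K /= fa.
have ax : a *m P = x by rewrite -fwE fa -xb.
have [b [Kb bx] hb] : O a.
  by apply: contrapT => nO; apply: hx; exists a.
pose g z := (beta z - (1 - eps) * fw b z) / eps.
have wg : weights g.
  split=> [z|].
    rewrite divr_ge0 ?(ltW eps0)// subr_ge0.
    have [bz|bz] := ltP 0 (fw b z).
      by have := hb _ bz; rewrite -/(fw a z) fa => /ltW.
    have -> : fw b z = 0 by apply/eqP; rewrite eq_le bz (Kb.1 z).
    by rewrite mulr0 (wb.1 z).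
  rewrite -mulr_suml sumrB -mulr_sumr wb.2 Kb.2 mulr1 opprB addrC subrK divff//.
  by rewrite gt_eqF.
exists (barycenter g); first exact: step_hull_barycenter.
rewrite -bx -fwE -barycenter_lin xb; congr barycenter; apply/funext => z.
have -> : eps * g z = beta z - (1 - eps) * fw b z by rewrite mulrC divfK ?gt_eqF.
by ring.
Qed.

Lemma affine_hull_weights y : affine_hull U y ->
  exists2 b : Rs -> R, \sum_z b z = 1 & y = barycenter b.
Proof.
move=> [m [p [a [pU a1 ->]]]].
have hb i : exists b : Rs -> R, weights b /\ p i = barycenter b.
  by have [b wb ->] := step_hullP (pU i); exists b.
have [bf hbf] := choice hb.
exists (fun z => \sum_i a i * bf i z).
  rewrite exchange_big/= -[RHS]a1; apply: eq_bigr => i _.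
  by rewrite -mulr_sumr (hbf i).1.2 mulr1.
rewrite /barycenter; under [RHS]eq_bigr do rewrite scaler_suml.
rewrite exchange_big/=; apply: eq_bigr => i _.
rewrite (hbf i).2 /barycenter scaler_sumr; apply: eq_bigr => z _.
by rewrite scalerA.
Qed.

(* Near x, a point of the affine hull is a combination of the steps whose
   coefficients depend continuously on it (pseudo-inverse), hence stay positive. *)
Lemma relint_barycenter alpha : weights alpha -> (forall z, 0 < alpha z) ->
  relint U (barycenter alpha).
Proof.
move=> wa a0; split; first exact: step_hull_barycenter.
(* The column of ones forces the correction [g] to have coefficients of sum 0, so that [alpha] plus
   [g] still has sum 1. *)
pose A : 'M[R]_(n, d + 1) := row_mx P (const_mx 1).
set x := barycenter alpha.
pose ext (y : 'rV[R]_d) : 'rV[R]_(d + 1) := row_mx y 0.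
pose Q : 'M[R]_(d, n) := usubmx (pinvmx A).
have extE y : ext y *m pinvmx A = y *m Q.
  by rewrite -[pinvmx A]vsubmxK mul_row_col mul0mx addr0.
have [m m0 hm] := weights_min wa.
have near_x : \forall y \near x, forall j, `|(x *m Q) 0 j - (y *m Q) 0 j| < m.
  exact: mulmx_near.
apply: filterS near_x => y hy /affine_hull_weights[b b1 yb].
pose c : 'rV[R]_n := \row_i (b (enum_val i) - alpha (enum_val i)).
have fc z : fw c z = b z - alpha z by rewrite /fw mxE enum_rankK.
have cP : c *m P = y - x.
  rewrite -fwE yb /x -[in RHS](scale1r (barycenter b)) -scaleN1r -barycenter_lin.
  congr barycenter; apply/funext => z; rewrite fc; ring.
have c1 : c *m (const_mx 1 : 'M[R]_(n, 1)) = 0.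
  apply/rowP => k; rewrite !mxE; under eq_bigr do rewrite [X in _ * X]mxE mulr1.
  rewrite -sum_fw; under eq_bigr do rewrite fc.
  by rewrite sumrB b1 wa.2 subrr.
have cA : c *m A = ext (y - x) by rewrite mul_mx_row cP c1.
have sub : (ext (y - x) <= A)%MS by apply/submxP; exists c.
pose g := (y - x) *m Q.
have gA : g *m A = ext (y - x) by rewrite /g -extE mulmxKpV.
have gP : g *m P = y - x.
  by have := congr1 lsubmx gA; rewrite mul_mx_row /ext !row_mxKl.
have g1 : g *m (const_mx 1 : 'M[R]_(n, 1)) = 0.
  by have := congr1 rsubmx gA; rewrite mul_mx_row /ext !row_mxKr.
have sg : \sum_z fw g z = 0.
  rewrite sum_fw; transitivity ((g *m (const_mx 1 : 'M[R]_(n, 1))) 0 0).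
    by rewrite mxE; apply: eq_bigr => i _; rewrite [X in _ = _ * X]mxE mulr1.
  by rewrite g1 mxE.
have -> : y = barycenter (fun z => 1 * alpha z + 1 * fw g z).
  by rewrite barycenter_lin !scale1r fwE gP -/x addrC subrK.
apply: step_hull_barycenter; split=> [z|]; last first.
  by rewrite big_split/= -!mulr_sumr wa.2 sg; ring.
have := hy (enum_rank z); have : m <= alpha z by rewrite hm// gt_eqF.
have -> : fw g z = (y *m Q) 0 (enum_rank z) - (x *m Q) 0 (enum_rank z).
  by rewrite /fw /g mulmxBl !mxE.
by rewrite ltr_norml; lra.
Qed.

Lemma centroid_weights : Rs != fset0 -> weights ((fun=> n%:R^-1) : Rs -> R) /\ 0 < n%:R^-1 :> R.
Proof.
move=> /fset0Pn[z zR]; have n0 : 0 < n%:R :> R.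
  by rewrite ltr0n; apply/card_gt0P; exists [` zR]%fset.
split; last by rewrite invr_gt0.
split=> [z'|]; first by rewrite invr_ge0 ltW.
by rewrite sumr_const -/n -[_ *+ n]mulr_natr mulVf// gt_eqF.
Qed.

Lemma affine_hull_pair x y (t : R) : U x -> U y -> affine_hull U ((1 - t) *: x + t *: y).
Proof.
move=> Ux Uy; exists 2, (fun i : 'I_2 => if i == 0 then x else y),
  (fun i : 'I_2 => if i == 0 then 1 - t else t).
split; first by move=> i; case: ifP.
  by rewrite big_ord_recl big_ord1/= subrK.
by rewrite big_ord_recl big_ord1.
Qed.

(* Prolonging the segment from y to x a little beyond x. *)
Lemma relint_prolong x y : relint U x -> U y ->
  exists2 s : R, 0 < s <= 1 & exists2 x', U x' & x = (1 - s) *: x' + s *: y.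
Proof.
move=> [Ux /nbhs_rVP[e e0 he]] Uy.
pose D := \sum_j `|x 0 j - y 0 j|; have D0 : 0 <= D by exact: sumr_ge0.
pose t := Num.min 1 (e / (D + 1)) / 2.
have D1 : 0 < D + 1 by rewrite ltr_wpDl.
have t0 : 0 < t by rewrite divr_gt0// lt_min ltr01 divr_gt0.
have tle : t * (D + 1) < e.
  rewrite -ltr_pdivlMr//; apply: (@lt_le_trans _ _ (Num.min 1 (e / (D + 1)))).
    by rewrite /t ltr_pdivrMr// ltr_pMr ?lt_min ?ltr01 ?divr_gt0// ltr1n.
  by rewrite ge_min lexx orbT.
pose x' := (1 - (- t)) *: x + (- t) *: y.
have Ux' : U x'.
  apply: he; last exact: affine_hull_pair.
  move=> j; rewrite !mxE.
  have -> : x 0 j - ((1 - - t) * x 0 j + - t * y 0 j) = - t * (x 0 j - y 0 j) by ring.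
  rewrite normrM normrN (gtr0_norm t0).
  have : t * `|x 0 j - y 0 j| <= t * (D + 1).
    apply: ler_wpM2l; first exact: ltW.
    by rewrite /D (bigD1 j)//= -addrA lerDl addr_ge0// sumr_ge0.
  by move=> /le_lt_trans; apply.
have t1 : 1 + t != 0 by rewrite gt_eqF// ltr_wpDr// ltW.
exists (t / (1 + t)).
  have t1' : 0 < 1 + t by rewrite addr_gt0.
  by rewrite divr_gt0// ler_pdivrMr// mul1r lerDr ler01.
exists x' => //; rewrite /x' scalerDr !scalerA.
by apply/rowP => j; rewrite !mxE; field; exact: t1.
Qed.

(** Prolonging the segment from the centroid beyond [x] writes [x] as a mixture in which the
    centroid gives every step a positive share. *)
Lemma relint_positive_weights x : Rs != fset0 -> relint U x ->
  exists beta : Rs -> R, [/\ weights beta, forall z, 0 < beta z & x = barycenter beta].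
Proof.
move=> Rs0 rx; have [wc c0] := centroid_weights Rs0.
have [s /andP[s0 s1] [x' /step_hullP[b wb ->] xE]] :=
  relint_prolong rx (step_hull_barycenter wc).
exists (fun z => (1 - s) * b z + s * n%:R^-1); split.
- by apply: weights_mix => //; rewrite (ltW s0).
- by move=> z; rewrite ltr_wpDl ?mulr_gt0// mulr_ge0 ?subr_ge0// (wb.1 z).
- by rewrite xE -barycenter_lin.
Qed.

Lemma relint_mix x y (t : R) : Rs != fset0 -> U x -> relint U y -> 0 < t <= 1 ->
  relint U ((1 - t) *: x + t *: y).
Proof.
move=> Rs0 /step_hullP[b wb ->] /(relint_positive_weights Rs0)[a [wa a0 ->]] /andP[t0 t1].
rewrite -barycenter_lin; apply: relint_barycenter.
  by apply: weights_mix => //; rewrite (ltW t0).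
by move=> z; rewrite ltr_wpDl ?mulr_gt0// mulr_ge0 ?subr_ge0// (wb.1 z).
Qed.

Lemma relint_nonempty : Rs != fset0 -> exists x, relint U x.
Proof.
move=> Rs0; have [wc c0] := centroid_weights Rs0.
by exists (barycenter ((fun=> n%:R^-1) : Rs -> R)); apply: relint_barycenter.
Qed.

End polytope.

Lemma within_continuous_EFin {R : realType} {T : topologicalType} (A : set T)
    (h : T -> \bar R) (psi : T -> R) : (forall x, A x -> h x = (psi x)%:E) ->
  (forall x e, A x -> 0 < e -> \forall y \near x, A y -> `|psi x - psi y| < e) ->
  {within A, continuous h}.
Proof.
move=> hE hpsi; rewrite continuous_subspace_in => x /set_mem Ax.
suff : h y @[y --> within A (nbhs x)] --> (psi x)%:E.
  by rewrite -(hE x Ax) (nbhs_subspace_in Ax).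
apply: cvg_EFin.
  by rewrite near_withinE; apply: nearW => y Ay; rewrite (hE y Ay).
apply/cvgrPdist_lt => e e0.
rewrite near_withinE; apply: filterS (hpsi x e Ax e0) => y hy Ay /=.
by rewrite (hE y Ay)/=; exact: hy.
Qed.

(** * Semicontinuity and upper regularization on the polytope *)

Section regularization.
Context {R : realType} {d : nat} {Rs : {fset 'rV[int]_d}}.
Hypothesis Rs_neq0 : Rs != fset0.

Let U : set 'rV[R]_d := @step_hull R d Rs.

Definition segment_stable (f : 'rV[R]_d -> \bar R) := forall eta : R, 0 < eta ->
  exists2 t0, 0 < t0 & forall (t : R) x y, 0 <= t <= t0 -> t <= 1 -> U x -> U y ->
    forall r : R, (r%:E < f x)%E -> ((r - eta)%:E <= f ((1 - t) *: x + t *: y)%R)%E.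

Let real_stable (phi : 'rV[R]_d -> R) := forall eta : R, 0 < eta ->
  exists2 t0, 0 < t0 & forall (t : R) x y, 0 <= t <= t0 -> t <= 1 -> U x -> U y ->
    phi x - eta <= phi ((1 - t) *: x + t *: y).

(** By [step_hull_conical] every point of [U] near [x] is a small move from [x] towards some point
    of [U]. *)
Let real_stable_lower phi x (e : R) : real_stable phi -> 0 < e ->
  \forall y \near x, U x -> U y -> phi x - e < phi y.
Proof.
move=> st e0; have [t0 t00 ht] := st _ (divr_gt0 e0 (ltr0n _ 2)).
pose t := Num.min t0 1.
have tgt0 : 0 < t by rewrite lt_min t00 ltr01.
have t1 : t <= 1 by rewrite ge_min lexx orbT.
have t01 : 0 < t <= 1 by rewrite tgt0.
apply: filterS (step_hull_conical x t01) => y hy Ux Uy.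
have [z Uz ->] := hy Uy.
have tt0 : 0 <= t <= t0 by rewrite (ltW tgt0) ge_min lexx.
by apply: lt_le_trans (ht t x z tt0 t1 Ux Uz); lra.
Qed.

(** The roles are exchanged: [x], being in the relative interior, is a small move from any nearby
    [y] towards a point [z] of [U]. *)
Let real_stable_upper phi x (e : R) : real_stable phi -> relint U x -> 0 < e ->
  \forall y \near x, U y -> phi y < phi x + e.
Proof.
move=> st [Ux /nbhs_rVP[a a0 ha]] e0.
have [t0 t00 ht] := st _ (divr_gt0 e0 (ltr0n _ 2)).
pose t := Num.min t0 1.
have tgt0 : 0 < t by rewrite lt_min t00 ltr01.
have t1 : t <= 1 by rewrite ge_min lexx orbT.
have tt0 : 0 <= t <= t0 by rewrite (ltW tgt0) ge_min lexx.
apply/nbhs_rVP; exists (a * t); first by rewrite mulr_gt0.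
move=> y hy Uy; pose z := (1 - t^-1) *: y + t^-1 *: x.
have Uz : U z.
  apply: ha; last exact: affine_hull_pair.
  move=> j; rewrite !mxE.
  have -> : x 0 j - ((1 - t^-1) * y 0 j + t^-1 * x 0 j) =
      (1 - t^-1) * (x 0 j - y 0 j) by ring.
  rewrite normrM.
  have it : 1 <= t^-1 by rewrite invf_ge1.
  have : `|1 - t^-1| <= t^-1 by rewrite ler_norml; lra.
  move=> /(ler_wpM2r (normr_ge0 (x 0 j - y 0 j)))/le_lt_trans; apply.
  by rewrite mulrC ltr_pdivrMr//; exact: hy.
have xE : x = (1 - t) *: y + t *: z.
  rewrite /z scalerDr !scalerA addrA -scalerDl divff ?gt_eqF// scale1r.
  by rewrite mulrBr mulr1 divff ?gt_eqF// addrA subrK subrr scale0r add0r.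
have := ht t y z tt0 t1 Uy Uz; rewrite -xE; lra.
Qed.

Variables (f : 'rV[R]_d -> \bar R) (C : R).
Hypothesis f_bounded : forall x, U x -> (`|f x| <= C%:E)%E.
Hypothesis f_stable : segment_stable f.

Let phi x := fine (f x).

Let fE x : U x -> f x = (phi x)%:E.
Proof.
move=> Ux; rewrite /phi fineK// fin_num_abs.
by apply: le_lt_trans (f_bounded Ux) _; rewrite ltry.
Qed.

Let phi_stable : real_stable phi.
Proof.
move=> eta eta0; have [t0 t00 ht] := f_stable eta0; exists t0 => // t x y tt t1 Ux Uy.
have Up : U ((1 - t) *: x + t *: y).
  by apply: step_hull_convex => //; case/andP: tt => -> _.
rewrite leNgt; apply/negP => h.
have : (((phi ((1 - t) *: x + t *: y) + eta + phi x) / 2)%:E < f x)%E.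
  by rewrite fE// lte_fin; lra.
by move=> /(ht t x y tt t1 Ux Uy); rewrite fE// lee_fin; lra.
Qed.

Lemma segment_stable_lsc : lsc_on U f.
Proof.
move=> x a afx.
(* Points outside [U] are isolated in the subspace topology, so semicontinuity is trivial there. *)
have [Ux|nUx] := pselect (U x); last first.
  exists [set x]; last by move=> y ->.
  by rewrite -[nbhs _]/(nbhs_subspace (A := U) x) -nbhs_subspace_out.
exists [set y | U y /\ (a%:E < f y)%E]; last by move=> y [].
rewrite -[nbhs _]/(nbhs_subspace (A := U) x) -nbhs_subspace_in//.
move: afx; rewrite fE// lte_fin => afx.
have e0 : 0 < phi x - a by rewrite subr_gt0.
apply: filterS (real_stable_lower x phi_stable e0) => y hy Uy; split => //.
by rewrite fE// lte_fin; have := hy Ux Uy; lra.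
Qed.

Lemma segment_stable_relint_continuous : {within relint U, continuous f}.
Proof.
apply: (@within_continuous_EFin _ _ _ f phi) => [x [Ux _]|x e rx e0]; first exact: fE.
have := real_stable_lower x phi_stable e0; have := real_stable_upper phi_stable rx e0.
apply: filterS2 => y h1 h2 [Uy _].
have := h1 Uy; have := h2 rx.1 Uy; rewrite ltr_norml; lra.
Qed.

Let F := usc_reg U f.
Let psi x := fine (F x).

Let F_ge x : U x -> (f x <= F x)%E.
Proof.
move=> Ux; apply: le_ereal_inf_tmp => _ [B [oB Bx] <-].
by apply: ereal_sup_ubound; exists x.
Qed.

Let F_le x (B : set 'rV[R]_d) : open B -> B x ->
  (F x <= ereal_sup [set f y | y in B `&` U])%E.
Proof. by move=> oB Bx; apply: ereal_inf_lbound; exists B. Qed.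

Let FE x : U x -> F x = (psi x)%:E.
Proof.
move=> Ux; rewrite /psi fineK// fin_numE; apply/andP; split.
  rewrite -ltNye; apply: lt_le_trans (F_ge Ux); rewrite fE// ltNyr//.
rewrite -ltey; apply: le_lt_trans (F_le openT I) _.
apply: (@le_lt_trans _ _ C%:E); last by rewrite ltry.
apply: ge_ereal_sup => _ [y [_ Uy] <-].
by apply: le_trans (f_bounded Uy); rewrite lee_abs.
Qed.

Let F_lt x (e : R) : U x -> 0 < e -> exists2 B : set 'rV[R]_d, open B /\ B x &
  forall y, B y -> U y -> phi y < psi x + e.
Proof.
move=> Ux e0; have : (F x < (psi x + e)%:E)%E by rewrite FE// lte_fin ltrDl.
move=> /ereal_inf_lt[_ [B [oB Bx] <-] sB]; exists B => // y By Uy.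
rewrite -lte_fin -fE//; apply: le_lt_trans sB.
by apply: ereal_sup_ubound; exists y.
Qed.

Let psi_upper x (e : R) : U x -> 0 < e ->
  \forall y \near x, U y -> psi y < psi x + e.
Proof.
move=> Ux e0; have [B [oB Bx] hB] := F_lt Ux (divr_gt0 e0 (ltr0n _ 2)).
apply: filterS (open_nbhs_nbhs (conj oB Bx)) => y By Uy.
rewrite -lte_fin -FE//; apply: le_lt_trans (F_le oB By) _.
apply: (@le_lt_trans _ _ (psi x + e / 2)%:E); last by rewrite lte_fin; lra.
apply: ge_ereal_sup => _ [z [Bz Uz] <-]; rewrite fE// lee_fin ltW//; exact: hB.
Qed.

Let psi_approx x (e : R) (B : set 'rV[R]_d) : U x -> 0 < e -> nbhs x B ->
  exists2 y, B y /\ U y & psi x - e < phi y.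
Proof.
move=> Ux e0; rewrite nbhsE => -[B' [oB' B'x] BB'].
have : ((psi x - e)%:E < ereal_sup [set f y | y in B' `&` U])%E.
  by apply: lt_le_trans (F_le oB' B'x); rewrite FE// lte_fin ltrBlDr ltrDl.
move=> /ereal_sup_gt[_ [y [B'y Uy] <-]]; rewrite fE// lte_fin => h.
by exists y => //; split => //; exact: BB'.
Qed.

(** A point [x'] near [x] with [phi x'] close to [psi x] is moved towards [y] in place of [x]; it
    arrives near [p], where [psi p] almost bounds [phi] from above. *)
Let psi_stable : real_stable psi.
Proof.
move=> eta eta0; have [t0 t00 ht] := phi_stable (divr_gt0 eta0 (ltr0n _ 2)).
exists t0 => // t x y tt t1 Ux Uy.
set p := (1 - t) *: x + t *: y.
have Up : U p by apply: step_hull_convex => //; case/andP: tt => -> _.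
rewrite leNgt; apply/negP => h.
have e0 : 0 < psi x - eta - psi p by rewrite subr_gt0.
have [B [oB Bp] hB] := F_lt Up e0.
have eta2 : 0 < eta / 2 by rewrite divr_gt0.
have nB : nbhs x [set x' | B ((1 - t) *: x' + t *: y)].
  have /nbhs_rVP[e e_gt0 he] := open_nbhs_nbhs (conj oB Bp).
  apply/nbhs_rVP; exists e => // x' hx' /=; apply: he => j; rewrite !mxE.
  have -> : (1 - t) * x 0 j + t * y 0 j - ((1 - t) * x' 0 j + t * y 0 j) =
    (1 - t) * (x 0 j - x' 0 j) by ring.
  rewrite normrM; apply: le_lt_trans (hx' j); rewrite ler_piMl//.
  by case/andP: tt => tge0 _; rewrite ger0_norm; lra.
have [x' [Bx' Ux'] hx'] := psi_approx Ux eta2 nB.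
have := ht t x' y tt t1 Ux' Uy.
have Up' : U ((1 - t) *: x' + t *: y).
  by apply: step_hull_convex => //; case/andP: tt => -> _.
have := hB _ Bx' Up'; lra.
Qed.

(** The regularization is upper semicontinuous by construction, and it inherits the stability along
    segments that gives lower semicontinuity. *)
Lemma usc_reg_continuous : {within U, continuous F}.
Proof.
apply: (@within_continuous_EFin _ _ _ F psi) => [x|x e Ux e0]; first exact: FE.
have := real_stable_lower x psi_stable e0; have := psi_upper Ux e0.
apply: filterS2 => y h1 h2 Uy.
have := h1 Uy; have := h2 Ux Uy; rewrite ltr_norml; lra.
Qed.

Lemma usc_reg_relint x : relint U x -> F x = f x.
Proof.
move=> rx; have Ux := rx.1; apply/eqP; rewrite eq_le F_ge// andbT.
rewrite FE// fE// lee_fin; apply/ler_addgt0Pr => e e0.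
have e2 : 0 < e / 2 by rewrite divr_gt0.
have [y [hy Uy] h] := psi_approx Ux e2 (real_stable_upper phi_stable rx e2).
have := hy Uy; lra.
Qed.

End regularization.

(** Each [x] in the hull is the limit of points on the segment to a relative interior point [c], and
    these lie in the relative interior. *)
Lemma cont_ext_unique {R : realType} {d : nat} {Rs : {fset 'rV[int]_d}}
    (f h h' : 'rV[R]_d -> \bar R) : Rs != fset0 ->
  cont_ext (relint (step_hull Rs)) (step_hull Rs) f h ->
  cont_ext (relint (step_hull Rs)) (step_hull Rs) f h' ->
  forall x, step_hull Rs x -> h' x = h x.
Proof.
move=> Rs0 [ch eh] [ch' eh'] x Ux.
have [c rc] := @relint_nonempty R d Rs Rs0.
pose gam (t : R) : 'rV[R]_d := (1 - t) *: x + t *: c.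
have near01 : \forall t \near (0 : R)^'+, 0 < t <= 1.
  near=> t; apply/andP; split; near: t; first exact: nbhs_right_gt.
  exact: nbhs_right_le.
have rel : \forall t \near (0 : R)^'+, relint (step_hull Rs) (gam t).
  by apply: filterS near01 => t t01; exact: relint_mix.
have gam_cvg : gam t @[t --> (0 : R)^'+] --> within (step_hull Rs) (nbhs x).
  move=> A; rewrite /within/= => /nbhs_rVP[e e0 hA].
  pose D := \sum_j `|x 0 j - c 0 j|; have D0 : 0 <= D by exact: sumr_ge0.
  have eD : 0 < e / (D + 1) by rewrite divr_gt0// ltr_wpDl.
  have near_e : \forall t \near (0 : R)^'+, t < e / (D + 1).
    by near=> t; near: t; exact: nbhs_right_lt.
  have : \forall t \near (0 : R)^'+, [/\ 0 < t <= 1, t < e / (D + 1) &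
      relint (step_hull Rs) (gam t)] by near=> t; split; near: t.
  apply: filterS => t [/andP[t0 t1] te rt] /=.
  apply: (hA _ _ rt.1) => j; rewrite !mxE.
  have -> : x 0 j - ((1 - t) * x 0 j + t * c 0 j) = t * (x 0 j - c 0 j) by ring.
  rewrite normrM (gtr0_norm t0).
  have : t * `|x 0 j - c 0 j| <= t * (D + 1).
    apply: ler_wpM2l; first exact: ltW.
    by rewrite /D (bigD1 j)//= -addrA lerDl addr_ge0// sumr_ge0.
  by move=> /le_lt_trans; apply; rewrite -ltr_pdivlMr// ltr_wpDl.
have cvg_comp_gam (k : 'rV[R]_d -> \bar R) : {within step_hull Rs, continuous k} ->
    k (gam t) @[t --> (0 : R)^'+] --> k x.
  move=> ck; apply: (cvg_comp gam _ gam_cvg).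
  by rewrite (nbhs_subspace_in Ux); exact: ck.
have e : \forall t \near (0 : R)^'+, h' (gam t) = h (gam t).
  by apply: filterS rel => t rt; rewrite eh' ?eh.
have h1 := cvg_comp_gam _ ch; have h2 := cvg_comp_gam _ ch'.
apply: (cvg_unique _ h2); first exact: ereal_hausdorff.
apply: cvg_trans h1; apply: near_eq_cvg; apply: filterS e => t ->//.
Unshelve. all: by end_near.
Qed.

(** * Partition functions *)

Lemma ler_sum_injective {R : realType} (I J : finType) (h : I -> J) (P : pred I)
    (Q : pred J) (w : J -> R) : injective h -> (forall j, 0 <= w j) ->
  (forall i, P i -> Q (h i)) -> \sum_(i | P i) w (h i) <= \sum_(j | Q j) w j.
Proof.
move=> hinj w0 PQ.
have -> : \sum_(i | P i) w (h i) = \sum_(j in h @: [set i | P i]%SET) w j.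
  rewrite big_imset/=; last by move=> x y _ _; exact: hinj.
  by apply: eq_bigl => i; rewrite inE.
rewrite big_mkcond [leRHS]big_mkcond; apply: ler_sum => j _.
case: ifPn => [/imsetP[i]|_]; last by case: ifP.
by rewrite inE => Pi ->; rewrite PQ.
Qed.

Section potential.
Context {R : realType} {d : nat} {Rs : {fset 'rV[int]_d}}.
Context {dO : measure_display} {Om : measurableType dO}.
Variables (PP : probability Om R) (T : 'rV[int]_d -> Om -> Om).
Hypothesis T_sys : dynamical_system Rs PP T.
Variables (l : nat) (g : Om * l.-tuple Rs -> R).
Implicit Types (s p : seq Rs) (u v : cnt Rs).

Definition envelope (om : Om) : R := \sum_zs `|g (om, zs)|.

Lemma envelope_ge0 om : 0 <= envelope om.
Proof. exact: sumr_ge0. Qed.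

Lemma envelope_ge om zs : `|g (om, zs)| <= envelope om.
Proof. by rewrite /envelope (bigD1 zs)//= lerDl sumr_ge0. Qed.

Lemma envelope_le om zs : - envelope om <= g (om, zs).
Proof. by have := envelope_ge om zs; rewrite ler_norml => /andP[]. Qed.

Definition pos s : 'rV[int]_d := \sum_(z <- s) val z.

Lemma pos_cat s p : pos (s ++ p) = pos s + pos p.
Proof. by rewrite /pos big_cat. Qed.

Lemma pos_cons z s : pos (z :: s) = val z + pos s.
Proof. by rewrite /pos big_cons. Qed.

Lemma pos_nil : pos [::] = 0.
Proof. by rewrite /pos big_nil. Qed.

Lemma pos_nseq k z : pos (nseq k z) = val z *+ k.
Proof. by elim: k => [|k IH]; rewrite ?pos_nil// pos_cons IH mulrS. Qed.

Lemma step_group_pos s : step_group Rs (pos s).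
Proof. by apply: step_group_sum => z; exact: step_group_val. Qed.

(* At the last l - 1 sites of a path the potential depends on steps beyond its
   end; it is replaced there by minus the envelope, so that lower potentials
   are superadditive under concatenation. *)
Fixpoint lower_potential (om : Om) s : R := match s with
  | [::] => 0
  | z :: s' => (if (l <= size s)%N then g (om, [tuple nth z s i | i < l])
                else - envelope om) + lower_potential (T (val z) om) s'
  end.

Lemma lower_potential_cat om s p : lower_potential om s +
  lower_potential (T (pos s) om) p <= lower_potential om (s ++ p).
Proof.
elim: s om => [|z s IH] om /=.
  by rewrite pos_nil (shift0 T_sys) add0r.
rewrite -addrA; apply: lerD; last first.
  rewrite pos_cons [val z + _]addrC (shiftD T_sys)//; first exact: step_group_pos.
  exact: step_group_val.
have [ls|ls] := leqP l (size s).+1.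
  rewrite ifT; last by rewrite size_cat (leq_trans ls)// ltnS leq_addr.
  have -> // : [tuple nth z (z :: s) i | i < l] = [tuple nth z (z :: s ++ p) i | i < l].
  apply: eq_from_tnth => i; rewrite !tnth_mktuple -cat_cons nth_cat.
  by rewrite (leq_trans (ltn_ord i)).
case: ifP => // _.
exact: envelope_le.
Qed.

Fixpoint envelope_sum (om : Om) s : R :=
  if s is z :: s' then envelope om + envelope_sum (T (val z) om) s' else 0.

Lemma envelope_sum_ge0 om s : 0 <= envelope_sum om s.
Proof. by elim: s om => [//|z s IH] om /=; rewrite addr_ge0// envelope_ge0. Qed.

Lemma lower_potential_ge om s : - envelope_sum om s <= lower_potential om s.
Proof.
elim: s om => [|z s IH] om /=; first by rewrite oppr0.
rewrite opprD lerD//; case: ifP => // _.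
exact: envelope_le.
Qed.

Lemma envelope_sum_cat om s p : envelope_sum om (s ++ p) =
  envelope_sum om s + envelope_sum (T (pos s) om) p.
Proof.
elim: s om => [|z s IH] om /=; first by rewrite pos_nil (shift0 T_sys) add0r.
rewrite IH addrA pos_cons; congr (_ + _).
rewrite [val z + _]addrC (shiftD T_sys)//; first exact: step_group_pos.
exact: step_group_val.
Qed.

Lemma envelope_sum_nseq om k z :
  envelope_sum om (nseq k z) = \sum_(0 <= j < k) envelope (T (val z *+ j) om).
Proof.
elim: k om => [|k IH] om /=; first by rewrite big_nil.
rewrite IH big_nat_recl// mulr0n (shift0 T_sys); congr (_ + _).
apply: eq_bigr => j _; rewrite mulrSr (shiftD T_sys)//.
  by apply: step_groupMn; exact: step_group_val.
exact: step_group_val.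
Qed.

Lemma envelope_sum_zero om s : all (fun z : Rs => val z == 0) s ->
  envelope_sum om s = (size s)%:R * envelope om.
Proof.
elim: s om => [|z s IH] om /=; first by rewrite mul0r.
by move=> /andP[/eqP -> /IH ->]; rewrite (shift0 T_sys) -natr1; ring.
Qed.

Definition path_potential (om : Om) (n : nat) (x : nat -> Rs) : R :=
  \sum_(k < n) g (T (\sum_(j < k) val (x j)) om, [tuple x (k + i)%N | i < l]).

Lemma path_potentialS om n x : path_potential om n.+1 x =
  g (om, [tuple x i | i < l]) + path_potential (T (val (x 0%N)) om) n (fun k => x k.+1).
Proof.
rewrite /path_potential big_ord_recl; congr (g (_, _) + _).
  by rewrite big_ord0 (shift0 T_sys).
apply: eq_bigr => k _; rewrite big_ord_recl /= [val _ + _]addrC (shiftD T_sys).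
- by congr (g (_, _)); apply: eq_from_tnth => i; rewrite !tnth_mktuple.
- by apply: step_group_sum => i; exact: step_group_val.
- exact: step_group_val.
Qed.

Lemma mkseqS (x : nat -> Rs) n : mkseq x n.+1 = x 0%N :: mkseq (fun k => x k.+1) n.
Proof. by rewrite /mkseq /= (iotaDl 1 0 n) -map_comp. Qed.

(** The two potentials differ at no more than the last [l - 1] sites, where each term lies between
    [- B] and [B]. *)
Lemma lower_potential_path om n x (B : R) : 0 <= B ->
  (forall k, (k < n)%N -> envelope (T (pos (mkseq x k)) om) <= B) ->
  lower_potential om (mkseq x n) <= path_potential om n x <=
  lower_potential om (mkseq x n) + 2 * (minn l n)%:R * B.
Proof.
move=> B0; elim: n om x => [|n IH] om x hB.
  by rewrite /path_potential big_ord0 minn0 /= mulr0 mul0r addr0 lexx.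
have hB' k : (k < n)%N -> envelope (T (pos (mkseq (fun k => x k.+1) k))
    (T (val (x 0%N)) om)) <= B.
  move=> kn; rewrite -(shiftD T_sys); [|exact: step_group_pos|exact: step_group_val].
  by rewrite [pos _ + _]addrC -pos_cons -mkseqS; exact: hB.
have /andP[h1 h2] := IH (T (val (x 0%N)) om) (fun k => x k.+1) hB'.
have h0 : envelope om <= B.
  by have := hB 0%N isT; rewrite /mkseq/= pos_nil (shift0 T_sys).
rewrite path_potentialS mkseqS [lower_potential _ (_ :: _)]/= size_mkseq.
have [ln|ln] := leqP l n.+1.
  have -> : [tuple nth (x 0%N) (x 0%N :: mkseq (fun k => x k.+1) n) i | i < l] =
      [tuple x i | i < l].
    apply: eq_from_tnth => i; rewrite !tnth_mktuple -mkseqS nth_mkseq//.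
    exact: leq_trans (ltn_ord i) ln.
  rewrite lerD2l h1/= -addrA lerD2l (le_trans h2)// lerD2l ler_wpM2r// ler_wpM2l//.
  by rewrite ler_nat; lia.
have e1 : minn l n = n by apply/minn_idPr; rewrite ltnW// ltnW.
rewrite e1 in h2; rewrite -natr1.
set c := g _; have := envelope_ge om [tuple x i | i < l]; rewrite -/c ler_norml.
by move=> /andP[c1 c2]; apply/andP; split; lra.
Qed.

(** All copies of a step are made in a row: the class L condition controls exactly such straight
    runs. *)
Definition word_of (zs : seq Rs) u : seq Rs := flatten [seq nseq (u z) z | z <- zs].
Definition word u : seq Rs := word_of (enum {: Rs}) u.

Lemma size_word u : size (word u) = csize u.
Proof.
rewrite size_flatten /shape -map_comp sumnE big_map /csize big_enum.
by apply: eq_bigr => z _ /=; rewrite size_nseq.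
Qed.

Lemma pos_word_of zs u : pos (word_of zs u) = \sum_(z <- zs) val z *+ u z.
Proof.
elim: zs => [|z zs IH]; first by rewrite pos_nil big_nil.
by rewrite /word_of /= pos_cat pos_nseq big_cons -IH.
Qed.

Lemma pos_word u : pos (word u) = cpos u.
Proof. by rewrite pos_word_of big_enum. Qed.

Definition count_vector s : cnt Rs := [ffun z => count_mem z s].

Lemma csize_count s : csize (count_vector s) = size s.
Proof.
elim: s => [|z s IH]; first by rewrite /csize big1// => z _; rewrite ffunE.
rewrite /= -IH /csize (bigD1 z)//= [in RHS](bigD1 z)//= !ffunE /= eqxx add1n addSn.
congr (_ + _).+1; apply: eq_bigr => z' zz'; rewrite !ffunE /= eq_sym.
by rewrite (negPf zz').
Qed.

Lemma cpos_count s : cpos (count_vector s) = pos s.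
Proof.
elim: s => [|z s IH].
  by rewrite /cpos pos_nil big1// => z _; rewrite ffunE mulr0n.
rewrite pos_cons -IH /cpos (bigD1 z)//= [in RHS](bigD1 z)//= !ffunE /= eqxx.
rewrite add1n mulrS -!addrA; congr (_ + (_ + _)); apply: eq_bigr => z' zz'.
by rewrite !ffunE /= eq_sym (negPf zz').
Qed.

Let r : R := #|{: Rs}|%:R.
Variable z0 : Rs.

Let r1 : 1 <= r.
Proof. by rewrite ler1n; apply/card_gt0P; exists z0. Qed.

Let r0 : 0 < r. Proof. exact: lt_le_trans r1. Qed.

Definition lower_partition (om : Om) (n : nat) (x : 'rV[int]_d) : R :=
  \sum_(s : n.-tuple Rs | pos s == x) expR (lower_potential om s) / r ^+ n.

Lemma lower_partition_term om n x (s : n.-tuple Rs) : pos s = x ->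
  expR (lower_potential om s) / r ^+ n <= lower_partition om n x.
Proof.
move=> sx; rewrite /lower_partition (bigD1 s) ?sx//= lerDl.
by apply: sumr_ge0 => t _; rewrite divr_ge0 ?expR_ge0// exprn_ge0// ltW.
Qed.

Definition log_partition (om : Om) u : R := ln (lower_partition om (csize u) (cpos u)).

Lemma lower_partition_gt0 om u : 0 < lower_partition om (csize u) (cpos u).
Proof.
have hs : size (word u) == csize u by rewrite size_word.
apply: lt_le_trans (lower_partition_term om (s := Tuple hs) (pos_word u)).
by rewrite divr_gt0 ?expR_gt0// exprn_gt0.
Qed.

(** The single path [word u] already gives this much. The bound is integrable in [om], which the ray
    limits need. *)
Lemma log_partition_ge om u : - envelope_sum om (word u) - (csize u)%:R * ln r <=
  log_partition om u.
Proof.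
have hs : size (word u) == csize u by rewrite size_word.
have := lower_partition_term om (s := Tuple hs) (pos_word u) => /=.
have e0 : 0 < expR (lower_potential om (word u)) / r ^+ csize u.
  by rewrite divr_gt0 ?expR_gt0// exprn_gt0.
rewrite -ler_ln ?posrE// ?lower_partition_gt0//; apply: le_trans.
rewrite ln_div ?posrE ?expR_gt0 ?exprn_gt0// expRK lnXn// mulr_natl.
by rewrite lerD2r lower_potential_ge.
Qed.

(** Concatenation embeds the pairs of paths into the paths that end at [x + y], and
    [lower_potential] is superadditive under it. *)
Lemma lower_partitionM om n m x y : step_group Rs x ->
  lower_partition om n x * lower_partition (T x om) m y <=
  lower_partition om (n + m) (x + y).
Proof.
move=> gx; rewrite /lower_partition big_distrlr/= pair_big/=.
pose h (q : n.-tuple Rs * m.-tuple Rs) : (n + m).-tuple Rs := [tuple of q.1 ++ q.2].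
pose w (t : (n + m).-tuple Rs) := expR (lower_potential om t) / r ^+ (n + m).
have w0 t : 0 <= w t by rewrite divr_ge0 ?expR_ge0// exprn_ge0// ltW.
apply: (@le_trans _ _ (\sum_(q : n.-tuple Rs * m.-tuple Rs |
    (pos q.1 == x) && (pos q.2 == y)) w (h q))).
  apply: ler_sum => q /andP[/eqP q1 _].
  rewrite /w mulrACA -expRD -invfM -exprD ler_wpM2r ?invr_ge0 ?exprn_ge0 ?(ltW r0)//.
  by rewrite ler_expR -q1; exact: lower_potential_cat.
have h_inj : injective h.
  move=> [a1 a2] [b1 b2] /(congr1 (fun t : (n + m).-tuple Rs => (t : seq Rs))) /eqP /=.
  rewrite eqseq_cat ?size_tuple// => /andP[/eqP e1 /eqP e2].
  by congr (_, _); apply: val_inj.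
apply: ler_sum_injective => // q /andP[/eqP <- /eqP <-].
by rewrite /= pos_cat.
Qed.

End potential.

Lemma ler_sum_nat_widen {R : realType} (F : nat -> R) (m n : nat) :
  (forall k, 0 <= F k) -> (m <= n)%N ->
  \sum_(0 <= k < m) F k <= \sum_(0 <= k < n) F k.
Proof.
move=> F0 mn; rewrite (@big_cat_nat _ _ _ m 0 n)//= lerDl.
by apply: sumr_ge0.
Qed.

(** * The class L condition at a fixed environment *)

Section environment_bounds.
Context {R : realType} {d : nat} {Rs : {fset 'rV[int]_d}}.
Context {dO : measure_display} {Om : measurableType dO}.
Variables (PP : probability Om R) (T : 'rV[int]_d -> Om -> Om).
Hypothesis T_sys : dynamical_system Rs PP T.
Variables (l : nat) (g : Om * l.-tuple Rs -> R).
Implicit Types (s p : seq Rs) (u v : cnt Rs).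

(** The class L condition at one environment with its upper limits unfolded, for all nonzero steps
    and all tuples at once. *)
Definition regular_env (om : Om) := forall eta : R, 0 < eta -> exists2 eps : R, 0 < eps &
  exists N : nat, forall n : nat, (N <= n)%N -> forall z : Rs, val z != 0 ->
  forall x, step_group Rs x -> euclid_norm x <= n%:R :> R ->
  \sum_(0 <= k < (Num.truncn (eps * n%:R)).+1) envelope g (T (x + val z *+ k) om) <=
  eta * n%:R.

Lemma class_L_regular : class_L PP T g -> {ae PP, forall om, regular_env om}.
Proof.
move=> [_ _ hL].
have ae_good : {ae PP, forall om, forall q : l.-tuple Rs * Rs, val q.2 != 0 ->
    limf_esup (fun eps : R => limn_esup (fun n : nat => ereal_sup
      [set (n%:R^-1 * \sum_(0 <= k < (Num.truncn (eps * n%:R)).+1)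
        `|g (T (x + val q.2 *+ k) om, q.1)|)%:E
      | x in [set x | step_group Rs x /\ euclid_norm x <= n%:R :> R]])) 0^'+ = 0%E}.
  apply: ae_forall_countable => -[zs z] /=.
  have [z0|z0] := eqVneq (val z) 0; first by apply: aeW.
  by apply: filterS (hL zs z z0).
apply: filterS ae_good => om hom eta eta0.
set K : R := #|{: l.-tuple Rs}|%:R + 1.
have K0 : 0 < K by rewrite ltr_wpDl.
have h (q : l.-tuple Rs * Rs) : exists eN : R * nat, 0 < eN.1 /\ (val q.2 != 0 ->
    forall n, (eN.2 <= n)%N -> forall x, step_group Rs x -> euclid_norm x <= n%:R :> R ->
    \sum_(0 <= k < (Num.truncn (eN.1 * n%:R)).+1) `|g (T (x + val q.2 *+ k) om, q.1)| <=
    eta / K * n%:R).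
  have [z0|z0] := eqVneq (val q.2) 0; first by exists (1, 0%N).
  have /eqP := hom q z0; rewrite eq_le => /andP[h0 _].
  have eK : (0 < (eta / K)%:E)%E by rewrite lte_fin divr_gt0.
  have := le_lt_trans h0 eK.
  move=> /ereal_inf_lt[_ [V nV <-] hV].
  have : \forall e \near (0 : R)^'+, V e /\ 0 < e.
    near=> e; split; first by near: e; exact: nV.
    by near: e; exact: nbhs_right_gt.
  move=> /filter_ex[e [Ve e0]].
  have := le_lt_trans (ereal_sup_ubound (ex_intro2 _ _ e Ve erefl)) hV.
  move=> /limn_esup_lt_near[N _ hN]; exists (e, N.+1); split => //= _ n Nn x gx xn.
  have := hN n (ltnW Nn) => /(le_lt_trans (ereal_sup_ubound (ex_intro2 _ _ x (conj gx xn) erefl))).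
  by rewrite lte_fin mulrC ltr_pdivrMr ?ltr0n ?(leq_trans _ Nn)// => /ltW.
have [f hf] := choice h.
pose eps := \big[Order.min/1]_q (f q).1.
have eps0 : 0 < eps.
  by rewrite /eps; elim/big_ind: _ => // [x y x0 y0|q _]; [rewrite lt_min x0|have [] := hf q].
exists eps => //; exists (\max_q (f q).2)%N => n Nn z z0 x gx xn.
rewrite /envelope exchange_big/=.
apply: (@le_trans _ _ (\sum_(zs : l.-tuple Rs) eta / K * n%:R)).
  apply: ler_sum => zs _; have [f0 hq] := hf (zs, z).
  have Nq : ((f (zs, z)).2 <= n)%N.
    by apply: leq_trans Nn; exact: (leq_bigmax (F := fun q => (f q).2)).
  apply: le_trans (hq z0 n Nq x gx xn) => /=.
  have le : ((Num.truncn (eps * n%:R)).+1 <= (Num.truncn ((f (zs, z)).1 * n%:R)).+1)%N.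
    rewrite ltnS; apply: le_truncn; rewrite ler_wpM2r//.
    exact: (@bigmin_le _ _ _ 1 (zs, z) (fun q => (f q).1)).
  exact: ler_sum_nat_widen.
have -> : \sum_(zs : l.-tuple Rs) eta / K * n%:R =
    #|{: l.-tuple Rs}|%:R * (eta / K * n%:R) by rewrite sumr_const mulr_natl.
rewrite mulrA ler_wpM2r// mulrCA ler_piMr ?(ltW eta0)//.
by rewrite ler_pdivrMr// mul1r lerDl.
Unshelve. all: by end_near. Qed.

Lemma euclid_norm_le (x : 'rV[int]_d) : euclid_norm x <= \sum_i `|x 0 i|%:~R :> R.
Proof.
have S0 : 0 <= \sum_i `|x 0 i|%:~R :> R by apply: sumr_ge0 => i _; rewrite ler0z.
rewrite -[leRHS]ger0_norm// -sqrtr_sqr; apply: ler_wsqrtr.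
rewrite expr2 mulr_suml; apply: ler_sum => i _.
rewrite -[leLHS]ger0_norm ?sqr_ge0// normrX expr2 -intr_norm ler_wpM2l ?ler0z//.
by rewrite (bigD1 i)//= lerDl; apply: sumr_ge0 => j _; rewrite ler0z.
Qed.

Definition step_bound : nat := (\sum_(z : Rs) \sum_i absz ((val z : 'rV_d) ord0 i)).+1.

Lemma euclid_norm_pos s : euclid_norm (pos s) <= (step_bound * size s)%:R :> R.
Proof.
apply: le_trans (euclid_norm_le _) _; elim: s => [|z s IH].
  by rewrite pos_nil muln0 big1// => i _; rewrite mxE normr0.
rewrite /= mulnS natrD pos_cons; apply: le_trans (lerD _ IH); last first.
  apply: (@le_trans _ _ (\sum_i `|val z 0 i|%:~R)); last first.
    have e : \sum_i `|val z 0 i|%:~R = (\sum_i absz ((val z : 'rV_d) ord0 i))%N%:R :> R.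
      by rewrite natr_sum; apply: eq_bigr => i _; rewrite natr_absz.
    by rewrite e ler_nat ltnW// ltnS (bigD1 z)//= leq_addr.
  by [].
rewrite -big_split/=; apply: ler_sum => i _; rewrite mxE -rmorphD/= ler_int.
exact: ler_normD.
Qed.

(** The site [pos s] is the first term of a run of some nonzero step. If all steps are zero, class L
    gives nothing, but then the walk stays at the origin. *)
Lemma regular_env_site om : regular_env om -> forall eta : R, 0 < eta ->
  exists N : nat, forall n s, (N <= n)%N -> (size s <= n)%N ->
    envelope g (T (pos s) om) <= eta * n%:R.
Proof.
move=> hom eta eta0.
have [[z z0]|/forallNP allz] := pselect (exists z : Rs, val z != 0); last first.
  have pos0 s : pos s = 0.
    rewrite /pos big1// => z _; apply/eqP; apply: contrapT => /negP h.
    exact: (allz z).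
  have [N hN] := natr_large (envelope g om / eta).
  exists N => n s Nn _; rewrite pos0 (shift0 T_sys).
  by rewrite mulrC -ler_pdivrMr// hN.
have C0 : 0 < step_bound%:R :> R by rewrite ltr0n.
have [eps eps0 [N hN]] := hom _ (divr_gt0 eta0 C0).
exists N => n s Nn sn.
have Nn' : (N <= step_bound * n)%N by rewrite (leq_trans Nn)// leq_pmull.
have hx : euclid_norm (pos s) <= (step_bound * n)%:R :> R.
  by apply: le_trans (euclid_norm_pos s) _; rewrite ler_nat leq_mul2l sn orbT.
have := hN _ Nn' z z0 _ (step_group_pos s) hx.
have e : eta / step_bound%:R * (step_bound * n)%:R = eta * n%:R.
  by rewrite natrM mulrA divfK ?gt_eqF.
rewrite e big_nat_recl//= mulr0n addr0.
by apply: le_trans; rewrite lerDl; apply: sumr_ge0 => k _; exact: envelope_ge0.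
Qed.

(* Walking along one step z after the other. *)
Lemma envelope_sum_word om u (b : R) (n : nat) (zs : seq Rs) p :
  (forall z (q : seq Rs), (size q <= n)%N -> u z <> 0%N ->
    \sum_(0 <= j < u z) envelope g (T (pos q + val z *+ j) om) <= b) -> 0 <= b ->
  (size p + size (word_of zs u) <= n)%N ->
  envelope_sum T g (T (pos p) om) (word_of zs u) <= (size zs)%:R * b.
Proof.
move=> hb b0; elim: zs p => [|z zs IH] p; first by rewrite mul0r.
rewrite /word_of /= size_cat size_nseq -/(word_of zs u) => hsz.
rewrite (envelope_sum_cat T_sys) (envelope_sum_nseq T_sys) pos_nseq.
rewrite -natr1 mulrDl mul1r addrC lerD//.
  rewrite -(shiftD T_sys); last exact: step_group_pos.
    rewrite addrC -pos_nseq -pos_cat; apply: IH.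
    by rewrite size_cat size_nseq -addnA.
  by apply: step_groupMn; exact: step_group_val.
have [->|uz] := eqVneq (u z) 0%N; first by rewrite big_nil.
apply: le_trans (hb z p _ (elimN eqP uz)); last by rewrite (leq_trans _ hsz)// leq_addr.
apply: ler_sum => j _; rewrite -(shiftD T_sys) ?[pos p + _]addrC//.
- by apply: step_groupMn; exact: step_group_val.
- exact: step_group_pos.
Qed.

Variable z0 : Rs.

Lemma log_partition_super om u v :
  log_partition T g om u + log_partition T g (T (cpos u) om) v <=
  log_partition T g om (cadd u v).
Proof.
have gu : step_group Rs (cpos u) by rewrite -pos_word; exact: step_group_pos.
have p1 := lower_partition_gt0 T g z0 om u.
have p2 := lower_partition_gt0 T g z0 (T (cpos u) om) v.
rewrite /log_partition -lnM ?posrE// ler_ln ?posrE ?mulr_gt0 ?lower_partition_gt0//.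
by rewrite csize_add cpos_add; exact: (lower_partitionM T_sys).
Qed.

Lemma log_partition0 om : log_partition T g om c0 = 0.
Proof.
have -> : log_partition T g om c0 = ln 1; last by rewrite ln1.
congr ln; have -> : cpos (c0 : cnt Rs) = 0.
  by rewrite /cpos big1// => z _; rewrite ffunE mulr0n.
rewrite csize0 /lower_partition (bigD1 [tuple])//=; last by rewrite pos_nil.
rewrite expR0 expr0 divr1 big1 ?addr0// => t /andP[_ /negP[]].
by apply/eqP; rewrite [t]tuple0; apply: val_inj.
Qed.

Lemma log_partition_pos om u v : csize u = csize v -> cpos u = cpos v ->
  log_partition T g om u = log_partition T g om v.
Proof. by rewrite /log_partition => -> ->. Qed.

(* The additional zero steps are made first, at the origin. *)
Lemma log_partition_extension om : regular_env om ->
  extension_stable (log_partition T g om).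
Proof.
move=> hom eta eta0.
pose r : R := #|{: Rs}|%:R.
have r1 : 1 <= r by rewrite ler1n; apply/card_gt0P; exists z0.
have r0 : 0 < r by exact: lt_le_trans r1.
have lnr : 0 <= ln r by rewrite ln_ge0.
pose C : R := step_bound%:R.
have C0 : 0 < C by rewrite ltr0n.
pose G := envelope g om + ln r + 1.
have G0 : 0 < G by rewrite ltr_wpDl// addr_ge0// envelope_ge0.
have e0 : 0 < eta / (2 * r * C) by rewrite divr_gt0// !mulr_gt0.
have [eps eps0 [N hN]] := hom _ e0.
(* Paths of [n] steps stay in the ball of radius [C * n], where regularity admits runs of
   [eps * C * n] steps; [eta / (2 * G)] pays for the zero steps and for the factors [ln r]. *)
pose eps' := Num.min (eps * C) (eta / (2 * G)).
have eps'0 : 0 < eps' by rewrite lt_min mulr_gt0//= divr_gt0// mulr_gt0.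
exists eps' => //; exists N => n u v Nn uv vn szd.
pose del := csub v u.
(* Class L says nothing about the zero step. At the origin its repetitions [a] see the fixed
   quantity [envelope g om]; the nonzero steps [c] are appended after [u]. *)
pose a : cnt Rs := [ffun z => if val z == 0 then del z else 0%N].
pose c : cnt Rs := [ffun z => if val z == 0 then 0%N else del z].
have vE : v = cadd (cadd a u) c.
  apply/ffunP => z; rewrite !ffunE; have := uv z.
  by case: ifP => _ h; rewrite ?addn0 ?add0n ?subnK// addnC subnK.
have del_le z : (del z <= csize del)%N by rewrite /csize (bigD1 z)//= leq_addr.
have sdel : (csize del)%:R <= eps' * n%:R :> R.
  by rewrite csize_sub// natrB// csize_le.
have sac : csize del = (csize a + csize c)%N.
  rewrite /csize -big_split/=; apply: eq_bigr => z _; rewrite [a z]ffunE [c z]ffunE.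
  by case: ifP; rewrite ?addn0.
have ca : cpos a = 0.
  rewrite /cpos big1// => z _; rewrite ffunE; case: ifP => [/eqP ->|_].
    by rewrite mul0rn.
  by rewrite mulr0n.
have := log_partition_super om (cadd a u) c; rewrite -vE; apply: le_trans.
have := log_partition_super om a u; rewrite ca (shift0 T_sys) => h1.
have := log_partition_ge T g z0 om a; rewrite -/r (envelope_sum_zero T_sys); last first.
  apply/allP => z /flattenP[_ /mapP[z' _ ->]]; rewrite mem_nseq ffunE => /andP[+ /eqP ->].
  by case: ifP.
rewrite size_word => h2.
have := log_partition_ge T g z0 (T (cpos (cadd a u)) om) c; rewrite -/r => h3.
have cap : cpos (cadd a u) = pos (word (cadd a u)) by rewrite pos_word.
have n0 : 0 <= n%:R :> R by [].
have b0 : 0 <= eta / (2 * r * C) * (C * n%:R).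
  by rewrite mulr_ge0 ?(ltW e0)// mulr_ge0// ltW.
have h4 : envelope_sum T g (T (cpos (cadd a u)) om) (word c) <=
    r * (eta / (2 * r * C) * (C * n%:R)).
  have er : r = (size (enum {: Rs}))%:R by rewrite -cardE.
  rewrite cap {1}er.
  apply: (envelope_sum_word (n := n)) => //; last first.
    by rewrite -/(word _) -/(word _) !size_word -csize_add -vE.
  move=> z q qn cz.
  have z_neq0 : val z != 0 by apply/negP => z_eq0; apply: cz; rewrite ffunE z_eq0.
  have Nn' : (N <= step_bound * n)%N by rewrite (leq_trans Nn)// leq_pmull.
  have hq : euclid_norm (pos q) <= (step_bound * n)%:R :> R.
    by apply: le_trans (euclid_norm_pos q) _; rewrite ler_nat leq_mul2l qn orbT.
  have := hN _ Nn' z z_neq0 _ (step_group_pos q) hq; rewrite natrM; apply: le_trans.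
  have le : (c z <= (Num.truncn (eps * (step_bound%:R * n%:R))).+1)%N.
    rewrite ltnW// ltnS truncn_ge_nat; last by rewrite !mulr_ge0// ltW.
    rewrite ffunE (negPf z_neq0).
    apply: (@le_trans _ _ (csize del)%:R); first by rewrite ler_nat.
    apply: le_trans sdel _; rewrite mulrA ler_wpM2r//.
    by rewrite ge_min lexx.
  by apply: ler_sum_nat_widen => // k; exact: envelope_ge0.
have h5 : r * (eta / (2 * r * C) * (C * n%:R)) = eta / 2 * n%:R.
  by field; rewrite !gt_eqF.
have h6 : (csize a)%:R * (envelope g om + ln r) + (csize c)%:R * ln r <= eta / 2 * n%:R.
  have k1 : (csize a)%:R * (envelope g om + ln r) <= (csize a)%:R * G.
    by apply: ler_wpM2l; rewrite // /G lerDl.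
  have k2 : (csize c)%:R * ln r <= (csize c)%:R * G.
    apply: ler_wpM2l; rewrite // /G; have := envelope_ge0 g om; lra.
  have k3 : (csize del)%:R * G <= eps' * n%:R * G by apply: ler_wpM2r; rewrite // ltW.
  have k4 : eps' * G <= eta / 2.
    have : eps' <= eta / (2 * G) by rewrite ge_min lexx orbT.
    by rewrite ler_pdivlMr ?mulr_gt0//; lra.
  have k5 : n%:R * (eps' * G) <= n%:R * (eta / 2) by exact: ler_wpM2l.
  by move: k3; rewrite sac natrD; lra.
by lra.
Qed.

Definition log_total (om : Om) (n : nat) : R :=
  ln (\sum_(s : n.-tuple Rs) expR (lower_potential T g om s) / #|{: Rs}|%:R ^+ n).

Let r0 : 0 < #|{: Rs}|%:R :> R.
Proof. by rewrite ltr0n; apply/card_gt0P; exists z0. Qed.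

Lemma log_partition_le_total om u : log_partition T g om u <= log_total om (csize u).
Proof.
have h : lower_partition T g om (csize u) (cpos u) <=
    \sum_(s : (csize u).-tuple Rs) expR (lower_potential T g om s) / #|{: Rs}|%:R ^+ csize u.
  rewrite /lower_partition [leLHS]big_mkcond; apply: ler_sum => s _; case: ifP => // _.
have p1 := lower_partition_gt0 T g z0 om u.
by rewrite ler_ln ?posrE// (lt_le_trans p1).
Qed.

(** Each path has one of at most [(n + 1) ^ #|{: Rs}|] count vectors; [u] is one of size [n] with
    the largest partition function. *)
Lemma log_total_le_partition om n : exists2 u : cnt Rs, csize u = n &
  log_total om n <= log_partition T g om u + #|{: Rs}|%:R * ln n.+1%:R.
Proof.
pose cv (s : n.-tuple Rs) : {ffun Rs -> 'I_n.+1} := [ffun z => inord (count_mem z s)].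
pose nat_of (c : {ffun Rs -> 'I_n.+1}) : cnt Rs := [ffun z => nat_of_ord (c z)].
have cvE (s : n.-tuple Rs) : nat_of (cv s) = count_vector s.
  apply/ffunP => z; rewrite !ffunE inordK// ltnS.
  by rewrite (leq_trans (count_size _ _))// size_tuple.
have s0 : size (nseq n z0) == n by rewrite size_nseq.
pose Pn c := csize (nat_of c) == n.
have P0 : Pn (cv (Tuple s0)) by rewrite /Pn cvE csize_count.
pose F c := lower_partition T g om (csize (nat_of c)) (cpos (nat_of c)).
have [c Pc hc] := @arg_maxP _ _ _ (cv (Tuple s0)) Pn F P0.
exists (nat_of c); first exact/eqP.
have F0 : 0 < F c by exact: lower_partition_gt0.
set w := fun s : n.-tuple Rs => expR (lower_potential T g om s) / #|{: Rs}|%:R ^+ n.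
have w0 (s : n.-tuple Rs) : 0 <= w s by rewrite divr_ge0 ?expR_ge0// exprn_ge0// ltW.
have le : \sum_s w s <= F c * n.+1%:R ^+ #|{: Rs}|.
  rewrite (partition_big cv xpredT)//=.
  apply: (@le_trans _ _ (\sum_(c' : {ffun Rs -> 'I_n.+1}) F c)); last first.
    by rewrite sumr_const card_ffun card_ord -natrX mulr_natr.
  apply: ler_sum => c' _.
  have [Pc'|Pc'] := boolP (Pn c'); last first.
    rewrite big1 ?(ltW F0)// => s /eqP sc; exfalso; move/negP: Pc'; apply.
    by rewrite /Pn -sc cvE csize_count size_tuple.
  apply: le_trans (hc c' Pc'); rewrite /F (eqP Pc') /lower_partition.
  rewrite big_mkcond [leRHS]big_mkcond; apply: ler_sum => s _.
  case: ifP => [/eqP sc|_]; last by case: ifP.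
  by rewrite ifT// -sc cvE cpos_count.
rewrite /log_total /log_partition -/(F c) mulr_natl -lnXn// -lnM ?posrE ?exprn_gt0//.
have w_gt0 : 0 < \sum_s w s.
  rewrite (bigD1 (Tuple s0))//= ltr_wpDr ?sumr_ge0//.
  by rewrite divr_gt0 ?expR_gt0// exprn_gt0.
by rewrite ler_ln ?posrE// mulr_gt0// exprn_gt0.
Qed.

End environment_bounds.

(** * Almost sure ray limits *)

Section log_partition_measure.
Context {R : realType} {d : nat} {Rs : {fset 'rV[int]_d}}.
Context {dO : measure_display} {Om : measurableType dO}.
Variables (PP : probability Om R) (T : 'rV[int]_d -> Om -> Om).
Hypothesis T_sys : dynamical_system Rs PP T.
Variables (l : nat) (g : Om * l.-tuple Rs -> R).
Hypothesis g_L : class_L PP T g.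
Variable z0 : Rs.
Implicit Types (s p : seq Rs) (u v : cnt Rs).

Let H := log_partition T g.

Lemma measurable_potential zs : measurable_fun setT (fun om => g (om, zs)).
Proof. by case: g_L => _ /(_ zs)/measurable_int/measurable_EFinP. Qed.

Lemma measurable_envelope : measurable_fun setT (envelope g).
Proof.
apply: measurable_sum => zs; apply: measurableT_comp => //.
exact: measurable_potential.
Qed.

Lemma measurable_shift (z : Rs) : measurable_fun setT (T (val z)).
Proof. exact: (shift_mpreserving T_sys (step_group_val z)).1. Qed.

Lemma measurable_lower_potential s :
  measurable_fun setT (fun om => lower_potential T g om s).
Proof.
elim: s => [|z s IH]; first exact: measurable_cst.
move=> /=; apply: measurable_funD.
  case: (l <= _)%N; first exact: measurable_potential.
  by apply: measurableT_comp => //; exact: measurable_envelope.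
exact: measurableT_comp IH (measurable_shift z).
Qed.

Lemma measurable_envelope_sum s :
  measurable_fun setT (fun om => envelope_sum T g om s).
Proof.
elim: s => [|z s IH]; first exact: measurable_cst.
apply: measurable_funD; first exact: measurable_envelope.
exact: measurableT_comp IH (measurable_shift z).
Qed.

Lemma measurable_log_partition u : measurable_fun setT (fun om => H om u).
Proof.
apply: measurableT_comp; first exact: measurable_ln.
rewrite /lower_partition; under eq_fun do rewrite big_mkcond.
apply: measurable_sum => s; case: (pos s == _); last exact: measurable_cst.
apply: measurable_funM; last exact: measurable_cst.
apply: measurableT_comp; first exact: measurable_expR.
exact: measurable_lower_potential.
Qed.

Lemma envelope_integral : (\int[PP]_om (envelope g om)%:E < +oo)%E.
Proof.
rewrite /envelope; under eq_integral do rewrite -sumEFin.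
rewrite ge0_integral_sum//; last first.
  move=> zs; apply/measurable_EFinP; apply: measurableT_comp => //.
  exact: measurable_potential.
apply: lte_sum_pinfty => zs _.
by case: g_L => _ /(_ zs)/integrableP[_ h] _.
Qed.

Lemma envelope_sum_integral s : (\int[PP]_om (envelope_sum T g om s)%:E < +oo)%E.
Proof.
elim: s => [|z s IH] /=; first by rewrite integral0 ltry.
under eq_integral do rewrite EFinD.
rewrite ge0_integralD//; last 4 first.
- by move=> om _; rewrite lee_fin envelope_ge0.
- by apply/measurable_EFinP; exact: measurable_envelope.
- by move=> om _; rewrite lee_fin envelope_sum_ge0.
- apply/measurable_EFinP.
  exact: measurableT_comp (measurable_envelope_sum s) (measurable_shift z).
rewrite lte_add_pinfty//; first exact: envelope_integral.
rewrite (mpreserving_integral (shift_mpreserving T_sys (step_group_val z))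
  (measurable_envelope_sum s))//.
by move=> om; exact: envelope_sum_ge0.
Qed.

(** An upper limit is defined and measurable everywhere; almost surely it is a limit, by
    [ae_ray_limits]. *)
Definition ray_limit u (om : Om) : \bar R :=
  limn_esup (fun k => (H om (cmul k u) / (k * csize u)%:R)%:E).

Lemma measurable_ray_limit u : measurable_fun setT (ray_limit u).
Proof.
apply: (measurable_fun_limn_esup
  (f := fun k om => (H om (cmul k u) / (k * csize u)%:R)%:E)) => k.
apply/measurable_EFinP; apply: measurable_funM; last exact: measurable_cst.
exact: measurable_log_partition.
Qed.

Lemma cmulD m n u : cmul (m + n) u = cadd (cmul m u) (cmul n u).
Proof. by apply/ffunP => z; rewrite !ffunE mulnDl. Qed.

Lemma cmul1 u : cmul 1 u = u.
Proof. by apply/ffunP => z; rewrite ffunE mul1n. Qed.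

Lemma cmul0 u : cmul 0 u = c0.
Proof. by apply/ffunP => z; rewrite !ffunE. Qed.

Lemma step_group_cpos u : step_group Rs (cpos u).
Proof. by rewrite -pos_word; exact: step_group_pos. Qed.

(** To make the sequence nonnegative, the Birkhoff sums [B] of an integrable [phi] with [- phi <= H]
    are added. Kingman's theorem applies to the sum [A] and to [B], and the limit for [B] is finite,
    so it can be subtracted even when that for [A] is [+oo]. *)
Lemma ae_ray_limits : {ae PP, forall om, ray_limits (H om) (ray_limit ^~ om)}.
Proof.
suff h u : {ae PP, forall om, (0 < csize u)%N ->
    (H om (cmul k u) / (k * csize u)%:R)%:E @[k --> \oo] --> ray_limit u om}.
  exact: ae_forall_countable h.
have [u0|] := boolP (0 < csize u)%N; last by move=> _; apply: aeW.
pose tau := T (cpos u).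
have tau_mp : mpreserving PP tau := shift_mpreserving T_sys (step_group_cpos u).
pose phi om := envelope_sum T g om (word u) + (csize u)%:R * ln #|{: Rs}|%:R.
have lnr : 0 <= (csize u)%:R * ln #|{: Rs}|%:R :> R.
  by rewrite mulr_ge0// ln_ge0// ler1n; apply/card_gt0P; exists z0.
have phi0 om : 0 <= phi om by rewrite addr_ge0// envelope_sum_ge0.
have mphi : measurable_fun setT phi.
  by apply: measurable_funD; [exact: measurable_envelope_sum|exact: measurable_cst].
have iphi : (\int[PP]_om (phi om)%:E < +oo)%E.
  rewrite /phi; under eq_integral do rewrite EFinD.
  rewrite ge0_integralD//; last 2 first.
  - by move=> om _; rewrite lee_fin envelope_sum_ge0.
  - by apply/measurable_EFinP; exact: measurable_envelope_sum.
  rewrite lte_add_pinfty//; first exact: envelope_sum_integral.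
  by rewrite integral_cst//= probability_setT mule1 ltry.
have itE k om : iter k tau om = T (cpos u *+ k) om.
  by rewrite /tau (shift_iter T_sys)//; exact: step_group_cpos.
pose B := birkhoff_sum tau phi.
pose A k om := H om (cmul k u) + B k om.
have mA k : measurable_fun setT (A k).
  apply: measurable_funD; first exact: measurable_log_partition.
  exact: (measurable_birkhoff_sum tau_mp).
have sH m n om : H om (cmul m u) + H (iter m tau om) (cmul n u) <= H om (cmul (m + n) u).
  by rewrite cmulD itE -cpos_mul; exact: (log_partition_super T_sys).
have A0 k om : 0 <= A k om.
  rewrite /A -lerBlDr sub0r; elim: k => [|k IH].
    by rewrite /B /birkhoff_sum big_geq// oppr0 cmul0 /H log_partition0.
  have h1 := sH k 1%N om; rewrite addn1 cmul1 in h1; apply: le_trans h1.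
  have h2 := log_partition_ge T g z0 (iter k tau om) u.
  have h3 : B k.+1 om = B k om + phi (iter k tau om).
    by rewrite /B /birkhoff_sum big_nat_recr.
  move: IH h2; rewrite h3 /phi -/(H (iter k tau om) u); lra.
have sA m n om : A m om + A n (iter m tau om) <= A (m + n)%N om.
  rewrite /A /B -birkhoff_sumD; have := sH m n om; lra.
have cA := kingman_superadditive tau_mp mA A0 sA.
have cB := kingman_superadditive tau_mp (measurable_birkhoff_sum tau_mp mphi)
  (fun n om => birkhoff_sum_ge0 tau phi0 n om)
  (fun m n om => eq_ind _ (fun y => _ <= y) (lexx _) _ (birkhoff_sumD tau phi m n om)).
have fB := birkhoff_limsup_finite tau_mp mphi phi0 iphi.
apply: filterS (ae_and cA (ae_and cB fB)) => om [/cvg_ex[a ca] [/cvg_ex[b cb] bfin]] _.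
move: bfin; rewrite (cvg_limn_einf_sup cb).2 => b_lt.
have b_ge : (0 <= b)%E.
  rewrite -(cvg_limn_einf_sup cb).1; apply: limn_einf_ge_near; apply: nearW => n.
  by rewrite lee_fin divr_ge0// birkhoff_sum_ge0.
have b_fin : b \is a fin_num by rewrite ge0_fin_numE.
have c1 : ((csize u)%:R^-1%:E * ((A k om / k%:R)%:E - (B k om / k%:R)%:E))%E @[k --> \oo] -->
    ((csize u)%:R^-1%:E * (a - b))%E.
  by apply: cvgeZl => //; apply: cvgeB => //; rewrite fin_num_adde_defl// fin_numN.
have e1 : (fun k => ((csize u)%:R^-1%:E * ((A k om / k%:R)%:E - (B k om / k%:R)%:E))%E) =
    (fun k => (H om (cmul k u) / (k * csize u)%:R)%:E).
  apply/funext => k; rewrite -EFinB -EFinM; congr EFin.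
  by rewrite /A natrM invfM; ring.
by rewrite e1 in c1; rewrite /ray_limit (cvg_limn_einf_sup c1).2.
Qed.

(** Because [u] contains [z], a step [z] followed by [k u] lies under [(k + 1) u], with a bounded
    number of steps missing. So [H om] at [(k + 1) u] is, up to o(k), at least [H] of the shifted
    environment at [k u]. *)
Lemma ray_limit_shift_le om u (z : Rs) : regular_env T g om -> cpositive u ->
  (ray_limit u (T (val z) om) <= ray_limit u om)%E.
Proof.
move=> hom pu; have u0 : (0 < csize u)%N := csize_positive z0 pu.
have ext := log_partition_extension T_sys z0 hom.
rewrite leNgt; apply/negP => /lte_rat_between[q2 lq2 /gte_real_between[q3 q23 q3l]].
set q : R := ratr q2 in lq2 q23.
have [N1 _ hN1] := limn_esup_lt_near lq2.
have m0 : 0 < (csize u)%:R :> R by rewrite ltr0n.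
set m := (csize u)%:R : R in m0.
have eta0 : 0 < (q3 - q) / 2 by rewrite divr_gt0// subr_gt0.
have [eps eps0 [N2 hN2]] := ext _ eta0.
pose ez : cnt Rs := [ffun z' => (z' == z : nat)].
have sez : csize ez = 1%N.
  rewrite /csize (bigD1 z)//= ffunE eqxx big1 ?addn0// => z' /negPf zz.
  by rewrite ffunE zz.
have cez : cpos ez = val z.
  rewrite /cpos (bigD1 z)//= ffunE eqxx mulr1n big1 ?addr0// => z' /negPf zz.
  by rewrite ffunE zz mulr0n.
pose e := log_partition T g om ez; pose c := `|e| + `|q| * m + (q3 - q) * m.
have [N3 hN3] := natr_large (Num.max (m / eps) (2 * c / (q3 - q))).
have [k Nk] := limn_esup_gt_freq q3l (maxn 1 (maxn N1 (maxn N2 N3))).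
move: Nk; rewrite !geq_max => /and4P[k1 N1k N2k N3k].
have km : (k <= k * csize u)%N by rewrite leq_pmulr.
have kmS : (k * csize u <= k.+1 * csize u)%N by rewrite leq_mul2r leqnSn orbT.
rewrite lte_fin ltr_pdivlMr; last by rewrite ltr0n (leq_trans k1).
move=> h1.
have := hN1 k.+1 (leqW N1k).
rewrite lte_fin ltr_pdivrMr; last by rewrite ltr0n (leq_trans k1 (leq_trans km kmS)).
move=> h2.
pose w := cadd ez (cmul k u).
have wk : cle w (cmul k.+1 u).
  move=> z'; rewrite !ffunE mulSn leq_add2r; case: (z' == z) => //; exact: pu.
have sw : csize w = (1 + k * csize u)%N by rewrite csize_add sez csize_mul.
have N2' : (N2 <= k.+1 * csize u)%N by rewrite (leq_trans N2k)// (leq_trans km).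
have := hN3 k N3k; rewrite ge_max => /andP[]; rewrite !ler_pdivrMr ?subr_gt0// => h3 h4.
have kR : k%:R <= (k * csize u)%:R :> R by rewrite ler_nat.
have kmR : (k.+1 * csize u)%:R = (k * csize u)%:R + m :> R by rewrite mulSn natrD addrC.
have h5 : k%:R * eps <= (k * csize u)%:R * eps by apply: ler_wpM2r => //; exact: ltW.
have := hN2 _ w (cmul k.+1 u) N2' wk.
rewrite csize_mul => /(_ (leqnn _)); rewrite sw => h6.
have {h6} : log_partition T g om w - (q3 - q) / 2 * (k.+1 * csize u)%:R <= H om (cmul k.+1 u).
  apply: h6; rewrite kmR natrD.
  have : 0 <= eps * m by rewrite mulr_ge0 ?ltW.
  by lra.
have := log_partition_super T_sys g z0 om ez (cmul k u); rewrite cez -/w.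
rewrite -/e => h7 h8.
rewrite kmR in h2 h8.
have k0 : 0 <= (k * csize u)%:R :> R by [].
have h9 : k%:R * (q3 - q) <= (k * csize u)%:R * (q3 - q).
  by apply: ler_wpM2r => //; rewrite subr_ge0 ltW.
have e_ge : - `|e| <= e by rewrite lerNl -normrN ler_norm.
have qm : q * m <= `|q| * m by rewrite ler_wpM2r ?ler_norm// ltW.
have q3m : 0 < (q3 - q) * m by rewrite mulr_gt0// subr_gt0.
move: h1 h2 h4 h7 h8 h9; rewrite /c -/(H (T (val z) om) (cmul k u)).
set X := (k * csize u)%:R; set h := H _ _; set h' := H _ _; set h'' := log_partition _ _ _ _.
clear -e_ge qm q3m; move: h h' h'' => h h' h''.
by move=> *; lra.
Qed.

Hypothesis PP_erg : ergodic Rs PP T.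

Lemma ray_limit_deterministic u : cpositive u ->
  exists c, {ae PP, forall om, ray_limit u om = c}.
Proof.
move=> pu; apply: (ergodic_ae_constant T_sys PP_erg); first exact: measurable_ray_limit.
move=> z; apply: filterS (class_L_regular g_L) => om hom.
exact: ray_limit_shift_le.
Qed.

End log_partition_measure.

(* Almost sure convergence gives convergence in probability, which survives
   composition with measure-preserving maps varying along the sequence. *)
Lemma frequently_shifted {R : realType} {dO : measure_display} {Om : measurableType dO}
    (PP : probability Om R) (E : nat -> set Om) (tau : nat -> Om -> Om) (Q : Om -> Prop) :
  (forall k, measurable (E k)) -> (forall k, mpreserving PP (tau k)) ->
  {ae PP, forall om, \forall k \near \oo, E k om} -> {ae PP, forall om, Q om} ->
  exists om, Q om /\ forall N, exists2 k, (N <= k)%N & E k (tau k om).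
Proof.
move=> mE mtau Eev [Z [mZ Z0 QZ]].
pose W n := \bigcap_(k in [set k | (n <= k)%N]) E k.
have mW n : measurable (W n) by apply: bigcap_measurableType.
have ndW : nondecreasing_seq W.
  move=> m n mn; apply/subsetPset => om h k /= nk; apply: h => /=.
  exact: leq_trans nk.
have mUW : measurable (\bigcup_n W n) by apply: bigcupT_measurable.
have UW1 : PP (\bigcup_n W n) = 1%E.
  have : PP (~` (\bigcup_n W n)) = 0%E.
    case: Eev => Z' [mZ' Z'0 sub]; apply/eqP; rewrite -measure_le0 -Z'0.
    by apply: le_measure; rewrite ?inE//; exact: measurableC.
  rewrite probability_setC// => /eqP.
  have := fin_num_measure PP _ mUW; case: (PP _) => // p _.
  by rewrite -EFinB eqe subr_eq0 => /eqP <-.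
have cW := nondecreasing_cvg_mu (mu := PP) mW mUW ndW.
(* From [n0] on each [E k], hence also its preimage under [tau k], has measure above 1/2; so the
   points in infinitely many of these preimages have measure at least 1/2. *)
have [n0 hn0] : exists n0, ((1/2)%:E < PP (W n0))%E.
  have : ((1/2)%:E < limn_einf (PP \o W))%E.
    by rewrite (cvg_limn_einf_sup cW).1 [X in (_ < X)%E]UW1 lte_fin; lra.
  by move=> /limn_einf_gt_near[n _ hn]; exists n; exact: (hn n (leqnn n)).
pose S k := tau k @^-1` E k.
have mS k : measurable (S k) by exact: mpreserving_meas (mtau k) _ (mE k).
pose D n := \bigcup_(k in [set k | (n <= k)%N]) S k.
have mD n : measurable (D n) by apply: bigcup_measurable => k _.
have mID : measurable (\bigcap_n D n) by apply: bigcapT_measurable.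
have niD : nonincreasing_seq D.
  move=> m n mn; apply/subsetPset => om [k /= nk Sk]; exists k => //=.
  exact: leq_trans nk.
have D0fin : (PP (D 0%N) < +oo)%E by rewrite ltey_eq fin_num_measure.
have cD := nonincreasing_cvg_mu (mu := PP) D0fin mD mID niD.
have Dge n : ((1/2)%:E <= PP (D n))%E.
  apply: le_trans (ltW hn0) _; set k := maxn n n0.
  apply: (@le_trans _ _ (PP (E k))).
    apply: le_measure; rewrite ?inE// => om h; apply: h => /=.
    exact: leq_maxr.
  rewrite -((mtau k).2 (E k) (mE k)); apply: le_measure; rewrite ?inE//.
    exact: mS.
  by move=> om h; exists k => //=; exact: leq_maxl.
have IDge : ((1/2)%:E <= PP (\bigcap_n D n))%E.
  rewrite -(cvg_lim _ cD)//; apply: lime_ge; first by apply/cvg_ex; eexists; exact: cD.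
  by apply: nearW => n; exact: Dge.
have [om [hom nZ]] : exists om, (\bigcap_n D n) om /\ ~ Z om.
  apply: contrapT => h; have sub : \bigcap_n D n `<=` Z.
    by move=> om hom; apply: contrapT => nZ; apply: h; exists om.
  have : (PP (\bigcap_n D n) <= PP Z)%E by apply: le_measure; rewrite ?inE.
  move=> /(le_trans IDge); rewrite [X in (_ <= X)%E]Z0 lee_fin; lra.
exists om; split; first by apply: contrapT => nQ; apply: nZ; exact: QZ.
by move=> N; have [k /= Nk Sk] := hom N I; exists k.
Qed.

(** * Superadditivity of the deterministic ray limits *)

Section ray_limit_super.
Context {R : realType} {d : nat} {Rs : {fset 'rV[int]_d}}.
Context {dO : measure_display} {Om : measurableType dO}.
Variables (PP : probability Om R) (T : 'rV[int]_d -> Om -> Om).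
Hypothesis T_sys : dynamical_system Rs PP T.
Variables (l : nat) (g : Om * l.-tuple Rs -> R).
Hypothesis g_L : class_L PP T g.
Hypothesis PP_erg : ergodic Rs PP T.
Variable z0 : Rs.
Implicit Types (u v : cnt Rs).

Lemma ray_limit_constants : exists c : cnt Rs -> \bar R,
  {ae PP, forall om, forall u, cpositive u -> ray_limit T g u om = c u}.
Proof.
have h u : exists c, {ae PP, forall om, cpositive u -> ray_limit T g u om = c}.
  have [pu|npu] := pselect (cpositive u); last by exists 0%E; apply: aeW.
  have [c hc] := ray_limit_deterministic T_sys g_L z0 PP_erg pu.
  by exists c; apply: filterS hc.
have [c hc] := choice h; exists c.
exact: ae_forall_countable hc.
Qed.

(** When [k v] follows [k u], its environment moves with [k], and only convergence in probability
    survives. It gives the desired bound at a suitable [om] for infinitely many [k], which suffices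
    because the limit along [cadd u v] exists. *)
Lemma ray_constants_super (c : cnt Rs -> \bar R) :
  {ae PP, forall om, forall u, cpositive u -> ray_limit T g u om = c u} ->
  ray_superadditive c.
Proof.
move=> hc u v r s pu pv ru sv.
have u0 : (0 < csize u)%N := csize_positive z0 pu.
have v0 : (0 < csize v)%N := csize_positive z0 pv.
have puv : cpositive (cadd u v) by move=> z; rewrite ffunE addn_gt0 pu.
have hr := ae_ray_limits T_sys g_L z0.
pose H := log_partition T g.
pose E k := [set om | s * (k * csize v)%:R < H om (cmul k v)].
have mE k : measurable (E k).
  rewrite (_ : E k = setT `&` (fun om => H om (cmul k v)) @^-1` `]s * (k * csize v)%:R, +oo[).
    exact: (measurable_log_partition T_sys g_L).
  by apply/seteqP; split => om /=; rewrite /E /= in_itv/= andbT// => -[].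
pose tau k := T (cpos (cmul k u)).
have mtau k : mpreserving PP (tau k).
  exact: (shift_mpreserving T_sys (step_group_cpos _)).
have Eev : {ae PP, forall om, \forall k \near \oo, E k om}.
  apply: filterS (ae_and hc hr) => om [h1 h2].
  have := h2 v v0; rewrite h1// => /cvg_limn_einf_sup[e _].
  rewrite -e in sv; have [K _ hK] := limn_einf_gt_near sv.
  exists K.+1 => // k /= Kk; have := hK k (ltnW Kk).
  rewrite lte_fin ltr_pdivlMr//.
  by rewrite ltr0n muln_gt0 v0 (leq_trans _ Kk).
have [om [[h1 h2] hfreq]] := frequently_shifted mE mtau Eev (ae_and hc hr).
have := h2 u u0; rewrite h1// => /cvg_limn_einf_sup[e _].
rewrite -e in ru; have [K _ hK] := limn_einf_gt_near ru.
have uv0 : (0 < csize (cadd u v))%N := csize_positive z0 puv.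
have := h2 _ uv0; rewrite h1// => /cvg_limn_einf_sup[_ e2].
rewrite leNgt; apply/negP => lt; rewrite -e2 in lt.
have [M _ hM] := limn_esup_lt_near lt.
have [k Nk Ek] := hfreq (maxn 1 (maxn K M)).
move: Nk; rewrite !geq_max => /and3P[k0 Kk Mk].
have k0R : 0 < k%:R :> R by rewrite ltr0n.
have := hM k Mk; have := hK k Kk; rewrite !lte_fin.
rewrite ltr_pdivlMr; last by rewrite ltr0n muln_gt0 k0.
rewrite ltr_pdivrMr; last by rewrite ltr0n muln_gt0 k0.
have uvR : 0 < (csize u + csize v)%:R :> R by rewrite ltr0n addn_gt0 u0.
have -> : (r * (csize u)%:R + s * (csize v)%:R) / (csize u + csize v)%:R *
    (k * csize (cadd u v))%:R = r * (k * csize u)%:R + s * (k * csize v)%:R.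
  by rewrite natrD in uvR; rewrite csize_add !natrM natrD; field; exact: lt0r_neq0.
have := log_partition_super T_sys g z0 om (cmul k u) (cmul k v).
have -> : cadd (cmul k u) (cmul k v) = cmul k (cadd u v).
  by apply/ffunP => z; rewrite !ffunE mulnDr.
move: Ek; rewrite /E /mkset /tau /H.
set X := log_partition _ _ _ _; set Y := log_partition _ _ _ _; set X' := log_partition _ _ _ _.
clear; lra.
Qed.

End ray_limit_super.

(** * Free energies of the random walk *)

Lemma nth_tuple_fun (X : Type) (x0 : X) (f : nat -> X) (m k : nat) : (k < m)%N ->
  nth x0 [tuple f i | i < m] k = f k.
Proof. by move=> km; exact: (nth_mktuple (fun i : 'I_m => f i) x0 (Ordinal km)). Qed.

Section walk_expectation.
Context {R : realType} {d : nat} {Rs : {fset 'rV[int]_d}}.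
Context {dW : measure_display} {W : measurableType dW}.
Variables (P : probability W R) (Z : nat -> W -> Rs).
Hypothesis Z_iid : iid_uniform_steps P Z.
Variable z0 : Rs.

Let r : R := #|{: Rs}|%:R.

Lemma prob_steps (m : nat) (t : m.-tuple Rs) :
  P [set w | [tuple Z i w | i < m] = t] = (r ^- m)%:E /\
  measurable [set w | [tuple Z i w | i < m] = t].
Proof.
case: Z_iid => mZ pZ iZ.
pose J : {fset nat} := [fset k | k in iota 0 m]%fset.
pose B k := [set nth z0 t k].
have setE : [set w | [tuple Z i w | i < m] = t] = \bigcap_(k in [set` J]) Z k @^-1` B k.
  apply/seteqP; split => w /=.
    move=> h k; rewrite /= !inE mem_iota add0n => /= km.
    by rewrite /B -h (nth_tuple_fun z0 (Z^~ w)).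
  move=> h; apply: eq_from_tnth => i; rewrite tnth_mktuple (tnth_nth z0).
  have /= := h (val i); apply; rewrite !inE mem_iota add0n /=.
  exact: ltn_ord.
rewrite setE; split; last by apply: bigcap_measurableType => k _; exact: mZ.
rewrite iZ; under eq_bigr do rewrite /B pZ.
rewrite prodEFin; congr EFin.
have -> : m = size (J : seq nat).
  by rewrite /J card_fseq undup_id ?iota_uniq// size_iota.
rewrite -exprVn /r -cardfE; elim: (J : seq nat) => [|k s IH].
  by rewrite big_nil expr0.
by rewrite big_cons IH /= exprS.
Qed.

Lemma expectation_steps (m : nat) (phi : m.-tuple Rs -> R) : (forall t, 0 <= phi t) ->
  ('E_P[fun w => phi [tuple Z i w | i < m]] = (\sum_t phi t / r ^+ m)%:E)%E.
Proof.
move=> phi0; rewrite unlock.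
pose A t := [set w | [tuple Z i w | i < m] = t].
have mA t : measurable (A t) by exact: (prob_steps t).2.
have phiE w : (phi [tuple Z i w | i < m])%:E = (\sum_t (phi t * \1_(A t) w)%:E)%E.
  rewrite sumEFin (bigD1 [tuple Z i w | i < m])//= big1; last first.
    move=> t /eqP tw; rewrite indicE memNset ?mulr0// => h; apply: tw.
    by rewrite -h.
  by rewrite indicE mem_set// mulr1 addr0.
under eq_integral do rewrite phiE.
rewrite ge0_integral_sum//; last 2 first.
- move=> t; apply/measurable_EFinP; apply: measurable_funM; first exact: measurable_cst.
  exact: measurable_indic.
- by move=> t w _; rewrite lee_fin mulr_ge0// indicE.
rewrite -sumEFin; apply: eq_bigr => t _.
under eq_integral do rewrite EFinM.
rewrite ge0_integralZl_EFin//.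
  rewrite integral_indic// setIT; apply: (etrans (congr1 (fun x => _ * x)%E (prob_steps t).1)).
  by rewrite -EFinM.
by apply/measurable_EFinP; exact: measurable_indic.
Qed.

Context {dO : measure_display} {Om : measurableType dO}.
Variables (PP : probability Om R) (T : 'rV[int]_d -> Om -> Om).
Hypothesis T_sys : dynamical_system Rs PP T.
Variables (l : nat) (g : Om * l.-tuple Rs -> R).

Lemma path_potential_ext om n (x y : nat -> Rs) :
  (forall k, (k < n + l)%N -> x k = y k) ->
  path_potential T g om n x = path_potential T g om n y.
Proof.
move=> xy; apply: eq_bigr => k _; congr (g (T _ _, _)).
  apply: eq_bigr => j _; rewrite xy//.
  by rewrite (ltn_trans (ltn_ord j))// (leq_trans (ltn_ord k))// leq_addr.
apply: eq_from_tnth => i; rewrite !tnth_mktuple xy//.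
by have := ltn_ord k; have := ltn_ord i; lia.
Qed.

Lemma walk_posE n w : walk_pos Z n w = pos (mkseq (fun k => Z k w) n).
Proof.
rewrite /walk_pos /pos big_map -[n in iota _ n]subn0 -/(index_iota 0 n) big_mkord.
by [].
Qed.

(* The steps n, ..., n + l - 1, on which the true potential also depends, are
   averaged out after bounding their influence. *)
Lemma expectation_lower_potential om n (q : pred (seq Rs)) (B : R) : 0 <= B ->
  (forall s : seq Rs, (size s <= n)%N -> envelope g (T (pos s) om) <= B) ->
  let S := \sum_(s : n.-tuple Rs | q s) expR (lower_potential T g om s) / r ^+ n in
  exists2 e : R,
    ('E_P[fun w => (expR (potential_sum Z T g om n w) *
                    (q (mkseq (fun k => Z k w) n))%:R)%R] = e%:E)%E &
    S <= e <= S * expR (2 * l%:R * B).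
Proof.
move=> B0 hB S.
pose phi (t : (n + l).-tuple Rs) :=
  expR (path_potential T g om n (nth z0 t)) * (q (take n t))%:R.
pose psi (s : n.-tuple Rs) := expR (lower_potential T g om s) * (q s)%:R.
have phi0 t : 0 <= phi t by rewrite mulr_ge0 ?expR_ge0.
have psi0 s : 0 <= psi s by rewrite mulr_ge0 ?expR_ge0.
pose tk (t : (n + l).-tuple Rs) : n.-tuple Rs := [tuple nth z0 t i | i < n].
have tkE (t : (n + l).-tuple Rs) : take n t = tk t :> seq Rs.
  have st : size (take n t) = n by rewrite size_takel// size_tuple leq_addr.
  apply: (@eq_from_nth _ z0) => [|i]; rewrite st ?size_tuple// => i_n.
  by rewrite nth_take// (nth_tuple_fun z0 (nth z0 t)).
have SE : S = \sum_s psi s / r ^+ n.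
  rewrite /S big_mkcond; apply: eq_bigr => s _; rewrite /psi.
  by case: (q s); rewrite ?mulr1 ?mulr0 ?mul0r.
(* Both sums are the expectation of the same function of the first [n] steps, once computed with [n]
   and once with [n + l] steps. *)
have SE' : S = \sum_t psi (tk t) / r ^+ (n + l).
  have := expectation_steps psi0; have := expectation_steps (fun t => psi0 (tk t)).
  have -> : (fun w => psi (tk [tuple Z i w | i < n + l])) =
      (fun w => psi [tuple Z i w | i < n]).
    apply/funext => w; congr psi; apply: eq_from_tnth => i; rewrite !tnth_mktuple.
    have il : (i < n + l)%N by rewrite (leq_trans (ltn_ord i))// leq_addr.
    by rewrite (nth_tuple_fun z0 (Z^~ w)).
  by move=> -> []; rewrite SE.
have r0 : 0 < r by rewrite ltr0n; apply/card_gt0P; exists z0.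
exists (\sum_t phi t / r ^+ (n + l)).
  rewrite -(expectation_steps phi0); congr (expectation _ _); apply/funext => w.
  have hZ k : (k < n + l)%N -> Z k w = nth z0 [tuple Z i w | i < n + l] k.
    by move=> kn; rewrite (nth_tuple_fun z0 (Z^~ w)).
  congr (expR _ * (nat_of_bool (q _))%:R).
    exact: (path_potential_ext om (x := fun k => Z k w) hZ).
  apply: (@eq_from_nth _ z0) => [|i].
    by rewrite size_mkseq size_takel// size_tuple leq_addr.
  rewrite size_mkseq => i_n; rewrite nth_mkseq// nth_take//; apply: hZ.
  by rewrite (leq_trans i_n)// leq_addr.
have bounds t : psi (tk t) <= phi t <= psi (tk t) * expR (2 * l%:R * B).
  rewrite /phi /psi tkE.
  have e : tk t = mkseq (nth z0 t) n :> seq Rs.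
    apply: (@eq_from_nth _ z0) => [|i]; rewrite size_tuple ?size_mkseq// => i_n.
    by rewrite nth_mkseq// (nth_tuple_fun z0 (nth z0 t)).
  rewrite e.
  have hB' k : (k < n)%N -> envelope g (T (pos (mkseq (nth z0 t) k)) om) <= B.
    by move=> kn; apply: hB; rewrite size_mkseq ltnW.
  have /andP[h1 h2] := lower_potential_path T_sys (g := g) B0 hB'.
  rewrite ler_wpM2r ?ler_expR//= mulrAC -expRD ler_wpM2r// ler_expR.
  apply: le_trans h2 _; rewrite lerD2l ler_wpM2r// ler_wpM2l// ler_nat.
  exact: geq_minl.
have ri0 : 0 < (r ^+ (n + l))^-1 by rewrite invr_gt0 exprn_gt0.
have le1 t : psi (tk t) / r ^+ (n + l) <= phi t / r ^+ (n + l).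
  by rewrite (ler_pM2r ri0); have /andP[] := bounds t.
have le2 t : phi t / r ^+ (n + l) <= psi (tk t) / r ^+ (n + l) * expR (2 * l%:R * B).
  by rewrite [leRHS]mulrAC (ler_pM2r ri0); have /andP[] := bounds t.
by rewrite SE' mulr_suml; apply/andP; split; apply: ler_sum => t _.
Qed.

End walk_expectation.

Lemma cvg_EFin_close {R : realType} (a b : nat -> R) (L : \bar R) :
  (forall e : R, 0 < e -> \forall n \near \oo, `|a n - b n| <= e) ->
  (b n)%:E @[n --> \oo] --> L -> (a n)%:E @[n --> \oo] --> L.
Proof.
move=> ab bL.
have d0 : (a n - b n)%:E @[n --> \oo] --> 0%:E.
  apply: cvg_EFin; first exact: nearW.
  by apply/cvgr0Pnorm_le => e e0; exact: ab.
rewrite -[L]adde0; have -> : (fun n => (a n)%:E) = (fun n => ((b n)%:E + (a n - b n)%:E)%E).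
  by apply/funext => n; rewrite -EFinD addrC subrK.
by apply: cvgeD => //; rewrite fin_num_adde_defl.
Qed.

Lemma cvg_thresholds {R : realType} (b : nat -> R) (L : \bar R) :
  (forall p : R, (p%:E < L)%E -> \forall n \near \oo, p <= b n) ->
  (forall q : R, (L < q%:E)%E -> \forall n \near \oo, b n <= q) ->
  (b n)%:E @[n --> \oo] --> L.
Proof.
move=> hlo hup.
have e1 : (L <= limn_einf (fun n => (b n)%:E))%E.
  rewrite leNgt; apply/negP => /lte_rat_between[q q1 q2].
  move: q1; apply/negP; rewrite -leNgt; apply: limn_einf_ge_near.
  by apply: filterS (hlo _ q2) => n; rewrite lee_fin.
have e2 : (limn_esup (fun n => (b n)%:E) <= L)%E.
  rewrite leNgt; apply/negP => /lte_rat_between[q q1 q2].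
  move: q2; apply/negP; rewrite -leNgt; apply: limn_esup_le_near.
  by apply: filterS (hup _ q1) => n; rewrite lee_fin.
have -> : L = limn_einf (fun n => (b n)%:E).
  by apply/eqP; rewrite eq_le e1 (le_trans (limn_einf_sup _) e2).
by apply: cvgn_limn_esup_einf; rewrite (le_trans e2).
Qed.

(** * Free energies as limits of log partition functions *)

Section free_energies.
Context {R : realType} {d : nat} {Rs : {fset 'rV[int]_d}}.
Context {dW : measure_display} {W : measurableType dW}.
Variables (P : probability W R) (Z : nat -> W -> Rs).
Hypothesis Z_iid : iid_uniform_steps P Z.
Context {dO : measure_display} {Om : measurableType dO}.
Variables (PP : probability Om R) (T : 'rV[int]_d -> Om -> Om).
Hypothesis T_sys : dynamical_system Rs PP T.
Variables (l : nat) (g : Om * l.-tuple Rs -> R).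
Variable z0 : Rs.
Variable om : Om.
Hypothesis om_reg : regular_env T g om.

Let H := log_partition T g om.

Let envelope_bounded n : exists2 B : R, 0 <= B &
  forall s : seq Rs, (size s <= n)%N -> envelope g (T (pos s) om) <= B.
Proof.
exists (\sum_(k < n.+1) \sum_(s : k.-tuple Rs) envelope g (T (pos s) om)).
  by apply: sumr_ge0 => k _; apply: sumr_ge0 => s _; exact: envelope_ge0.
move=> s; rewrite -ltnS => sn.
rewrite (bigD1 (Ordinal sn))//= (bigD1 (in_tuple s))//= -addrA lerDl.
apply: addr_ge0; first by apply: sumr_ge0 => t _; exact: envelope_ge0.
by apply: sumr_ge0 => k _; apply: sumr_ge0 => t _; exact: envelope_ge0.
Qed.

(* The expectations are computed up to a factor expR (o(n)) by the lower
   potentials. *)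
Let expectation_cvg (q : nat -> pred (seq Rs)) (S : nat -> R) (L : \bar R) :
  (forall n, S n = \sum_(s : n.-tuple Rs | q n s)
     expR (lower_potential T g om s) / #|{: Rs}|%:R ^+ n) ->
  (forall n, 0 < S n) ->
  (ln (S n) / n%:R)%:E @[n --> \oo] --> L ->
  ((n%:R^-1)%:E * lne ('E_P[fun w => (expR (potential_sum Z T g om n w) *
     (q n (mkseq (fun k => Z k w) n))%:R)%R]))%E @[n --> \oo] --> L.
Proof.
move=> SE S0 SL.
(* The value [e] is fixed with a crude bound that exists for every [n]; the sharp bound, available
   for large [n] only, then applies to the same [e]. *)
have h n : exists e : R, ('E_P[fun w => (expR (potential_sum Z T g om n w) *
       (q n (mkseq (fun k => Z k w) n))%:R)%R] = e%:E)%E /\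
    forall B, 0 <= B ->
      (forall s : seq Rs, (size s <= n)%N -> envelope g (T (pos s) om) <= B) ->
      S n <= e <= S n * expR (2 * l%:R * B).
  have [B B0 hB] := envelope_bounded n.
  have [e eE _] := expectation_lower_potential Z_iid z0 T_sys (q n) B0 hB.
  exists e; split => // B' B'0 hB'.
  have [e' e'E] := expectation_lower_potential Z_iid z0 T_sys (q n) B'0 hB'.
  by move: e'E; rewrite eE => -[<-]; rewrite -SE.
have [e he] := choice h.
have e0 n : 0 < e n.
  have [_ h'] := he n.
  have [B B0 hB] := envelope_bounded n.
  by have /andP[h1 _] := h' B B0 hB; exact: lt_le_trans h1.
have -> : (fun n => ((n%:R^-1)%:E * lne ('E_P[fun w => (expR (potential_sum Z T g om n w) *
     (q n (mkseq (fun k => Z k w) n))%:R)%R]))%E) = (fun n => (ln (e n) / n%:R)%:E).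
  apply/funext => n; rewrite (he n).1 lne_EFin ?e0//.
  by rewrite -EFinM mulrC.
apply: cvg_EFin_close SL => eta eta0.
(* The 1 keeps the divisor positive when [l = 0]. *)
have c0 : 0 < 2 * l%:R + 1 :> R by rewrite ltr_wpDl// mulr_ge0.
have [N hN] := regular_env_site T_sys om_reg (divr_gt0 eta0 c0).
exists N.+1 => // n /= Nn.
have n0 : 0 < n%:R :> R by rewrite ltr0n (leq_trans _ Nn).
have B0 : 0 <= eta / (2 * l%:R + 1) * n%:R by rewrite mulr_ge0// divr_ge0 ?ltW.
have /andP[h1 h2] := (he n).2 _ B0 (fun s sn => hN n s (ltnW Nn) sn).
have l1 : ln (S n) <= ln (e n) by rewrite ler_ln ?posrE.
have l2 : ln (e n) <= ln (S n) + 2 * l%:R * (eta / (2 * l%:R + 1) * n%:R).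
  by rewrite -[X in _ <= _ + X]expRK -lnM ?posrE ?expR_gt0// ler_ln ?posrE ?mulr_gt0 ?expR_gt0.
rewrite -mulrBl normrM (ger0_norm (x := _ - _)) ?subr_ge0//.
rewrite (ger0_norm (x := n%:R^-1)) ?invr_ge0// ler_pdivrMr//.
have : 2 * l%:R * (eta / (2 * l%:R + 1) * n%:R) <= (2 * l%:R + 1) * (eta / (2 * l%:R + 1) * n%:R).
  by apply: ler_wpM2r => //; rewrite lerDl.
have -> : (2 * l%:R + 1) * (eta / (2 * l%:R + 1) * n%:R) = eta * n%:R.
  by field; rewrite gt_eqF.
by lra.
Qed.

Variable lam : cnt Rs -> \bar R.
Hypothesis H_ray : ray_limits H lam.

Let H_ext : extension_stable H := log_partition_extension T_sys z0 om_reg.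

Let H0 : H c0 = 0 := log_partition0 T g om.

Lemma free_energyE : free_energy P Z T g om = ray_sup lam.
Proof.
have [C C0 [N hN]] := extension_lower_bound H_ext H0.
have cJ := total_cvg z0 H_ext H_ray (log_partition_le_total T g z0 om)
  (log_total_le_partition T g z0 om) hN.
apply/cvg_lim => //.
have := @expectation_cvg (fun=> xpredT) (fun n => \sum_(s : n.-tuple Rs)
  expR (lower_potential T g om s) / #|{: Rs}|%:R ^+ n) (ray_sup lam).
move=> /(_ _ _ cJ) h.
have -> : (fun n => (n%:R^-1%:E * lne ('E_P[fun w => expR (potential_sum Z T g om n w)]))%E) =
    (fun n => ((n%:R^-1)%:E * lne ('E_P[fun w => (expR (potential_sum Z T g om n w) *
     1%:R)%R]))%E).
  by apply/funext => n; congr (_ * lne (expectation _ _))%E; apply/funext => w; rewrite mulr1.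
apply: h => // n.
have r0 : 0 < #|{: Rs}|%:R :> R by rewrite ltr0n; apply/card_gt0P; exists z0.
have hs : size (nseq n z0) == n by rewrite size_nseq.
rewrite (bigD1 (Tuple hs))//= ltr_wpDr//.
  by apply: sumr_ge0 => s _; rewrite divr_ge0 ?expR_ge0// exprn_ge0// ltW.
by rewrite divr_gt0 ?expR_gt0// exprn_gt0.
Qed.

Variables (beta : 'rV[R]_d -> Rs -> R) (b : nat -> 'rV[R]_d -> Rs -> bool).
Hypothesis b_r : rounding beta b.

(** The floors together with [b] form a count vector [v n] of size exactly [n] that deviates by at
    most 1 from [n * beta zeta], and [lattice_pt] is its displacement. *)
Lemma free_energy_ptE zeta : step_hull Rs zeta -> weights (beta zeta) ->
  free_energy_pt P Z T g (lattice_pt beta b) om zeta = dir_limit H (beta zeta).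
Proof.
move=> Uz wb.
pose fl n z := Num.floor (n%:R * beta zeta z).
have fl0 n z : 0 <= fl n z by rewrite floor_ge0 mulr_ge0// (wb.1 z).
pose v n : cnt Rs := [ffun z => absz (fl n z + (b n zeta z : nat)%:Z)].
have vE n z : (v n z)%:Z = fl n z + (b n zeta z : nat)%:Z.
  by rewrite ffunE gez0_abs// addr_ge0.
have sv n : csize (v n) = n.
  apply/eqP; rewrite -eqz_nat; apply/eqP.
  rewrite /csize (big_morph Posz PoszD erefl).
  under eq_bigr do rewrite vE.
  by rewrite big_split/= (b_r n Uz).2 addrC subrK.
have pv n : cpos (v n) = lattice_pt beta b n zeta.
  rewrite /cpos /lattice_pt; apply: eq_bigr => z _.
  by rewrite -vE -[Posz _]natz scaler_nat.
have fv n : follows (beta zeta) (v n).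
  move=> z; split; last first.
    move=> bz; have := vE n z; rewrite /fl bz mulr0 floor0 add0r.
    by rewrite ((b_r n Uz).1 z bz) => -[].
  rewrite sv; have -> : (v n z)%:R = (fl n z + (b n zeta z : nat)%:Z)%:~R :> R.
    by rewrite -vE pmulrn.
  rewrite rmorphD/= -pmulrn.
  have /andP[f1 f2] := floor_itv (n%:R * beta zeta z).
  rewrite -/(fl n z) in f1 f2; rewrite intrD in f2.
  have /andP[b0 b1] : 0 <= ((b n zeta z)%:R : R) <= 1.
    by case: (b n zeta z); rewrite ?lexx ?ler01.
  have : 0 <= #|{: Rs}|%:R :> R by [].
  by rewrite ler_norml /dev; move: f1 f2; lra.
apply/cvg_lim => //.
have := @expectation_cvg (fun n s => pos s == lattice_pt beta b n zeta)
  (fun n => lower_partition T g om (csize (v n)) (cpos (v n))) (dir_limit H (beta zeta)).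
move=> /(_ _ _ _) h.
have -> : (fun n => (n%:R^-1%:E * lne ('E_P[fun w => (expR (potential_sum Z T g om n w) *
      \1_[set w' | walk_pos Z n w' = lattice_pt beta b n zeta] w)%R]))%E) =
    (fun n => ((n%:R^-1)%:E * lne ('E_P[fun w => (expR (potential_sum Z T g om n w) *
     (pos (mkseq (fun k => Z k w) n) == lattice_pt beta b n zeta)%:R)%R]))%E).
  apply/funext => n; congr (_ * lne (expectation _ _))%E; apply/funext => w.
  congr (_ * _); rewrite indicE; congr (nat_of_bool _)%:R.
  rewrite -walk_posE; apply/idP/idP => [/set_mem/= ->//|/eqP h'].
  exact: mem_set.
apply: h => [n|n|].
- by rewrite sv pv.
- exact: lower_partition_gt0.
apply: cvg_thresholds => p pl.
  have [N hN] := dir_limit_gt pl.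
  exists N.+1 => // n /= Nn; rewrite ler_pdivlMr ?ltr0n ?(leq_trans _ Nn)//.
  by have h' := hN (v n) (fv n); rewrite sv in h'; exact: h' (ltnW Nn).
have [N hN] := dir_limit_lt H_ext H_ray wb pl.
exists N.+1 => // n /= Nn; rewrite ler_pdivrMr ?ltr0n ?(leq_trans _ Nn)//.
by have h' := hN (v n) (fv n); rewrite sv in h'; exact: h' (ltnW Nn).
Qed.

End free_energies.

(** * The free energy as a function of the direction *)

Section dir_limit_function.
Context {R : realType} {d : nat} {Rs : {fset 'rV[int]_d}}.
Hypothesis Rs_neq0 : Rs != fset0.
Variable z0 : Rs.
Variables (H : cnt Rs -> R) (lam : cnt Rs -> \bar R).
Hypothesis H_ext : extension_stable H.
Hypothesis H_ray : ray_limits H lam.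
Hypothesis H_pos : forall u v, csize u = csize v -> cpos u = cpos v -> H u = H v.
Hypothesis H0 : H c0 = 0.
Variable J : nat -> R.
Hypothesis H_le_J : forall u, H u <= J (csize u).
Hypothesis J_le_H : forall n, exists2 u : cnt Rs, csize u = n &
  J n <= H u + #|{: Rs}|%:R * ln n.+1%:R.
Hypothesis lam_super : ray_superadditive lam.
Variable f : 'rV[R]_d -> \bar R.
Let U : set 'rV[R]_d := @step_hull R d Rs.
Hypothesis fE : forall alpha : Rs -> R, weights alpha ->
  f (barycenter alpha) = dir_limit H alpha.

Lemma relint_infinite : ray_sup lam = +oo%E ->
  forall x, relint U x -> f x = +oo%E.
Proof.
move=> supoo x /(relint_positive_weights Rs_neq0)[a [wa a0 ->]].
have [C C0 [N hN]] := extension_lower_bound H_ext H0.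
by rewrite fE//; exact: (dir_limit_infinite z0 H_ext H_ray lam_super hN).
Qed.

Hypothesis sup_fin : (ray_sup lam < +oo)%E.

Lemma hull_bounded : exists2 C : R, 0 <= C & forall x, U x -> (`|f x| <= C%:E)%E.
Proof.
have [C C0 [N hN]] := extension_lower_bound H_ext H0.
have lo x : U x -> ((- C)%:E <= f x)%E.
  by move=> /step_hullP[a wa ->]; rewrite fE//; exact: dir_limit_ge_lower hN _.
have hi x : U x -> (f x <= ray_sup lam)%E.
  move=> /step_hullP[a wa ->]; rewrite fE//.
  exact: (dir_limit_le_ray_sup z0 H_ext H_ray H_le_J J_le_H wa).
(* A point of [U] excludes the value [-oo] of [ray_sup lam]. *)
have [x rx] := @relint_nonempty R d Rs Rs_neq0.
have := le_trans (lo x rx.1) (hi x rx.1).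
move: hi sup_fin; case: (ray_sup lam) => [s| |]// hi _ _.
exists (C + `|s|) => [|y Uy]; first by rewrite addr_ge0// ltW.
have := lo y Uy; have := hi y Uy; case: (f y) => // r.
rewrite !lee_fin => h1 h2; rewrite ler_norml.
by have := ler_norm s; have := normr_ge0 s; lra.
Qed.

Lemma hull_stable : segment_stable f (Rs := Rs).
Proof.
move=> eta eta0; have [C C0 hC] := hull_bounded.
have [t0 t00 ht] := dir_limit_mix H_ext (divr_gt0 eta0 (ltr0n _ 2)).
have C1 : 0 < 2 * (C + 1) by rewrite mulr_gt0// ltr_wpDl.
(* [dir_limit_mix] loses [eta / 2]; replacing [(1 - t) * r] by [r] loses at most
   [t * (C + 1) <= eta / 2]. *)
exists (Num.min t0 (eta / (2 * (C + 1)))); first by rewrite lt_min t00 divr_gt0.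
move=> t x y /andP[tge0]; rewrite le_min => /andP[tt0 tC] t1 Ux.
have rC (r : R) : (r%:E < f x)%E -> r < C.
  move=> rf; rewrite -lte_fin; apply: lt_le_trans rf _.
  by apply: le_trans (hC x Ux); exact: lee_abs.
move: Ux rC => /step_hullP[a wa ->] rC /step_hullP[a' wa' ->] r ra.
have rltC := rC r ra.
rewrite -barycenter_lin fE; last by apply: weights_mix => //; rewrite tge0.
rewrite fE// in ra.
have tt0' : 0 <= t <= t0 by rewrite tge0.
have wm : weights (fun z => (1 - t) * a z + t * a' z).
  by apply: weights_mix => //; rewrite tge0.
have dom z : (1 - t) * a z <= (1 - t) * a z + t * a' z.
  by rewrite lerDl mulr_ge0// (wa'.1 z).
apply: le_trans (ht _ _ t r wm wa tt0' dom ra); rewrite lee_fin.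
have : t * r <= t * (C + 1) by apply: ler_wpM2l => //; lra.
have : t * (2 * (C + 1)) <= eta by rewrite -ler_pdivlMr.
by lra.
Qed.

Lemma relint_concave : concave_on (relint U) f.
Proof.
move=> x y t rx ry /andP[t0 t1]; have [C C0 hC] := hull_bounded.
have fin z : U z -> exists r : R, f z = r%:E.
  move=> /hC; case: (f z) => [r| |]//; first by exists r.
have [a [wa a0 xE]] := relint_positive_weights Rs_neq0 rx.
have [a' [wa' a0' yE]] := relint_positive_weights Rs_neq0 ry.
have wm : weights (fun z => t * a z + (1 - t) * a' z).
  have := @weights_mix R d Rs a a' (1 - t); rewrite subKr; apply => //.
  by rewrite subr_ge0 t1/= gerBl.
have pE : t *: x + (1 - t) *: y = barycenter (fun z => t * a z + (1 - t) * a' z).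
  by rewrite barycenter_lin -xE -yE.
have [r rE] := fin x rx.1; have [r' r'E] := fin y ry.1.
have [s sE] : exists s : R, f (t *: x + (1 - t) *: y) = s%:E.
  by apply: fin; rewrite pE; exact: step_hull_barycenter.
rewrite rE r'E sE -!EFinM -EFinD lee_fin; apply/ler_addgt0Pr => e e0.
have e1 : ((r - e)%:E < dir_limit H a)%E.
  by rewrite -fE// -xE rE lte_fin ltrBlDr ltrDl.
have e2 : ((r' - e)%:E < dir_limit H a')%E.
  by rewrite -fE// -yE r'E lte_fin ltrBlDr ltrDl.
have t01 : 0 <= t <= 1 by rewrite t0.
have := dir_limit_concave z0 H_ext H_ray lam_super wa wa' a0 a0' t01 e1 e2.
by rewrite -fE// -pE sE lee_fin; lra.
Qed.

End dir_limit_function.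

Theorem theorem2p6 (R : realType) (d : nat) (d_gt0 : (0 < d)%N)
  (Rs : {fset 'rV[int]_d}) (Rs_neq0 : Rs != fset0)
  (dW : measure_display) (W : measurableType dW) (P : probability W R)
  (Z : nat -> W -> Rs) (Z_iid : iid_uniform_steps P Z)
  (dO : measure_display) (Om : measurableType dO) (PP : probability Om R)
  (T : 'rV[int]_d -> Om -> Om) (T_sys : dynamical_system Rs PP T)
  (PP_erg : ergodic Rs PP T)
  (l : nat) (g : Om * l.-tuple Rs -> R) (g_L : class_L PP T g)
  (beta : 'rV[R]_d -> Rs -> R) (beta_w : step_weights beta)
  (b : nat -> 'rV[R]_d -> Rs -> bool) (b_r : rounding beta b) :
  let U := @step_hull R d Rs in
  let Lam := free_energy P Z T g in
  let Lam_pt := free_energy_pt P Z T g (lattice_pt beta b) in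
  (exists c : \bar R, {ae PP, forall om, Lam om = c}) /\
  (exists F : 'rV[R]_d -> \bar R, {ae PP, forall om,
    (Lam om = +oo%E -> forall zeta, relint U zeta -> Lam_pt om zeta = +oo%E) /\
    ((Lam om < +oo)%E ->
      [/\ lsc_on U (Lam_pt om) /\ bounded_on U (Lam_pt om),
          concave_on (relint U) (Lam_pt om),
          {within relint U, continuous (Lam_pt om)},
          unique_cont_ext (relint U) U (Lam_pt om) F
        & forall zeta, U zeta -> usc_reg U (Lam_pt om) zeta = F zeta])}).
Proof.
move=> U Lam Lam_pt.
have [z zR] := fset0Pn _ Rs_neq0; pose z0 : Rs := [` zR]%fset.
have [c hc] := ray_limit_constants T_sys g_L PP_erg z0.
have c_super := ray_constants_super T_sys g_L z0 hc.
have good := ae_and (class_L_regular g_L) (ae_and (ae_ray_limits T_sys g_L z0) hc).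
have wb zeta : U zeta -> weights (beta zeta).
  by move=> /beta_w[h1 h2 _ _]; split => // z'; case/andP: (h1 z').
have bb zeta : U zeta -> zeta = barycenter (beta zeta) by move=> /beta_w[].
pose H om := log_partition T g om.
pose lam om (u : cnt Rs) := ray_limit T g u om.
have supE om : (forall u, cpositive u -> lam om u = c u) -> ray_sup (lam om) = ray_sup c.
  move=> hu; congr ereal_sup; apply/seteqP; split => _ [u pu <-]; by exists u; rewrite ?hu.
have lam_super om : (forall u, cpositive u -> lam om u = c u) -> ray_superadditive (lam om).
  move=> hu u v r s pu pv; rewrite (hu u pu) (hu v pv).
  have puv : cpositive (cadd u v) by move=> z'; rewrite ffunE addn_gt0 pu.
  by rewrite (hu _ puv); exact: c_super.
have LamE om : regular_env T g om -> ray_limits (H om) (lam om) ->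
    (forall u, cpositive u -> lam om u = c u) -> Lam om = ray_sup c.
  by move=> h1 h2 h3; rewrite /Lam (free_energyE Z_iid T_sys z0 h1 h2) supE.
(* [Lam_pt] is computed with the prescribed weights [beta]; they are exchanged here for any weights
   with the same barycenter, such as positive ones or mixtures. *)
have LptE om : regular_env T g om -> ray_limits (H om) (lam om) ->
    forall alpha : Rs -> R, weights alpha ->
    Lam_pt om (barycenter alpha) = dir_limit (H om) alpha.
  move=> h1 h2 alpha wa; have Ua := step_hull_barycenter wa.
  rewrite /Lam_pt (free_energy_ptE Z_iid T_sys z0 h1 h2 b_r Ua (wb _ Ua)).
  apply: dir_limit_weights_eq (wb _ Ua) wa (esym (bb _ Ua)).
  - exact: (log_partition_extension T_sys z0 h1).
  - exact: h2.
  - exact: log_partition_pos.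
split.
  by exists (ray_sup c); apply: filterS good => om [h1 [h2 h3]]; exact: LamE.
(* [F] is the regularization at one good environment [om0]. All good environments have the same free
   energy on the relative interior, so uniqueness of continuous extensions carries [F] over to
   them. *)
have [om0 [r0 [l0 c0']]] := ae_exists good.
exists (usc_reg U (Lam_pt om0)); apply: filterS good => om [h1 [h2 h3]].
have ext om' (h : regular_env T g om') := log_partition_extension T_sys z0 h.
split=> [Loo zeta rz|Lfin].
  apply: (relint_infinite Rs_neq0 z0 (ext om h1) h2 (log_partition0 T g om)
    (lam_super om h3) (LptE om h1 h2) _ rz).
  by rewrite (supE om h3) -(LamE om h1 h2 h3).
(* Finiteness is known at [om]; through the constants [c] it passes to [om0]. *)
have sup_fin om' : (forall u, cpositive u -> lam om' u = c u) -> (ray_sup (lam om') < +oo)%E.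
  by move=> hu; rewrite (supE om' hu) -(LamE om h1 h2 h3).
have bnd om' (k1 : regular_env T g om') (k2 : ray_limits (H om') (lam om'))
    (k3 : forall u, cpositive u -> lam om' u = c u) :=
  hull_bounded Rs_neq0 z0 (ext om' k1) k2 (log_partition0 T g om')
    (log_partition_le_total T g z0 om') (log_total_le_partition T g z0 om')
    (LptE om' k1 k2) (sup_fin om' k3).
have stab om' (k1 : regular_env T g om') (k2 : ray_limits (H om') (lam om'))
    (k3 : forall u, cpositive u -> lam om' u = c u) :=
  hull_stable Rs_neq0 z0 (ext om' k1) k2 (log_partition0 T g om')
    (log_partition_le_total T g z0 om') (log_total_le_partition T g z0 om')
    (LptE om' k1 k2) (sup_fin om' k3).
have [C C0 hC] := bnd om h1 h2 h3.
have [C' C'0 hC'] := bnd om0 r0 l0 c0'.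
have st := stab om h1 h2 h3; have st0 := stab om0 r0 l0 c0'.
have same x : relint U x -> Lam_pt om0 x = Lam_pt om x.
  move=> /(relint_positive_weights Rs_neq0)[a [wa a0 ->]].
  rewrite (LptE om0 r0 l0 a wa) (LptE om h1 h2 a wa).
  apply/eqP; rewrite eq_le; apply/andP; split.
    apply: (dir_limit_deterministic (ext om0 r0) l0 (ext om h1) h2 _ wa a0) => u pu.
    by rewrite [LHS]c0'// [RHS]h3.
  apply: (dir_limit_deterministic (ext om h1) h2 (ext om0 r0) l0 _ wa a0) => u pu.
  by rewrite [RHS]c0'// [LHS]h3.
have extF : cont_ext (relint U) U (Lam_pt om) (usc_reg U (Lam_pt om0)).
  split; first exact: (usc_reg_continuous hC' st0).
  by move=> x rx; rewrite (usc_reg_relint hC' st0 rx) same.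
have extG : cont_ext (relint U) U (Lam_pt om) (usc_reg U (Lam_pt om)).
  split; first exact: (usc_reg_continuous hC st).
  by move=> x rx; rewrite (usc_reg_relint hC st rx).
split.
- by split; [exact: (segment_stable_lsc hC st)|exists C].
- exact: (relint_concave Rs_neq0 z0 (ext om h1) h2 (log_partition0 T g om)
    (log_partition_le_total T g z0 om) (log_total_le_partition T g z0 om)
    (lam_super om h3) (LptE om h1 h2) (sup_fin om h3)).
- exact: (segment_stable_relint_continuous hC st).
- split; first exact: extF.
  by move=> h' exth'; exact: (cont_ext_unique Rs_neq0 extF exth').
- exact: (cont_ext_unique Rs_neq0 extF extG).
Qed.
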